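(* Let $G$ be a non-bipartite graph that is $4$-colourable (i.e., admits a graph homomorphism $G\to K_4$). Then the problem $\mathrm{PCSP}(G,K_4)$ is NP-hard.
   Context: Graphs are finite and undirected, viewed as symmetric binary relations $E(G)\subseteq V(G)\times V(G)$ (loops allowed). A graph homomorphism $f\colon G\to H$ is a map $V(G)\to V(H)$ with $(u,v)\in E(G)\Rightarrow (f(u),f(v))\in E(H)$; write $G\to H$ if one exists. $K_k$ is the complete loopless graph on $k$ vertices. For graphs $G\to H$, the promise problem $\mathrm{PCSP}(G,H)$ is: given an input graph $I$, output YES if $I\to G$ and NO if $I\not\to H$ (inputs satisfying neither condition may be answered arbitrarily). *)

(* Defs.v *)
From mathcomp Require Import all_boot all_order all_algebra.

Set Implicit Arguments.
Unset Strict Implicit.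
Unset Printing Implicit Defensive.

Import GRing.Theory.

Record graph := Graph {
  vertex :> finType;
  edge : rel vertex;
  edge_sym : symmetric edge
}.

Definition hom_to (G H : graph) : Prop :=
  exists f : G -> H, forall u v : G, edge u v -> edge (f u) (f v).

Definition bipartite (G : graph) : Prop :=
  exists A : {set G}, forall u v : G, edge u v -> (u \in A) != (v \in A).

Lemma neq_sym (T : eqType) : symmetric (fun u v : T => u != v).
Proof. by move=> u v; rewrite eq_sym. Qed.

Definition complete_graph (k : nat) : graph := Graph (@neq_sym 'I_k).

(* Deterministic multitape Turing machines over the input alphabet bool.  The
   tapes are infinite in both directions and [None] is the blank symbol.  Both
   the states and the tuples of scanned symbols range over finite types, so
   [tm_trans] is a finite table. *)
Inductive move := MoveLeft | Stay | MoveRight.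

Record tm := TM {
  tm_tapes : nat;  (* the machine has [tm_tapes.+1] tapes *)
  tm_work : finType;
  tm_state : finType;
  tm_start : tm_state;
  tm_halt : pred tm_state;
  tm_trans : tm_state ->
    {ffun 'I_tm_tapes.+1 -> option (bool + tm_work)} ->
    tm_state * {ffun 'I_tm_tapes.+1 -> option (bool + tm_work) * move}
}.

Section Execution.
Variable M : tm.

Definition cell : Type := option (bool + tm_work M).

Record config := Config {
  cf_state : tm_state M;
  cf_head : 'I_(tm_tapes M).+1 -> int;
  cf_tape : 'I_(tm_tapes M).+1 -> int -> cell
}.

Definition shift (m : move) (i : int) : int :=
  match m with
  | MoveLeft => (i - 1)%R
  | Stay => i
  | MoveRight => (i + 1)%R
  end.

Definition step (c : config) : config :=
  if tm_halt (cf_state c) then c else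
  let: (q, a) := tm_trans (cf_state c)
                   [ffun t => cf_tape c t (cf_head c t)] in
  Config q
    (fun t => shift (a t).2 (cf_head c t))
    (fun t i => if i == cf_head c t then (a t).1 else cf_tape c t i).

Definition string_tape (s : seq bool) (i : int) : cell :=
  match i with
  | Posz n => nth None [seq Some (inl b) | b <- s] n
  | Negz _ => None
  end.

Definition init (s : seq bool) : config :=
  Config (tm_start M) (fun=> 0%R)
    (fun t => if t == ord0 then string_tape s else fun=> None).

End Execution.

(* The input is on the first tape, the output on the last one.  Since [step]
   leaves halted configurations unchanged, the conditions below say that the
   machine halts within [size s ^ c + c] steps with output [f s]. *)
Definition polytime (f : seq bool -> seq bool) : Prop :=
  exists (M : tm) (c : nat), forall s : seq bool,
    let final := iter (size s ^ c + c) (@step M) (init M s) in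
    tm_halt (cf_state final) /\
    cf_tape final ord_max =1 @string_tape M (f s).

Definition pair_string (s w : seq bool) : seq bool :=
  flatten [seq [:: true; b] | b <- s] ++ false :: w.

Definition NP (L : seq bool -> Prop) : Prop :=
  exists (V : seq bool -> bool) (c : nat),
    polytime (fun s => [:: V s]) /\
    forall s, L s <->
      exists w, size w <= size s ^ c + c /\ V (pair_string s w).

Record promise_problem := PromiseProblem {
  yes_instance : seq bool -> Prop;
  no_instance : seq bool -> Prop
}.

Definition NP_hard (P : promise_problem) : Prop :=
  forall L, NP L ->
    exists f, polytime f /\
      (forall s, L s -> yes_instance P (f s)) /\
      (forall s, ~ L s -> no_instance P (f s)).

(* The number of vertices in unary, followed by the adjacency matrix. *)
Definition graph_code (I : graph) : seq bool :=
  nseq #|I| true ++ false :: [seq edge u v | u <- enum I, v <- enum I].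

Definition PCSP (G H : graph) : promise_problem := {|
  yes_instance s := exists I : graph, s = graph_code I /\ hom_to I G;
  no_instance s := exists I : graph, s = graph_code I /\ ~ hom_to I H
|}.

(* Main.v *)
Require Import Defs.
From mathcomp Require Import all_boot all_order all_algebra.
From mathcomp Require Import ring zify.
From Stdlib Require Import FunctionalExtensionality.

(* A non-bipartite [G] receives a homomorphism from an odd cycle C_l, so it is
   enough to tell C_l-colourable graphs from graphs that are not 4-colourable.

   A 4-colouring f of the power C_l^L gives a Z/2-equivariant map from a torus to
   the box complex of K4, a 2-sphere. Up to the higher homotopy of the sphere such
   maps are classified by vectors a in (Z/2)^L with sum 1. The bit a_S of a set S
   of coordinates is computed from the toroidal grid spanned by a loop winding
   around in the coordinates of S and by the diagonal rotation: it is the holonomy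
   of a linear order of the colours along the loop plus the number of faces
   covering a fixed point of the sphere. It is additive in S, natural in L, and
   the same for colourings that are adjacent in the exponential graph.

   At most 8 l^2 coordinates j have a_j = 1. For such a j, every diagonal line of
   C_l^L contains a point at which the set of colours of a box of side two in the
   coordinates before (or after) j changes when the box is enlarged in direction j;
   but for each point the increasing chain of boxes has at most four changes.

   Given a constraint satisfaction problem, put a power C_l^L on the set L of
   partial solutions of each bounded tuple of variables, with edges between the
   powers of tuples W contained in U along the restriction map. A satisfying
   assignment yields dictators, hence a homomorphism to C_l. In a 4-colouring each
   tuple has a nonempty support of bounded size, the partial solutions with bit 1,
   and the support of W is covered by restrictions from the support of U. If the
   support of U has maximal size relative to U, restriction from slightly larger
   tuples is bijective on supports, and following one element of the support of U
   defines a global solution; no PCP theorem is needed.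

   The constraint problem is the tableau of a verifier for the given language. The
   entries of the resulting adjacency matrix are expressions of bounded arithmetic
   in unary numbers, which a multitape machine evaluates in polynomial time with
   its head positions as registers. *)

Set Implicit Arguments.
Unset Strict Implicit.
Unset Printing Implicit Defensive.
Import GRing.Theory.

(** * Holonomy of columns of colours *)

Definition colour : Type := bool * bool.

(* The linear order of the four colours [(h, l)] by the value of [2 l + h]. *)
Definition colour_gt (a b : colour) : bool :=
  (b.2 < a.2) || (a.2 == b.2) && (b.1 < a.1).

(* [a b c d] are the colours around a 4-cycle, [a] and [c] on one side of the
   bipartition. The box complex of K4 is the surface of a cuboctahedron, and
   [curved] says that the 4-cycle covers the square face {0,2} x {1,3} of it
   (colours numbered by [2 l + h]). *)
Definition curved (a b c d : colour) : bool :=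
  [&& ~~ a.1, ~~ c.1, b.1, d.1, a.2 != c.2 & b.2 != d.2].

(* [p] is the parity of the position of the first argument, i.e. the side of the
   bipartition on which it lies. *)
Definition edge_val (p : bool) (x y : colour) : bool :=
  if p then colour_gt y x else colour_gt x y.

Definition face_val (p : bool) (x y z w : colour) : bool :=
  if p then curved y z w x else curved x y z w.

Definition allc (P : colour -> bool) : bool :=
  [&& P (false, false), P (false, true), P (true, false) & P (true, true)].

Lemma allcP (P : colour -> bool) : allc P -> forall c, P c.
Proof. by case/and4P=> ? ? ? ? [[] []]. Qed.

(* Stokes: modulo 2, the holonomy of the order around a 4-cycle counts the
   curved faces of both orientations. *)
Lemma quad_edges (b : bool) (p x q y : colour) :
  p != x -> x != q -> q != y -> y != p ->
  edge_val b p x (+) edge_val b q x (+) edge_val b p y (+) edge_val b q y =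
  face_val b p x q y (+) face_val (~~ b) p x q y.
Proof.
have H : all (fun b => allc (fun p => allc (fun x => (p != x) ==>
  allc (fun q => (x != q) ==> allc (fun y =>
  [&& q != y & y != p] ==>
  (edge_val b p x (+) edge_val b q x (+) edge_val b p y (+) edge_val b q y ==
  face_val b p x q y (+) face_val (~~ b) p x q y)))))) [:: true; false].
  by vm_compute.
move=> px xq qy yp; have /(allP H) Hb : b \in [:: true; false] by case: (b).
move: (allcP (implyP (allcP (implyP (allcP (allcP Hb p) x) px) q) xq) y).
by rewrite qy yp => /eqP.
Qed.

(* The diagonal of the cube is needed: the proper 4-colouring giving antipodal
   corners the same colour violates the identity. *)
Lemma cube_faces (b : bool) (p x q y p' x' q' y' : colour) :
  [&& p != x, x != q, q != y & y != p] ->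
  [&& p' != x', x' != q', q' != y' & y' != p'] ->
  [&& p != p', x != x', q != q' & y != y'] ->
  (x' != y) || (y' != x) ->
  face_val b p x x' p' (+) face_val b q x x' q' (+)
  face_val b p y y' p' (+) face_val b q y y' q' =
  face_val b p x q y (+) face_val (~~ b) p' x' q' y'.
Proof.
have H : all (fun b => allc (fun p => allc (fun x => (p != x) ==>
  allc (fun q => (x != q) ==> allc (fun y => [&& q != y & y != p] ==>
  allc (fun p' => (p != p') ==> allc (fun x' => [&& p' != x' & x != x'] ==>
  allc (fun q' => [&& x' != q' & q != q'] ==> allc (fun y' =>
  [&& q' != y', y' != p', y != y' & (x' != y) || (y' != x)] ==>
  (face_val b p x x' p' (+) face_val b q x x' q' (+)
  face_val b p y y' p' (+) face_val b q y y' q' ==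
  face_val b p x q y (+) face_val (~~ b) p' x' q' y')))))))))) [:: true; false].
  by vm_compute.
have /(allP H) {H} : b \in [:: true; false] by case: (b).
move=> H /and4P[px xq qy yp] /and4P[px' xq' qy' yp'] /and4P[pp xx qq yy] d.
move: H => /(@allcP _)/(_ p)/(@allcP _)/(_ x).
rewrite px => /(@allcP _)/(_ q); rewrite xq => /(@allcP _)/(_ y).
rewrite qy yp => /(@allcP _)/(_ p'); rewrite pp => /(@allcP _)/(_ x').
rewrite px' xx => /(@allcP _)/(_ q'); rewrite xq' qq => /(@allcP _)/(_ y').
by rewrite qy' yp' yy d => /eqP.
Qed.

Lemma edge_valC (b : bool) (x y : colour) :
  edge_val b x y = edge_val (~~ b) y x.
Proof. by case: b. Qed.

Lemma edge_valN (b : bool) (x y : colour) :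
  x != y -> edge_val b x y (+) edge_val (~~ b) x y.
Proof. by case: b x y => [] [[] []] [[] []]. Qed.

Lemma face_valC (b : bool) (x y z w : colour) :
  face_val b x y z w = face_val (~~ b) y x w z.
Proof. by case: b x y z w => [] [[] []] [[] []] [[] []] [[] []]. Qed.

Lemma face_val_eq1 (b : bool) (x y w : colour) : face_val b x y x w = false.
Proof. by case: b x y w => [] [[] []] [[] []] [[] []]. Qed.

Lemma face_val_eq2 (b : bool) (x y z : colour) : face_val b x y z y = false.
Proof. by case: b x y z => [] [[] []] [[] []] [[] []]. Qed.

Lemma addb_eq (a b : bool) : a (+) b = false -> a = b.
Proof. by case: a b => [] []. Qed.

Lemma addb_transpose4 (a b c d a' b' c' d' : bool) :
  (a (+) a') (+) ((b (+) b') (+) ((c (+) c') (+) (d (+) d'))) =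
  (a (+) b (+) c (+) d) (+) (a' (+) b' (+) c' (+) d').
Proof. by case: a b c d a' b' c' d' => [] [] [] [] [] [] [] []. Qed.

Lemma addb_exchange (a b c d : bool) : a (+) b = c (+) d -> a (+) c = b (+) d.
Proof. by case: a b c d => [] [] [] []. Qed.

Lemma addb_cancel4 (a b s : bool) : s = (a (+) b) (+) (a (+) (b (+) s)).
Proof. by case: a b s => [] [] []. Qed.

Lemma addb_square (x x' s s' a b b' x0 : bool) :
  x = (a (+) b) (+) ((a (+) x0) (+) b') -> x (+) s' = s (+) x' ->
  x' = (a (+) (b (+) s)) (+) ((a (+) x0) (+) (b' (+) s')).
Proof. by move=> ->; case: x' s s' a b b' x0 => [] [] [] [] [] [] []. Qed.

Notation xsum n F := (\big[addb/false]_(0 <= i < n) F i).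

Lemma xsumD n (F G : nat -> bool) :
  \big[addb/false]_(0 <= i < n) (F i (+) G i) = xsum n F (+) xsum n G.
Proof. by rewrite big_split. Qed.

Lemma xsum_telescope n (F : nat -> bool) :
  \big[addb/false]_(0 <= i < n) (F i (+) F i.+1) = F 0 (+) F n.
Proof.
elim: n => [|n IH]; first by rewrite big_geq // addbb.
by rewrite big_nat_recr //= IH addbA addbK.
Qed.

Lemma xsum_double n (F : nat -> bool) :
  xsum (n + n) F = \big[addb/false]_(0 <= i < n) (F i (+) F (i + n)).
Proof.
rewrite xsumD (big_cat_nat (n := n)) ?leq_addr //=; congr (_ (+) _).
have := @big_addn bool false addb 0 (n + n) n xpredT F.
by rewrite add0n addnK.
Qed.

Lemma xsum_true n : \big[addb/false]_(0 <= i < n) true = odd n.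
Proof.
elim: n => [|n IH]; first by rewrite big_geq.
by rewrite big_nat_recr //= IH addbT.
Qed.

Section Columns.

Variable T : nat.
Hypothesis T_odd : odd T.

Definition column := nat -> colour.

Definition proper_col (c : column) :=
  c T = c 0 /\ forall r, r < T -> c r != c r.+1.

Definition adj_col (c d : column) := forall r, r <= T -> c r != d r.

(* For each row one of the two diagonals is required, as in [cube_faces]. *)
Definition skew_col (c d : column) :=
  forall r, r < T -> (c r.+1 != d r) || (d r.+1 != c r).

(* Contribution of two adjacent columns to the invariant of a 4-colouring of a
   toroidal grid with an odd number [T] of rows: the holonomy along row 0 plus
   the number of faces covering a fixed point of the sphere. *)
Definition strip (b : bool) (c d : column) : bool :=
  edge_val b (c 0) (d 0) (+)
  \big[addb/false]_(0 <= r < T) face_val (b (+) odd r) (c r) (d r) (d r.+1) (c r.+1).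

Lemma adj_colC c d : adj_col c d -> adj_col d c.
Proof. by move=> h r /h; rewrite eq_sym. Qed.

Lemma stripC b c d : strip b c d = strip (~~ b) d c.
Proof.
rewrite /strip edge_valC; congr (_ (+) _); apply: eq_bigr => r _.
by rewrite face_valC addNb.
Qed.

Lemma eq_strip b c c' d d' : (forall r, r <= T -> c r = c' r) ->
  (forall r, r <= T -> d r = d' r) -> strip b c d = strip b c' d'.
Proof.
move=> hc hd; rewrite /strip hc // hd //; congr (_ (+) _).
by apply: eq_big_nat => r /andP[_ rT]; rewrite !hc ?hd // ltnW.
Qed.

(** Between rows [r] and [r.+1] the four columns bound a cube, whose side faces [cube_faces] trades
    for its bottom and top. These telescope to the faces in rows 0 and [T], which for odd [T] have
    opposite orientations, so [quad_edges] cancels them against the edges of row 0. *)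
Lemma strip_flat b (p x q y : column) :
  proper_col p -> proper_col x -> proper_col q -> proper_col y ->
  adj_col p x -> adj_col x q -> adj_col q y -> adj_col y p -> skew_col x y ->
  strip b p x (+) strip b q x = strip b p y (+) strip b q y.
Proof.
move=> [pT pp] [xT px] [qT pq] [yT py] apx axq aqy ayp sk.
apply: addb_eq; rewrite -addbA.
pose Q r := face_val (b (+) odd r) (p r) (x r) (q r) (y r).
have -> : strip b p x (+) (strip b q x (+) (strip b p y (+) strip b q y)) =
  (edge_val b (p 0) (x 0) (+) edge_val b (q 0) (x 0) (+)
   edge_val b (p 0) (y 0) (+) edge_val b (q 0) (y 0)) (+)
  \big[addb/false]_(0 <= r < T) (Q r (+) Q r.+1).
  transitivity ((edge_val b (p 0) (x 0) (+) edge_val b (q 0) (x 0) (+)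
   edge_val b (p 0) (y 0) (+) edge_val b (q 0) (y 0)) (+)
  \big[addb/false]_(0 <= r < T)
   (face_val (b (+) odd r) (p r) (x r) (x r.+1) (p r.+1) (+)
    face_val (b (+) odd r) (q r) (x r) (x r.+1) (q r.+1) (+)
    face_val (b (+) odd r) (p r) (y r) (y r.+1) (p r.+1) (+)
    face_val (b (+) odd r) (q r) (y r) (y r.+1) (q r.+1))).
    by rewrite !big_split /strip; apply: addb_transpose4.
  congr (_ (+) _); apply: eq_big_nat => r /andP[_ rT].
  rewrite cube_faces ?apx ?axq ?aqy ?ayp ?(ltnW rT) //=; last by rewrite sk.
    by rewrite /Q /= addbN.
  by rewrite pp ?px ?pq ?py.
rewrite xsum_telescope quad_edges ?apx ?axq ?aqy ?ayp //.
by rewrite /Q pT xT qT yT T_odd addbF addbT addbb.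
Qed.

Definition walk_sum n (c : nat -> column) : bool :=
  \big[addb/false]_(0 <= t < n) strip (odd t) (c t) (c t.+1).

Lemma eq_walk_sum n c c' :
  (forall t r, t <= n -> r <= T -> c t r = c' t r) ->
  walk_sum n c = walk_sum n c'.
Proof.
move=> h; apply: eq_big_nat => t /andP[_ tn].
by apply: eq_strip => r rT; rewrite h // ltnW.
Qed.

(** The squares [d t], [c t.+1], [c t.+2], [d t.+1] are flat, so the difference of the two sums
    telescopes through [g]; for even [n] the labels [odd t] agree when the walks close up. *)
Lemma walk_sum_homotopy n (c d : nat -> column) : ~~ odd n ->
  (forall t, c (t + n) = c t) -> (forall t, d (t + n) = d t) ->
  (forall t, proper_col (c t)) -> (forall t, proper_col (d t)) ->
  (forall t, adj_col (c t) (c t.+1)) -> (forall t, adj_col (c t) (d t.+1)) ->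
  (forall t, adj_col (d t) (c t.+1)) -> (forall t, adj_col (d t) (d t.+1)) ->
  (forall t, skew_col (c t) (d t)) ->
  walk_sum n c = walk_sum n d.
Proof.
move=> n_even cn dn pc pd cc cd dc dd sk.
pose g t := strip (odd t) (c t) (c t.+1) (+) strip (odd t) (d t) (c t.+1).
have gS t : strip (odd t) (d t) (c t.+1) (+) strip (odd t) (d t) (d t.+1) = g t.+1.
  rewrite stripC (stripC _ (d t) (d _)) /g /=.
  rewrite stripC (stripC _ (d t.+1) (d t)) !negbK.
  rewrite [in RHS]stripC (stripC _ (d t.+1) (c _)) /= negbK.
  have := @strip_flat (odd t) (d t) (c t.+1) (c t.+2) (d t.+1).
  have sk' := sk t.+1.
  move=> /(_ (pd _) (pc _) (pc _) (pd _) (dc _) (cc _) (adj_colC (dc _)) (adj_colC (dd _)) sk').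
  exact: addb_exchange.
apply: addb_eq; rewrite /walk_sum -xsumD.
rewrite (eq_bigr (fun t => g t (+) g t.+1)) => [|t _].
  rewrite xsum_telescope /g -(add0n n) cn dn -addSn cn add0n.
  by rewrite (negbTE n_even) addbb.
by rewrite -gS /g addbA addbK.
Qed.

End Columns.

(** * The parity vector of a 4-colouring of a power of an odd cycle *)

Section Parity.

Variable k : nat.
Let l := k.*2.+3.
Notation Zl := ('Z_(k.*2.+3)).
Local Open Scope ring_scope.

Definition nb (x y : Zl) : bool := (x == y + 1) || (y == x + 1).

Lemma nbC x y : nb x y = nb y x.
Proof. by rewrite /nb orbC. Qed.

Lemma nb_add x y a : nb (x + a) (y + a) = nb x y.
Proof. by rewrite /nb -![_ + a + 1]addrAC !(inj_eq (addIr a)). Qed.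

Lemma nbS x : nb x (x + 1).
Proof. by rewrite /nb eqxx orbT. Qed.

Lemma nb_odd t : nb (odd t)%:R (odd t.+1)%:R.
Proof.
have n01 : nb 0 1 by rewrite -{1}[1]add0r nbS.
by rewrite oddS; case: (odd t); rewrite //= nbC.
Qed.

Lemma natl : l%:R = 0 :> Zl.
Proof. by rewrite pchar_Zp. Qed.

Section Vectors.

Variable L : finType.
Notation vec := {ffun L -> Zl}.

Definition nbv (R : {set L}) (x y : vec) : bool := [forall i in R, nb (x i) (y i)].

Lemma nbvP (R : {set L}) (x y : vec) : reflect (forall i, i \in R -> nb (x i) (y i)) (nbv R x y).
Proof. exact: forall_inP. Qed.

Lemma nbvC (R : {set L}) (x y : vec) : nbv R x y = nbv R y x.
Proof. by apply/nbvP/nbvP => h i /h; rewrite nbC. Qed.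

Definition shiftv (v : vec) (a : Zl) : vec := [ffun i => v i + a].

Lemma nbv_shift (R : {set L}) (x y : vec) (a : Zl) : nbv R (shiftv x a) (shiftv y a) = nbv R x y.
Proof. by apply/nbvP/nbvP => h i /h; rewrite !ffunE nb_add. Qed.

(* With [f = g], a proper colouring of the power of the cycle in which only the
   coordinates of [R] matter for adjacency; in general, [f] and [g] are adjacent
   in the exponential graph. *)
Definition crossing (R : {set L}) (f g : vec -> colour) : Prop :=
  forall x y, nbv R x y -> f x != g y.

Variables (T : nat) (beta : nat -> Zl).
Hypothesis T_odd : odd T.
Hypothesis beta_step : forall r, (r < T)%N -> nb (beta r) (beta r.+1).
Hypothesis beta_per : beta T = beta 0%N.

(** The restriction of [f] to the diagonal line through [v], traversed by the closed odd walk
    [beta]. The walk is a parameter because the support bound needs the particular walk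
    [low_beta]. *)
Definition vcol (f : vec -> colour) (v : vec) : column :=
  fun r => f (shiftv v (beta r)).

Lemma vcol_proper (R : {set L}) (f : vec -> colour) (v : vec) : crossing R f f -> proper_col T (vcol f v).
Proof.
move=> ff; split; first by rewrite /vcol beta_per.
move=> r rT; apply: ff; apply/nbvP=> i _.
by rewrite !ffunE ![v i + _]addrC nb_add beta_step.
Qed.

Lemma vcol_adj (R : {set L}) (f g : vec -> colour) (v w : vec) : crossing R f g -> nbv R v w ->
  adj_col T (vcol f v) (vcol g w).
Proof. by move=> fg vw r _; apply: fg; rewrite nbv_shift. Qed.

(* Raising some coordinates by two commutes with a single unit step. *)
Lemma vcol_skew (R S : {set L}) (f g : vec -> colour) (v w : vec) : crossing R f g ->
  (forall i, i \in R -> w i = v i + (i \in S)%:R *+ 2) ->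
  skew_col T (vcol f v) (vcol g w).
Proof.
move=> fg vw r rT; apply/orP.
have /orP[/eqP b|/eqP b] := beta_step rT; [right; rewrite eq_sym|left];
  apply: fg; apply/nbvP => i /vw; rewrite !ffunE b => ->; rewrite /nb.
  case: (i \in S) => /=; last by rewrite addrA mul0rn addr0 eqxx.
  by apply/orP; right; apply/eqP; ring.
case: (i \in S) => /=; first by apply/orP; right; apply/eqP; ring.
by rewrite addrA mul0rn addr0 eqxx.
Qed.

Lemma vcol_walk_homotopy (R : {set L}) (f g : vec -> colour) n (c d : nat -> vec) : ~~ odd n ->
  crossing R f f -> crossing R g g -> crossing R f g ->
  (forall t, c (t + n)%N = c t) -> (forall t, d (t + n)%N = d t) ->
  (forall t, nbv R (c t) (c t.+1)) -> (forall t, nbv R (c t) (d t.+1)) ->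
  (forall t, nbv R (d t) (c t.+1)) -> (forall t, nbv R (d t) (d t.+1)) ->
  (forall t, exists S : {set L},
     forall i, i \in R -> d t i = c t i + (i \in S)%:R *+ 2) ->
  walk_sum T n (fun t => vcol f (c t)) = walk_sum T n (fun t => vcol g (d t)).
Proof.
move=> n_even ff gg fg cn dn cc cd dc dd sk.
have gf : crossing R g f by move=> x y; rewrite nbvC eq_sym; apply: fg.
apply: walk_sum_homotopy => //.
- by move=> t; rewrite cn.
- by move=> t; rewrite dn.
- by move=> t; apply: vcol_proper ff.
- by move=> t; apply: vcol_proper gg.
- by move=> t; apply: vcol_adj ff _.
- by move=> t; apply: vcol_adj fg _.
- by move=> t; apply: vcol_adj gf _.
- by move=> t; apply: vcol_adj gg _.
- by move=> t; have [S hS] := sk t; apply: vcol_skew fg hS.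
Qed.

(* The loop winding twice around the cycle in the coordinates of [S] and
   flip-flopping along an edge in the others. *)
Definition gamma (S : {set L}) (t : nat) : vec :=
  [ffun i => if i \in S then t%:R else (odd t)%:R].

Definition parity (f : vec -> colour) (S : {set L}) : bool :=
  walk_sum T l.*2 (fun t => vcol f (gamma S t)).

Lemma gamma_per S t : gamma S (t + l.*2)%N = gamma S t.
Proof.
apply/ffunP=> i; rewrite !ffunE oddD odd_double addbF.
by rewrite natrD -(addnn l) (natrD _ l) natl !addr0.
Qed.

Lemma nbv_gamma (R S : {set L}) t : nbv R (gamma S t) (gamma S t.+1).
Proof.
apply/nbvP=> i _; rewrite !ffunE; case: ifP => _; last exact: nb_odd.
by rewrite -natr1 nbS.
Qed.

Lemma parity_crossing (R S : {set L}) (f g : vec -> colour) :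
  crossing R f f -> crossing R g g -> crossing R f g -> parity f S = parity g S.
Proof.
move=> ff gg fg; apply: (@vcol_walk_homotopy R); rewrite ?odd_double //;
  try exact: gamma_per; try exact: nbv_gamma.
by move=> t; exists set0 => i _; rewrite inE mul0rn addr0.
Qed.

Lemma crossing_sub (R R' : {set L}) (f g : vec -> colour) :
  R \subset R' -> crossing R f g -> crossing R' f g.
Proof.
move=> /subsetP sR fg x y /nbvP h; apply: fg; apply/nbvP=> i /sR; exact: h.
Qed.

(** The loops [gamma S] and [gamma set0] agree in all coordinates that matter for adjacency, hence
    are homotopic. *)
Lemma parity_disjoint (R S : {set L}) (f : vec -> colour) : crossing R f f -> [disjoint R & S] ->
  parity f S = parity f set0.
Proof.
move=> ff /disjoint_setI0 RS; have e t i : i \in R -> gamma S t i = gamma set0 t i.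
  move=> iR; rewrite !ffunE inE; case: ifP => // iS.
  by move/setP/(_ i): RS; rewrite !inE iR iS.
apply: (@vcol_walk_homotopy R); rewrite ?odd_double //;
  try exact: gamma_per; try exact: nbv_gamma.
- by move=> t; apply/nbvP=> i iR; rewrite e //; apply/nbvP: iR; apply: nbv_gamma.
- by move=> t; apply/nbvP=> i iR; rewrite (e t.+1) //; apply/nbvP: iR; apply: nbv_gamma.
- by move=> t; exists set0 => i iR; rewrite e // inE mul0rn addr0.
Qed.

(** The torus collapses to one diagonal: every face has two equal opposite corners and contributes
    nothing. Each edge is passed at times [t] and [t + l], with opposite labels since [l] is odd, so
    each of the [l] pairs contributes one. *)
Lemma parity_setT (R : {set L}) (f : vec -> colour) : crossing R f f -> parity f setT.
Proof.
move=> ff; pose g (a : Zl) := f [ffun=> a].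
have ge a b : f (shiftv (gamma setT a) b) = g (a%:R + b).
  by rewrite /g; congr f; apply/ffunP=> i; rewrite !ffunE inE.
have gn a : g a != g (a + 1).
  by apply: ff; apply/nbvP=> i _; rewrite !ffunE nbS.
pose u := beta 0.
have strip_edge t : strip T (odd t) (vcol f (gamma setT t)) (vcol f (gamma setT t.+1)) =
   edge_val (odd t) (g (t%:R + u)) (g (t.+1%:R + u)).
  rewrite /strip /vcol !ge; rewrite big1_seq ?addbF // => r /=.
  rewrite mem_index_iota => /andP[_ rT]; rewrite !ge.
  have tS a : t.+1%:R + a = t%:R + (a + 1) :> Zl by rewrite -natr1; ring.
  have /orP[/eqP -> | /eqP ->] := beta_step rT.
    by rewrite (tS (beta r.+1)) face_val_eq1.
  by rewrite (tS (beta r)) face_val_eq2.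
rewrite /parity /walk_sum (eq_bigr _ (fun t _ => strip_edge t)).
rewrite -(addnn l) xsum_double (eq_bigr (fun=> true)) => [|t _].
  by rewrite xsum_true /l /= odd_double.
rewrite oddD -addSn !natrD natl !addr0 /l /= odd_double addbT -natr1 addrAC.
exact: edge_valN (gn _).
Qed.

(* The lattice plane in which the coordinates of [S1] and [S2] vary freely is
   simply connected, so the strips between its points have a potential; the
   diagonal path and the two axis-parallel zigzags then have the same sum. *)
Section Lattice.

Variables (R S1 S2 : {set L}) (f : vec -> colour).
Hypothesis ff : crossing R f f.
Hypothesis disjS : [disjoint S1 & S2].

(** A step in [a] raises the coordinates of [S1] and [S2], a step in [b] raises those of [S1] and
    lowers those of [S2]; the others flip-flop. Steps in [a] alone trace [gamma (S1 :|: S2)],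
    alternating with steps in [b] they trace [gamma S1], and with reversed steps in [b] they trace
    [gamma S2]. *)
Definition lattice_pt (a b : nat) : vec :=
  [ffun i => if i \in S1 then (a + b)%:R else
             if i \in S2 then a%:R - b%:R else (odd (a + b))%:R].

Lemma lattice_stepX a b : nbv setT (lattice_pt a b) (lattice_pt a.+1 b).
Proof.
apply/nbvP=> i _; rewrite !ffunE addSn; case: ifP => _; first by rewrite -natr1 nbS.
by case: ifP => _; [rewrite -natr1 addrAC nbS | exact: nb_odd].
Qed.

Lemma lattice_stepY a b : nbv setT (lattice_pt a b) (lattice_pt a b.+1).
Proof.
apply/nbvP=> i _; rewrite !ffunE addnS; case: ifP => _; first by rewrite -natr1 nbS.
case: ifP => _; last exact: nb_odd.
by rewrite -natr1 opprD addrA nbC -{2}[_ - b%:R](subrK 1) nbS.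
Qed.

Definition lattice_strip (a b a' b' : nat) : bool :=
  strip T (odd (a + b)) (vcol f (lattice_pt a b)) (vcol f (lattice_pt a' b')).

Lemma lattice_potential : exists phi : nat -> nat -> bool, forall a b,
  lattice_strip a b a.+1 b = phi a b (+) phi a.+1 b /\
  lattice_strip a b a b.+1 = phi a b (+) phi a b.+1.
Proof.
have ffT : crossing setT f f by apply: crossing_sub ff; apply: subsetT.
have pr v := vcol_proper v ff.
have square a b : lattice_strip a b a.+1 b (+) lattice_strip a.+1 b a.+1 b.+1 =
                  lattice_strip a b a b.+1 (+) lattice_strip a b.+1 a.+1 b.+1.
  rewrite /lattice_strip (stripC _ _ _ (vcol f (lattice_pt a.+1 b.+1))) addSn /= negbK.
  rewrite addnS (stripC _ _ (vcol f (lattice_pt a b.+1)) (vcol f (lattice_pt a.+1 b.+1))) /= negbK.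
  apply: strip_flat => //; try (by apply: vcol_adj ffT _; rewrite ?lattice_stepX ?lattice_stepY // nbvC ?lattice_stepX ?lattice_stepY).
  (* The corners [(a.+1, b)] and [(a, b.+1)] of the square differ by two exactly in the coordinates
     of [S2]. *)
  move=> r rT; rewrite orbC; apply: (@vcol_skew setT S2 f f) => // i _.
  rewrite !ffunE addSn addnS.
  case: ifP => [iS|_]; first by rewrite (disjointFr disjS iS) mul0rn addr0.
  case: ifP => _; last by rewrite mul0rn addr0.
  by rewrite -!natr1; ring.
exists (fun a b => \big[addb/false]_(0 <= i < a) lattice_strip i 0 i.+1 0 (+)
                   \big[addb/false]_(0 <= j < b) lattice_strip a j a j.+1).
move=> a b; split; last by rewrite [in RHS](big_nat_recr b) //= -addb_cancel4.
elim: b => [|b IH].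
  by rewrite !(big_geq (m := 0) (n := 0)) // !addbF big_nat_recr //= addbA addbb.
rewrite !(big_nat_recr b) //=; move: IH (square a b).
rewrite !(big_nat_recr a) //=.
exact: addb_square.
Qed.

(** The zigzag of [S1] leads from [(0, 0)] to [(l, l)] and that of [S2] from there to [(l.*2, 0)],
    the end of the path of the union. All three sums are differences of [phi]. *)
Lemma parity_setU : parity f (S1 :|: S2) = parity f S1 (+) parity f S2.
Proof.
have [phi phiE] := lattice_potential.
have l_odd : odd l by rewrite /l /= odd_double.
have -> : parity f (S1 :|: S2) = phi 0 0 (+) phi l.*2 0.
  rewrite -(xsum_telescope l.*2 (fun t => phi t 0)); apply: eq_bigr => t _.
  rewrite -(phiE t 0).1 /lattice_strip addn0.
  have e m : gamma (S1 :|: S2) m = lattice_pt m 0.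
    by apply/ffunP=> i; rewrite !ffunE addn0 subr0 inE; do !case: (i \in _).
  by rewrite !e.
pose psi t := phi (uphalf t) t./2.
have -> : parity f S1 = psi 0 (+) psi l.*2.
  rewrite -(xsum_telescope l.*2 psi); apply: eq_bigr => t _.
  have e m : gamma S1 m = lattice_pt (uphalf m) m./2.
    apply/ffunP=> i; rewrite !ffunE uphalf_half -addnA addnn odd_double_half.
    by case: ifP => // _; case: ifP => // _; rewrite natrD addrK.
  rewrite !e /psi; have := odd_double_half t.
  case t2 : (odd t) => /=; rewrite ?add1n ?add0n => tE.
    rewrite uphalf_half t2 /= add1n -(phiE _ _).2 /lattice_strip.
    by rewrite addSn addnn /= odd_double.
  rewrite uphalf_half t2 /= add0n -(phiE _ _).1 /lattice_strip.
  by rewrite addnn odd_double.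
pose psi' t := phi (l + uphalf t)%N (l - t./2)%N.
have -> : parity f S2 = psi' 0 (+) psi' l.*2.
  rewrite -(xsum_telescope l.*2 psi'); apply: eq_big_nat => t /andP[_ tl].
  have e m : (m <= l.*2)%N -> gamma S2 m = lattice_pt (l + uphalf m)%N (l - m./2)%N.
    move=> ml; have ml' : (m./2 <= l)%N by rewrite -(doubleK l) half_leq.
    have ab : (l + uphalf m + (l - m./2) = odd m + l.*2)%N.
      by rewrite uphalf_half; move: ml'; clear; lia.
    apply/ffunP=> i; rewrite !ffunE ab oddD odd_double addbF.
    have -> : (odd m + l.*2)%:R = (odd m)%:R :> Zl.
      by rewrite natrD -(addnn l) (natrD _ l) natl !addr0.
    case: ifP => [iS|_].
      rewrite (disjointFl disjS iS) natrD (natrB _ ml') natl add0r sub0r opprK.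
      by rewrite -natrD uphalf_half -addnA addnn odd_double_half.
    by rewrite oddb; case: ifP.
  rewrite !e ?(ltnW tl) // /psi'.
  have tl' : (t./2 < l)%N by move: tl (odd_double_half t); lia.
  case t2 : (odd t).
    rewrite stripC /= uphalf_half t2 /= add1n.
    have -> : (l - t./2 = (l - (t./2).+1).+1)%N by lia.
    rewrite addbC -(phiE _ _).2 /lattice_strip; congr strip.
    by move: (odd_double_half t); rewrite t2; lia.
  rewrite /= uphalf_half t2 /= add0n addnS -(phiE _ _).1 /lattice_strip.
  by congr strip; move: (odd_double_half t); rewrite t2; lia.
rewrite /psi /psi' doubleK uphalf_double addnn subnn subn0 !addn0.
by rewrite addbA addbK.
Qed.

End Lattice.

End Vectors.
End Parity.

(** * Additivity, minors and translations of the parity vector *)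

Section ParityMeasure.

Variable k : nat.
Let l := k.*2.+3.
Notation Zl := ('Z_(k.*2.+3)).
Local Open Scope ring_scope.

Variables (T : nat) (beta : nat -> Zl).
Hypothesis T_odd : odd T.
Hypothesis beta_step : forall r, (r < T)%N -> nb (beta r) (beta r.+1).
Hypothesis beta_per : beta T = beta 0%N.

Notation par f S := (parity T beta f S).

Definition translate (L : finType) (f : {ffun L -> Zl} -> colour)
  (w : {ffun L -> Zl}) (x : {ffun L -> Zl}) : colour := f [ffun i => x i + w i].

Definition minor (L L' : finType) (p : L -> L') (f : {ffun L -> Zl} -> colour)
  (y : {ffun L' -> Zl}) : colour := f [ffun i => y (p i)].

Lemma crossing_translate (L : finType) (R : {set L}) (f : {ffun L -> Zl} -> colour) w :
  crossing R f f -> crossing R (translate f w) (translate f w).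
Proof.
by move=> ff x y /nbvP h; apply: ff; apply/nbvP=> i /h; rewrite !ffunE nb_add.
Qed.

Lemma parity_minor (L L' : finType) (p : L -> L') (f : {ffun L -> Zl} -> colour)
  (S : {set L'}) : par (minor p f) S = par f (p @^-1: S).
Proof.
apply: eq_walk_sum => t r _ _; rewrite /vcol /minor; congr f.
by apply/ffunP=> i; rewrite !ffunE inE.
Qed.

Section OneFunction.

Variables (L : finType) (Q : {set L}).
Implicit Types (f : {ffun L -> Zl} -> colour) (S R : {set L}).

Lemma parity_set0 f : crossing Q f f -> par f set0 = false.
Proof.
move=> ff; have d : [disjoint set0 & (set0 : {set L})] by rewrite -setI_eq0 setI0.
have := parity_setU T_odd beta_step beta_per ff d.
by rewrite setU0; case: (par f set0).
Qed.

Lemma parity_sum f S : crossing Q f f ->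
  par f S = \big[addb/false]_(i in S) par f [set i].
Proof.
move=> ff; elim: {S}_.+1 {-2}S (ltnSn #|S|) => // n IH S.
have [->|[i iS]] := set_0Vmem S; first by rewrite big_set0 parity_set0.
rewrite (cardsD1 i) iS ltnS => Sn.
rewrite (big_setD1 i) //= -(IH _ Sn) -(parity_setU T_odd beta_step beta_per ff).
  by rewrite setD1K.
by rewrite disjoints1 !inE eqxx.
Qed.

Lemma parity_exists f : crossing Q f f -> exists i, par f [set i].
Proof.
move=> ff; apply/existsP; apply: contraT => /existsPn no.
have := parity_setT beta_step ff; rewrite (parity_sum _ ff) big1 // => i _.
exact: negbTE.
Qed.

Definition flip_walk S R (u : bool -> Zl) (t : nat) : {ffun L -> Zl} :=
  [ffun i => if i \in R then u (odd t) else gamma k S t i].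

Lemma flip_walk_homotopy f S R (u v : bool -> Zl) : crossing Q f f ->
  (forall b, nb (u b) (u (~~ b))) -> (forall b, nb (u b) (v (~~ b))) ->
  (forall b, nb (v b) (v (~~ b))) -> 
  (exists e : bool -> bool, forall b, v b = u b + (e b)%:R *+ 2) ->
  walk_sum T l.*2 (fun t => vcol beta f (flip_walk S R u t)) =
  walk_sum T l.*2 (fun t => vcol beta f (flip_walk S R v t)).
Proof.
move=> ff uu uv vv [d dE].
have per w t : flip_walk S R w (t + l.*2)%N = flip_walk S R w t.
  apply/ffunP=> i; rewrite [LHS]ffunE [RHS]ffunE gamma_per.
  by rewrite oddD odd_double addbF.
have adj w w' t : (forall b, nb (w b) (w' (~~ b))) ->
    nbv Q (flip_walk S R w t) (flip_walk S R w' t.+1).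
  move=> ww; apply/nbvP=> i iQ; rewrite [X in nb X]ffunE [X in nb _ X]ffunE.
  case: ifP => _; first exact: ww.
  by have /nbvP/(_ i iQ) := nbv_gamma k Q S t.
apply: (@vcol_walk_homotopy _ _ _ _ T_odd beta_step beta_per Q); rewrite ?odd_double //.
- by move=> t; apply: adj.
- by move=> t; apply: adj.
- by move=> t; apply: adj => b; rewrite nbC -{2}(negbK b).
- by move=> t; apply: adj.
move=> t; exists (if d (odd t) then R else set0) => i _.
rewrite [LHS]ffunE [flip_walk _ _ _ _ _]ffunE; case: ifP => [iR|iR].
  by rewrite dE; case: (d _); rewrite ?iR // inE.
by case: (d _); rewrite ?inE ?iR mul0rn addr0.
Qed.

(** The coordinates of [R] only flip-flop along the edge from 0 to 1. It is carried to the edge from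
    2 to 3 by way of the edge from 2 to 1, one endpoint moving by two each time. *)
Lemma parity_translate2 f S R : crossing Q f f -> [disjoint R & S] ->
  par (translate f [ffun i => (i \in R)%:R *+ 2]) S = par f S.
Proof.
move=> ff RS.
pose u0 (b : bool) : Zl := b%:R.
pose u1 (b : bool) : Zl := b%:R + (~~ b)%:R *+ 2.
pose u2 (b : bool) : Zl := b%:R + 1 *+ 2.
have n10 (x : Zl) : nb (1 + x) (0 + x) by rewrite nb_add nbC -{1}[1]add0r nbS.
have n12 (x : Zl) : nb (1 + x) (1 *+ 2 + x).
  by rewrite nb_add -[1 *+ 2]/(1 + 1) nbS.
have n32 (x : Zl) : nb (1 + 1 *+ 2 + x) (1 *+ 2 + x).
  by rewrite nb_add nbC addrC nbS.
have E0 b : u0 b = if b then 1 else 0 by case: b.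
have E1 b : u1 b = if b then 1 else 1 *+ 2.
  by rewrite /u1; case: b; rewrite /= ?mul0rn ?addr0 ?add0r.
have E2 b : u2 b = if b then 1 + 1 *+ 2 else 1 *+ 2.
  by rewrite /u2; case: b; rewrite /= ?add0r.
have nE (x y : Zl) : nb x y = nb (x + 0) (y + 0) by rewrite !addr0.
transitivity (walk_sum T l.*2 (fun t => vcol beta f (flip_walk S R u2 t))).
  apply: eq_walk_sum => t r _ _; rewrite /vcol /translate; congr f.
  apply/ffunP=> i; rewrite !ffunE; case: (boolP (i \in R)) => [iR|iR].
    by rewrite /u2 (disjointFr RS iR) addrAC.
  by rewrite mul0rn addr0.
transitivity (walk_sum T l.*2 (fun t => vcol beta f (flip_walk S R u0 t))); last first.
  apply: eq_walk_sum => t r _ _; rewrite /vcol; congr f.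
  apply/ffunP=> i; rewrite !ffunE; case: (boolP (i \in R)) => // iR.
  by rewrite (disjointFr RS iR).
symmetry; transitivity (walk_sum T l.*2 (fun t => vcol beta f (flip_walk S R u1 t))).
  apply: flip_walk_homotopy => //; try (by move=> b; rewrite nE ?E0 ?E1; case: b; rewrite //= nbC).
  by exists negb.
apply: flip_walk_homotopy => //; try (by move=> b; rewrite nE ?E1 ?E2; case: b; rewrite //= nbC).
by exists id => b; rewrite E1 E2; case: b; rewrite //= mul0rn addr0.
Qed.

Lemma parity_translate f S (w : {ffun L -> Zl}) : crossing Q f f -> (forall i, i \in S -> w i = 0) ->
  par (translate f w) S = par f S.
Proof.
(* [k.+2] is the inverse of 2 modulo [l], so [w i] is a sum of [a i] twos; round [m] adds a two in
   the coordinates with [m < a i]. *)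
move=> ff wS; pose a i : nat := (w i * k.+2)%N.
have aE i : (a i)%:R *+ 2 = w i.
  rewrite -mulrnA /a -mulnA natrM natr_Zp.
  have -> : (k.+2 * 2 = l + 1)%N by rewrite /l; lia.
  by rewrite natrD natl add0r mulr1.
pose wm m : {ffun L -> Zl} := [ffun i => (minn m (a i))%:R *+ 2].
have -> : w = wm (\max_i a i).
  by apply/ffunP=> i; rewrite ffunE (minn_idPr _) ?aE //; apply: leq_bigmax.
elim: (\max_i a i) => [|m IH].
  apply: eq_walk_sum => t r _ _; rewrite /vcol /translate; congr f.
  by apply/ffunP=> i; rewrite !ffunE min0n mul0rn addr0.
rewrite -{}IH; pose R := [set i | m < a i]%N.
rewrite -(@parity_translate2 (translate f (wm m)) S R).
- apply: eq_walk_sum => t r _ _; rewrite /vcol /translate; congr f.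
  apply/ffunP=> i; rewrite !ffunE -[RHS]addrA; congr (_ + _).
  rewrite inE -mulrnDl -natrD; congr (_%:R *+ 2).
  by case: ltnP; lia.
- exact: crossing_translate.
rewrite disjoints_subset; apply/subsetP=> i; rewrite !inE => mi.
by apply: contraL mi => /wS; rewrite /a => ->; rewrite mul0n.
Qed.

End OneFunction.
End ParityMeasure.

(** * The parity vector has bounded support *)

(* Fix a coordinate [j]. Along a closed walk of odd length [2 l + 1], coordinates
   before [j] follow [high_walk] and those after [j] follow [low_walk]. At even
   times the coordinates of one side may be doubled ([offsets]) while the boxes at
   consecutive times remain completely joined:
     time        4m          4m+1      4m+2          4m+3
     before j    {2m,2m+2}   {2m+1}    {2m+2}        {2m+3}
     after j     {2m}        {2m+1}    {2m,2m+2}     {2m+1}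
   The last time [2 l] is followed by time 0, both of them even. *)
Definition low_walk (r : nat) : nat := (r %/ 4).*2 + nth 0 [:: 0; 1; 2; 1] (r %% 4).

Definition offsets (b : bool) (r : nat) : seq nat :=
  [seq (r %/ 4).*2 + v | v <- nth [::]
     (if b then [:: [:: 0; 2]; [:: 1]; [:: 2]; [:: 3]]
           else [:: [:: 0]; [:: 1]; [:: 0; 2]; [:: 1]]) (r %% 4)].

Lemma mod4_cases r : exists m, r = 4 * m \/ r = 4 * m + 1 \/ r = 4 * m + 2 \/ r = 4 * m + 3.
Proof. by exists (r %/ 4); lia. Qed.

Definition near (m n : nat) : bool := (m == n.+1) || (n == m.+1).

Lemma div4E m i : i < 4 -> (4 * m + i) %/ 4 = m.
Proof. by move=> i4; rewrite mulnC divnMDl // divn_small ?addn0. Qed.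

Lemma mod4E m i : i < 4 -> (4 * m + i) %% 4 = i.
Proof. by move=> i4; rewrite mulnC modnMDl modn_small. Qed.

Lemma low_walkE m : [/\ low_walk (4 * m) = m.*2, low_walk (4 * m + 1) = m.*2.+1,
  low_walk (4 * m + 2) = m.*2.+2 & low_walk (4 * m + 3) = m.*2.+1].
Proof.
by rewrite /low_walk -{1 2}(addn0 (4 * m)) !div4E // !mod4E //=; split; lia.
Qed.

Lemma offsetsE b m :
  [/\ offsets b (4 * m) = (if b then [:: m.*2; m.*2.+2] else [:: m.*2]),
      offsets b (4 * m + 1) = [:: m.*2.+1],
      offsets b (4 * m + 2) = (if b then [:: m.*2.+2] else [:: m.*2; m.*2.+2]) &
      offsets b (4 * m + 3) = (if b then [:: m.*2.+3] else [:: m.*2.+1])].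
Proof.
rewrite /offsets -{1 2}(addn0 (4 * m)) !div4E // !mod4E //.
by case: b; rewrite /= ?addn0 ?addn1 ?addn2 ?addn3.
Qed.

Lemma offsets_step b r u v : u \in offsets b r -> v \in offsets b r.+1 -> near u v.
Proof.
rewrite /near.
have [m] := mod4_cases r; have [o0 o1 o2 o3] := offsetsE b m.
have [o0' _ _ _] := offsetsE b m.+1.
have e0 : (4 * m).+1 = 4 * m + 1 by lia.
have e1 : (4 * m + 1).+1 = 4 * m + 2 by lia.
have e2 : (4 * m + 2).+1 = 4 * m + 3 by lia.
have e3 : (4 * m + 3).+1 = 4 * m.+1 by lia.
case=> [|[|[|]]] ->; rewrite ?e0 ?e1 ?e2 ?e3 ?o0 ?o1 ?o2 ?o3 ?o0'.
- by case: b {o0 o1 o2 o3 o0'}; rewrite !inE; lia.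
- by case: b {o0 o1 o2 o3 o0'}; rewrite !inE; lia.
- by case: b {o0 o1 o2 o3 o0'}; rewrite !inE; lia.
by case: b {o0 o1 o2 o3 o0'}; rewrite !inE; lia.
Qed.

Section BoundedSupport.

Variable k : nat.
Let l := k.*2.+3.
Notation Zl := ('Z_(k.*2.+3)).
Let T := l.*2.+1.

(** The value [l] at time [T], where the table would give [l + 2], closes the walk up modulo [l] as
    [low_walk] does; both neighbouring values are [l + 1], so it is still a walk. *)
Definition high_walk (r : nat) : nat :=
  if r == T then l else (r %/ 4).*2 + nth 0 [:: 0; 1; 2; 3] (r %% 4).

Definition side_walk (b : bool) : nat -> nat := if b then high_walk else low_walk.

Lemma nb_near (m n : nat) : near m n -> nb (m%:R : Zl)%R n%:R%R.
Proof. by rewrite /nb !natr1 => /orP[/eqP->|/eqP->]; rewrite eqxx ?orbT. Qed.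

Lemma high_walkE m : [/\ high_walk (4 * m) = m.*2, high_walk (4 * m + 1) = m.*2.+1,
  high_walk (4 * m + 2) = m.*2.+2 &
  high_walk (4 * m + 3) = if m == k.+1 then l else m.*2.+3].
Proof.
rewrite /high_walk -{1 2 3}(addn0 (4 * m)) !div4E // !mod4E //= addn0 addn1 addn2 addn3.
have -> : (4 * m == T) = false by rewrite /T /l; lia.
have -> : ((4 * m).+1 == T) = false by rewrite /T /l; lia.
have -> : ((4 * m).+2 == T) = false by rewrite /T /l; lia.
have -> : ((4 * m).+3 == T) = (m == k.+1) by rewrite /T /l; lia.
by split; [lia.. | case: ifP => // _; lia].
Qed.

Lemma side_walk_step b r : r <= T -> near (side_walk b r) (side_walk b r.+1).
Proof.
rewrite /near /side_walk.
have [m] := mod4_cases r; have [l0 l1 l2 l3] := low_walkE m.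
have [h0 h1 h2 h3] := high_walkE m.
have [l0' _ _ _] := low_walkE m.+1; have [h0' _ _ _] := high_walkE m.+1.
have e0 : (4 * m).+1 = 4 * m + 1 by lia.
have e1 : (4 * m + 1).+1 = 4 * m + 2 by lia.
have e2 : (4 * m + 2).+1 = 4 * m + 3 by lia.
have e3 : (4 * m + 3).+1 = 4 * m.+1 by lia.
case=> [|[|[|]]] -> => rT; case: b.
- by rewrite e0 h0 h1; lia.
- by rewrite e0 l0 l1; lia.
- by rewrite e1 h1 h2; lia.
- by rewrite e1 l1 l2; lia.
- by rewrite e2 h2 h3; case: (m =P k.+1) => [->|_]; rewrite ?/l; clear; lia.
- by rewrite e2 l2 l3; lia.
- by rewrite e3 h3 h0'; case: (m =P k.+1) => [->|_]; rewrite ?/l; clear; lia.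
by rewrite e3 l3 l0'; lia.
Qed.

(** These adjacencies deform the flip-flop between [low_walk r] and its successor into the one
    between [side_walk b r] and [side_walk b r.+1]; [low_side_skew] helps with the skewness
    condition. *)
Lemma low_side b r : near (low_walk r) (side_walk b r.+1) /\
  near (low_walk r).+1 (side_walk b r).
Proof.
rewrite /near /side_walk.
have [m] := mod4_cases r; have [l0 l1 l2 l3] := low_walkE m.
have [h0 h1 h2 h3] := high_walkE m.
have [l0' _ _ _] := low_walkE m.+1; have [h0' _ _ _] := high_walkE m.+1.
have e0 : (4 * m).+1 = 4 * m + 1 by lia.
have e1 : (4 * m + 1).+1 = 4 * m + 2 by lia.
have e2 : (4 * m + 2).+1 = 4 * m + 3 by lia.
have e3 : (4 * m + 3).+1 = 4 * m.+1 by lia.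
case=> [|[|[|]]] ->; case: b.
- by rewrite e0 h0 h1 l0; lia.
- by rewrite e0 l0 l1; lia.
- by rewrite e1 h1 h2 l1; lia.
- by rewrite e1 l1 l2; lia.
- by rewrite e2 h2 h3 l2; case: (m =P k.+1) => [->|_]; rewrite ?/l; clear; lia.
- by rewrite e2 l2 l3; lia.
- by rewrite e3 h3 h0' l3; case: (m =P k.+1) => [->|_]; rewrite ?/l; clear; lia.
by rewrite e3 l3 l0'; lia.
Qed.

Lemma low_side_skew b r : near (low_walk r.+1) (side_walk b r).
Proof.
rewrite /near /side_walk.
have [m] := mod4_cases r; have [l0 l1 l2 l3] := low_walkE m.
have [h0 h1 h2 h3] := high_walkE m.
have [l0' _ _ _] := low_walkE m.+1; have [h0' _ _ _] := high_walkE m.+1.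
have e0 : (4 * m).+1 = 4 * m + 1 by lia.
have e1 : (4 * m + 1).+1 = 4 * m + 2 by lia.
have e2 : (4 * m + 2).+1 = 4 * m + 3 by lia.
have e3 : (4 * m + 3).+1 = 4 * m.+1 by lia.
case=> [|[|[|]]] ->; case: b.
- by rewrite e0 h0 l1; lia.
- by rewrite e0 l0 l1; lia.
- by rewrite e1 h1 l2; lia.
- by rewrite e1 l1 l2; lia.
- by rewrite e2 h2 l3; lia.
- by rewrite e2 l2 l3; lia.
- by rewrite e3 h3 l0'; case: (m =P k.+1) => [->|_]; rewrite ?/l; clear; lia.
by rewrite e3 l3 l0'; lia.
Qed.

Lemma offsets_wrap b u v : u \in offsets b l.*2 -> v \in offsets b 0 ->
  near u (l + v).
Proof.
rewrite /near.
have -> : l.*2 = 4 * k.+1 + 2 by rewrite /l; lia.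
have [_ _ -> _] := offsetsE b k.+1; have [] := offsetsE b 0.
by rewrite muln0 => -> _ _ _; case: b; rewrite !inE /l; lia.
Qed.

Lemma side_walk_offsets b r : r < T -> side_walk b r \in offsets b r.
Proof.
rewrite /side_walk.
have [m] := mod4_cases r; have [l0 l1 l2 l3] := low_walkE m.
have [h0 h1 h2 h3] := high_walkE m; have [o0 o1 o2 o3] := offsetsE b m.
case=> [|[|[|]]] -> => rT; rewrite ?o0 ?o1 ?o2 ?o3.
- by case: (b); rewrite ?h0 ?h1 ?l0 ?l1 !inE ?eqxx.
- by case: (b); rewrite ?h0 ?h1 ?l0 ?l1 !inE ?eqxx.
- by case: (b); rewrite ?h2 ?l2 !inE ?eqxx ?orbT.
case: (b); rewrite ?h3 ?l3 !inE ?eqxx //.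
by case: (m =P k.+1) => // mk; move: rT; rewrite mk /T /l; lia.
Qed.

End BoundedSupport.

(** * Parity zero of a coordinate that the boxes do not feel *)

Section InsensitiveCoordinate.

Variable k : nat.
Let l := k.*2.+3.
Notation Zl := ('Z_(k.*2.+3)).
Let T := l.*2.+1.
Local Open Scope ring_scope.

Definition low_beta (r : nat) : Zl := (low_walk r)%:R.

Lemma side_walk_last b : side_walk k b T = l /\ side_walk k b T.+1 = l.+1.
Proof.
have -> : T = (4 * k.+1 + 3)%N by rewrite /T /l; lia.
have -> : (4 * k.+1 + 3).+1 = (4 * k.+2)%N by lia.
have [_ _ _ l3] := low_walkE k.+1; have [_ _ _ h3] := high_walkE k k.+1.
have [l0 _ _ _] := low_walkE k.+2; have [h0 _ _ _] := high_walkE k k.+2.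
rewrite /side_walk /l; case: b; first by rewrite h0 h3 eqxx; split; lia.
by rewrite l0 l3; split; lia.
Qed.

Lemma side_walk_first b : side_walk k b 0 = 0%N /\ side_walk k b 1 = 1%N.
Proof.
have [l0 l1 _ _] := low_walkE 0; have [h0 h1 _ _] := high_walkE k 0.
by rewrite muln0 in l0 l1 h0 h1; rewrite /side_walk; case: b.
Qed.

Lemma low_beta_step r : (r < T)%N -> nb (low_beta r) (low_beta r.+1).
Proof. by move=> rT; rewrite /low_beta; apply: nb_near; apply: (@side_walk_step k false r (ltnW rT)). Qed.

Lemma low_beta_per : low_beta T = low_beta 0%N.
Proof.
rewrite /low_beta; have [e _] := side_walk_last false; have [e0 _] := side_walk_first false.
by rewrite [low_walk T]e [low_walk 0]e0 natl.
Qed.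

Variables (L : finType) (f : {ffun L -> Zl} -> colour).
Hypothesis ff : crossing setT f f.
Variables (j : L) (side : L -> bool) (z : {ffun L -> Zl}).
Hypothesis zj : z j = 0.

Definition inbox (r : nat) (s : Zl) (y : {ffun L -> Zl}) : Prop :=
  y j = s /\ forall i, i != j ->
  exists2 v, v \in offsets (side i) r & y i = z i + v%:R.

(* At even times the colours seen in a box do not depend on coordinate [j].
   Hence the sets of colours of the boxes at consecutive times are disjoint, and
   the colouring can be deformed to one which ignores [j]. *)
Hypothesis good : forall r s s' y, ~~ odd r -> (r < T)%N -> inbox r s y ->
  exists2 y', inbox r s' y' & f y' = f y.

Lemma inbox_adj m n s s' y y' : nb s s' ->
  (forall b u v, u \in offsets b m -> v \in offsets b n -> nb (u%:R : Zl) v%:R) ->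
  inbox m s y -> inbox n s' y' -> f y != f y'.
Proof.
move=> ss step [yj yi] [yj' yi']; apply: ff; apply/nbvP=> i _.
have [->|ij] := eqVneq i j; first by rewrite yj yj'.
have [u ui ->] := yi i ij; have [v vi ->] := yi' i ij.
by rewrite ![z i + _]addrC nb_add; apply: step vi.
Qed.

(** Of two cyclically consecutive times at least one is even. There [good] moves coordinate [j] next
    to its value at the other time without changing the colour, which makes the two points
    adjacent. *)
Lemma inbox_separated r s s' y y' :
  inbox (r %% T) s y -> inbox (r.+1 %% T) s' y' -> f y != f y'.
Proof.
have mT : (r %% T < T)%N by rewrite ltn_mod.
have -> : (r.+1 %% T = if r %% T == l.*2 then 0 else (r %% T).+1)%N.
  rewrite -addn1 -modnDml; case: eqP => [->|ne]; first by rewrite addn1 modnn.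
  by rewrite addn1 modn_small //; move: mT ne; rewrite /T; lia.
move: (r %% T)%N mT => m mT; case: eqP => [ml | ml] iy iy'.
  have [||w iw <-] := good (s' + 1) _ _ iy; rewrite ?ml ?odd_double //.
  apply: inbox_adj iw iy'; first by rewrite nbC nbS.
  move=> b u v; rewrite ml => hu hv; have := nb_near k (offsets_wrap hu hv).
  by rewrite natrD natl add0r.
have step b u v : u \in offsets b m -> v \in offsets b m.+1 -> nb (u%:R : Zl) v%:R.
  by move=> hu hv; apply: nb_near; apply: offsets_step hu hv.
case: (boolP (odd m)) => om.
  have [||w iw <-] := good (s + 1) _ _ iy'; rewrite /= ?om //.
    by move: mT ml; rewrite /T; lia.
  by apply: inbox_adj iy iw => //; rewrite nbS.
have [||w iw <-] := good (s' + 1) _ _ iy => //.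
by apply: inbox_adj iw iy' => //; rewrite nbC nbS.
Qed.

Let base_pt (r t : nat) : {ffun L -> Zl} :=
  shiftv (gamma k [set j] t) (low_beta r) + z.
Let box_pt (r t : nat) : {ffun L -> Zl} :=
  [ffun i => if i == j then t%:R + low_beta r
             else z i + (side_walk k (side i) (r + odd t))%:R].
Let rep (r : nat) : colour :=
  f [ffun i => if i == j then 0 else z i + (side_walk k (side i) (r %% T))%:R].

Lemma box_pt_inbox r t : (r <= T)%N -> inbox ((r + odd t) %% T) (t%:R + low_beta r) (box_pt r t).
Proof.
move=> rT; split; first by rewrite ffunE eqxx.
move=> i ij; rewrite ffunE (negbTE ij).
have : (r + odd t <= T.+1)%N by case: (odd t); rewrite /= ?addn1 ?addn0; lia.
move: (r + odd t)%N => m; rewrite leq_eqVlt ltnS leq_eqVlt.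
have [eT eT1] := side_walk_last (side i); have [e0 e1] := side_walk_first (side i).
case/or3P=> [/eqP->|/eqP->|mT].
- exists 1%N; last by rewrite eT1 -natr1 natl add0r.
  have -> : (T.+1 %% T = 1)%N by rewrite -(addn1 T) modnDl modn_small.
  by rewrite -[X in X \in _]e1; apply: side_walk_offsets.
- exists 0%N; last by rewrite eT natl.
  by rewrite modnn -[X in X \in _]e0; apply: side_walk_offsets.
rewrite modn_small //; exists (side_walk k (side i) m) => //.
exact: side_walk_offsets.
Qed.

Lemma rep_inbox r : exists2 y, inbox (r %% T) 0 y & f y = rep r.
Proof.
exists [ffun i => if i == j then 0 else z i + (side_walk k (side i) (r %% T))%:R] => //.
split; first by rewrite ffunE eqxx.
move=> i ij; rewrite ffunE (negbTE ij); eexists; last by [].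
by apply: side_walk_offsets; rewrite ltn_mod.
Qed.

Lemma base_ptE r t i : base_pt r t i =
  if i == j then t%:R + low_beta r else z i + (odd t + low_walk r)%:R.
Proof.
rewrite !ffunE inE; case: eqP => [->|_]; first by rewrite zj addr0.
by rewrite addrC natrD.
Qed.

Lemma base_box r t r' t' : nb (t%:R + low_beta r) (t'%:R + low_beta r') ->
  (forall b, near (odd t + low_walk r) (side_walk k b (r' + odd t'))) ->
  f (base_pt r t) != f (box_pt r' t').
Proof.
move=> hj hi; apply: ff; apply/nbvP=> i _; rewrite base_ptE ffunE.
by case: eqP => // _; rewrite ![z i + _]addrC nb_add; apply: nb_near.
Qed.

(** Two homotopies: from the loop, translated by [z], to [d], where the other coordinates follow the
    side walks; then to [e], where coordinate [j] is frozen. As [e t] depends only on the parity of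
    [t], its faces are degenerate and its strips at [t] and [t + l] cancel. *)
Lemma insensitive_parity : parity T low_beta f [set j] = false.
Proof.
have T_odd : odd T by rewrite /T /= odd_double.
have step := low_beta_step; have per := low_beta_per.
have zs i : i \in [set j] -> z i = 0 by rewrite inE => /eqP->.
rewrite -(parity_translate T_odd step per ff zs).
have fz : crossing setT (translate f z) (translate f z) by apply: crossing_translate.
pose c t := vcol low_beta (translate f z) (gamma k [set j] t).
pose d t : column := fun r => f (box_pt r t).
pose e t : column := fun r => rep (r + odd t).
have cE t r : c t r = f (base_pt r t).
  by rewrite /c /vcol /translate; congr f; apply/ffunP=> i; rewrite !ffunE.
have dper t : d (t + l.*2)%N = d t.
  rewrite /d /box_pt oddD odd_double addbF.
  by rewrite natrD -(addnn l) (natrD _ l) natl !addr0.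
have nbt t : nb (t%:R : Zl) t.+1%:R by rewrite -natr1 nbS.
have bT : low_beta T = low_beta 0%N := per.
have d_inbox t r : (r <= T)%N -> exists2 y, (exists s, inbox ((r + odd t) %% T) s y) & f y = d t r.
  by move=> rT; eexists; [eexists; apply: box_pt_inbox rT | ].
have e_inbox t r : exists2 y, (exists s, inbox ((r + odd t) %% T) s y) & f y = e t r.
  by have [y iy yE] := rep_inbox (r + odd t); exists y => //; exists 0.
have sep r (a b : colour) :
    (exists2 y, (exists s, inbox (r %% T) s y) & f y = a) ->
    (exists2 y, (exists s, inbox (r.+1 %% T) s y) & f y = b) -> a != b.
  by move=> [y [s iy] <-] [y' [s' iy'] <-]; apply: inbox_separated iy iy'.
have sep_odd t r a b :
    (exists2 y, (exists s, inbox ((r + odd t) %% T) s y) & f y = a) ->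
    (exists2 y, (exists s, inbox ((r + odd t.+1) %% T) s y) & f y = b) -> a != b.
  move=> ha hb; move: ha hb; rewrite oddS.
  case: (odd t); rewrite /= ?addn0 ?addn1 => ha hb; last exact: sep ha hb.
  by rewrite eq_sym; apply: sep hb ha.
have d_proper t : proper_col T (d t).
  split; last first.
    move=> r rT; apply: sep (d_inbox _ _ (ltnW rT)) _.
    by rewrite -addSn; apply: d_inbox.
  rewrite /d; congr f; apply/ffunP=> i; rewrite !ffunE bT.
  case: eqP => // _; have [eT eT1] := side_walk_last (side i).
  have [e0 e1] := side_walk_first (side i).
  case: (odd t); last by rewrite !addn0 eT e0 natl.
  by rewrite addn1 eT1 e1 -(natr1 l) natl add0r.
transitivity (walk_sum T l.*2 d).
  apply: walk_sum_homotopy => //; rewrite ?odd_double //.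
  - by move=> t; rewrite gamma_per.
  - by move=> t; apply: vcol_proper fz.
  - by move=> t; apply: vcol_adj fz _; apply: nbv_gamma.
  - move=> t r rT; rewrite -/(c t) cE; apply: base_box.
      by rewrite nb_add.
    move=> b; have [h1 h2] := low_side k b r.
    by rewrite oddS; case: (odd t); rewrite /= ?addn0 ?addn1 ?add0n ?add1n.
  - move=> t r rT; rewrite -/(c t.+1) cE eq_sym; apply: base_box.
      by rewrite nb_add nbC.
    move=> b; have [h1 h2] := low_side k b r.
    by rewrite oddS; case: (odd t); rewrite /= ?addn0 ?addn1 ?add0n ?add1n.
  - by move=> t r rT; apply: sep_odd (d_inbox _ _ rT) (d_inbox _ _ rT).
  move=> t r rT; apply/orP; left; rewrite -/(c t) cE; apply: base_box.
    by rewrite ![t%:R + _]addrC nb_add nbC step.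
  move=> b; case: (odd t); rewrite /= ?addn0 ?addn1 ?add0n ?add1n; last exact: low_side_skew.
  by have [_ h] := low_side k b r.+1.
transitivity (walk_sum T l.*2 e).
  apply: walk_sum_homotopy => //; rewrite ?odd_double //.
  - by move=> t; rewrite /e oddD odd_double addbF.
  - move=> t; split; first by rewrite /e /rep addnC modnDr add0n.
    by move=> r rT; apply: sep (e_inbox _ _) _; rewrite -addSn; apply: e_inbox.
  - by move=> t r rT; apply: sep_odd (d_inbox _ _ rT) (d_inbox _ _ rT).
  - by move=> t r rT; apply: sep_odd (d_inbox _ _ rT) (e_inbox _ _).
  - by move=> t r rT; apply: sep_odd (e_inbox _ _) (d_inbox _ _ rT).
  - by move=> t r rT; apply: sep_odd (e_inbox _ _) (e_inbox _ _).
  move=> t r rT; apply/orP; right; rewrite eq_sym.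
  by apply: sep (d_inbox _ _ (ltnW rT)) _; rewrite -addSn; apply: e_inbox.
rewrite /walk_sum -(addnn l) xsum_double big1 // => t _.
have stripE t' : strip T (odd t') (e t') (e t'.+1) =
    edge_val (odd t') (rep (odd t')) (rep (~~ odd t')).
  rewrite /strip big1_seq ?addbF // => r _; rewrite /e oddS.
  by case: (odd t'); rewrite /= ?addn0 ?addn1 ?face_val_eq1 ?face_val_eq2.
rewrite !stripE oddD /l /= odd_double addbT edge_valC negbK.
by case: (odd t); rewrite /= addbb.
Qed.

End InsensitiveCoordinate.

(** * Double counting of sensitive points *)

Section SupportBound.

Variable k : nat.
Let l := k.*2.+3.
Notation Zl := ('Z_(k.*2.+3)).
Let T := l.*2.+1.
Local Open Scope ring_scope.

Variables (L : finType) (f : {ffun L -> Zl} -> colour).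
Hypothesis ff : crossing setT f f.
Notation vec := {ffun L -> Zl}.

Definition box (a : Zl) (P : {set L}) (x : vec) : {set vec} :=
  [set y : vec | [forall i, (y i == x i) || (i \in P) && (y i == x i + a)]].

Definition box_colours (a : Zl) (P : {set L}) (x : vec) : {set bool * bool} :=
  [set f y | y in box a P x].

Definition below (o : L -> nat) (m : nat) : {set L} := [set i | (o i < m)%N].

(** Used with [a] equal to 2 and the increasing order for the coordinates before [j], and with [a]
    equal to -2 and the reversed order for those after [j]. *)
Definition sensitive (a : Zl) (o : L -> nat) (j : L) (x : vec) : bool :=
  box_colours a (below o (o j)) x != box_colours a (below o (o j).+1) x.

Lemma box_colours_sub a (P P' : {set L}) (x : vec) : P \subset P' ->
  box_colours a P x \subset box_colours a P' x.
Proof.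
move=> /subsetP PP; apply: imsetS; apply/subsetP=> y; rewrite !inE.
move=> /forallP h; apply/forallP=> i; case/orP: (h i) => [->//|/andP[/PP -> ->]].
by rewrite orbT.
Qed.

(* Enlarging the box one coordinate at a time changes its set of colours at most
   four times. *)
Lemma card_sensitive a (o : L -> nat) x : injective o ->
  (#|[set j | sensitive a o j x]| <= 4)%N.
Proof.
move=> o_inj; pose F m := box_colours a (below o m) x.
have F_mono m n : (m <= n)%N -> (#|F m| <= #|F n|)%N.
  move=> mn; apply/subset_leq_card/box_colours_sub/subsetP=> i.
  by rewrite !inE => /leq_trans; apply.
have F_strict j : sensitive a o j x -> (#|F (o j)| < #|F (o j).+1|)%N.
  move=> h; apply: proper_card; rewrite properEneq [X in X && _]h /=.
  by apply/box_colours_sub/subsetP=> i; rewrite !inE => /ltnW.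
have F4 m : (#|F m| <= 4)%N.
  by apply: leq_trans (max_card _) _; rewrite card_prod card_bool.
have lt4 j : sensitive a o j x -> (#|F (o j)| < 4)%N.
  by move=> /F_strict/leq_trans; apply.
pose g j : 'I_4 := inord #|F (o j)|.
rewrite -(card_in_imset (f := g)); first by apply: leq_trans (max_card _) _; rewrite card_ord.
move=> i j; rewrite !inE => si sj /(congr1 val); rewrite /= !inordK ?lt4 // => e.
apply: o_inj; case: (ltngtP (o i) (o j)) => // lt.
  by have := leq_trans (F_strict _ si) (F_mono _ _ lt); rewrite e ltnn.
by have := leq_trans (F_strict _ sj) (F_mono _ _ lt); rewrite e ltnn.
Qed.

Section OneCoordinate.

Variable j : L.

Definition diag_pt (z : vec) (q s : Zl) : vec :=
  [ffun i => if i == j then s else z i + q].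

Definition rank_up (i : L) : nat := enum_rank i.
Definition rank_down (i : L) : nat := (#|L| - enum_rank i)%N.

Lemma rank_up_inj : injective rank_up.
Proof. by move=> i i' /val_inj/enum_rank_inj. Qed.

Lemma rank_down_inj : injective rank_down.
Proof.
move=> i i'; rewrite /rank_down => e; apply: rank_up_inj.
by apply/eqP; rewrite -(eqn_sub2lE (ltnW (ltn_ord _)) (ltnW (ltn_ord _))) e.
Qed.

(** If enlarging the box in direction [j] shows no new colour, the box displaced by [a] in
    coordinate [j] shows only colours of the original one; multiples of [a] reach every value of
    that coordinate. *)
Lemma insensitive_colours a (o : L -> nat) z q : injective o ->
  (forall s s' : Zl, exists n : nat, s' = s + a *+ n) ->
  (forall s, ~~ sensitive a o j (diag_pt z q s)) ->
  forall s s', box_colours a (below o (o j)) (diag_pt z q s') \subset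
               box_colours a (below o (o j)) (diag_pt z q s).
Proof.
move=> o_inj gen ns s s'; have [n ->] := gen s s'; elim: n => [|n IH].
  by rewrite mulr0n addr0.
apply: subset_trans IH; have /eqP -> := negbNE (ns (s + a *+ n)).
apply/subsetP=> c /imsetP[y]; rewrite inE => /forallP hy ->.
apply: imset_f; rewrite inE; apply/forallP=> i; have := hy i.
rewrite !ffunE !inE; have [->|ij] := eqVneq i j.
  rewrite !ltnn ltnSn /= orbF => /eqP ->.
  by rewrite mulrSr addrA eqxx orbT.
case/orP=> [->//|/andP[h ->]]; rewrite andbT.
by rewrite (ltn_trans h) ?orbT.
Qed.

Lemma generate2 (b : bool) (s s' : Zl) : exists n : nat,
  s' = s + (if b then 1 *+ 2 else - (1 *+ 2)) *+ n.
Proof.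
pose d : Zl := if b then s' - s else s - s'.
have dE : (1 *+ 2) *+ (d * k.+2) = d.
  rewrite -mulrnA mulnC -mulnA mulrnA natr_Zp.
  have -> : (k.+2 * 2 = l + 1)%N by rewrite /l; lia.
  by rewrite mulrnDr mulr1n -mulr_natl natl mul0r add0r.
exists (d * k.+2)%N; case: b @d dE => d dE; last rewrite mulNrn.
  by rewrite dE addrC subrK.
by rewrite dE opprB addrC subrK.
Qed.

Lemma insensitive_diag z :
  (forall q s, ~~ sensitive (1 *+ 2) rank_up j (diag_pt z q s) /\
               ~~ sensitive (- (1 *+ 2)) rank_down j (diag_pt z q s)) ->
  parity T (@low_beta k) f [set j] = false.
Proof.
move=> ns; pose z0 : vec := [ffun i => if i == j then 0 else z i].
have diagE q s : diag_pt z0 q s = diag_pt z q s.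
  by apply/ffunP=> i; rewrite !ffunE; case: eqP.
pose side i := (rank_up i < rank_up j)%N.
have sideN i : i != j -> (rank_down i < rank_down j)%N = ~~ side i.
  move=> ij; have: rank_up i != rank_up j by apply: contra_neq ij => /rank_up_inj.
  rewrite /side /rank_down /rank_up => ne.
  by rewrite ltn_sub2lE ?(ltnW (ltn_ord _)) // -leqNgt ltn_neqAle eq_sym ne.
apply: (@insensitive_parity k L f ff j side z0); first by rewrite ffunE eqxx.
move=> r s s' y r_even _.
have [m rE] : exists m, r = (4 * m)%N \/ r = (4 * m + 2)%N.
  have [m mE] := mod4_cases r; exists m; move: r_even.
  case: mE => [->|[->|[->|->]]] re; [by left| exfalso | by right | exfalso];
    by move: re; rewrite oddD oddM.
(* At time [4 * m] the box extends upwards from [m.*2] in the coordinates before [j]; at time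
   [4 * m + 2] it extends downwards from [m.*2.+2] in those after [j]. *)
have [a [o [q [o_inj gen ns' boxP]]]] : exists a o q, [/\ injective o,
    forall s s' : Zl, exists n : nat, s' = s + a *+ n,
    forall s, ~~ sensitive a o j (diag_pt z0 q s) &
    forall s y, inbox j side z0 r s y <-> y \in box a (below o (o j)) (diag_pt z0 q s)].
  have [o0 _ _ _] := offsetsE true m; have [o0' _ _ _] := offsetsE false m.
  have [_ _ o2 _] := offsetsE true m; have [_ _ o2' _] := offsetsE false m.
  case: rE => ->.
    exists (1 *+ 2), rank_up, (m.*2)%:R; split.
    - exact: rank_up_inj.
    - exact: (generate2 true).
    - by move=> t; rewrite diagE; have [] := ns (m.*2)%:R t.
    move=> t x; rewrite inE; split.
      move=> [xj xi]; apply/forallP=> i; rewrite ffunE inE.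
      have [->|ij] := eqVneq i j; first by rewrite xj eqxx.
      have [v + ->] := xi i ij; rewrite -/(side i); case: (side i).
        rewrite o0 !inE => /orP[/eqP->|/eqP->]; first by rewrite eqxx.
        by apply/orP; right; apply/eqP; rewrite -2!natr1; ring.
      by rewrite o0' inE => /eqP->; rewrite eqxx.
    move=> /forallP h; split.
      by have := h j; rewrite !ffunE inE eqxx ltnn orbF => /eqP.
    move=> i ij; have := h i; rewrite ffunE inE (negbTE ij) -/(side i).
    case: (side i) => /=; last first.
      by rewrite orbF => /eqP->; exists m.*2; rewrite // o0' inE.
    case/orP=> [/eqP->|/eqP->]; [exists m.*2|exists m.*2.+2]; rewrite // ?o0 ?inE ?eqxx ?orbT //.
    by rewrite -2!natr1; ring.
  exists (- (1 *+ 2)), rank_down, (m.*2.+2)%:R; split.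
  - exact: rank_down_inj.
  - exact: (generate2 false).
  - by move=> t; rewrite diagE; have [] := ns (m.*2.+2)%:R t.
  move=> t x; rewrite inE; split.
    move=> [xj xi]; apply/forallP=> i; rewrite ffunE inE.
    have [->|ij] := eqVneq i j; first by rewrite xj eqxx.
    have [v + ->] := xi i ij; rewrite sideN //; case: (side i).
      by rewrite o2 inE => /eqP->; rewrite eqxx.
    rewrite o2' !inE => /orP[/eqP->|/eqP->]; last by rewrite eqxx.
    by apply/orP; right; apply/eqP; rewrite -2!natr1; ring.
  move=> /forallP h; split.
    by have := h j; rewrite !ffunE inE eqxx ltnn orbF => /eqP.
  move=> i ij; have := h i; rewrite ffunE inE (negbTE ij) sideN //.
  case: (side i) => /=.
    by rewrite orbF => /eqP->; exists m.*2.+2; rewrite // o2 inE.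
  case/orP=> [/eqP->|/eqP->]; [exists m.*2.+2|exists m.*2]; rewrite // ?o2' ?inE ?eqxx ?orbT //.
  by rewrite -2!natr1; ring.
move=> /boxP yb; have /subsetP sub := insensitive_colours o_inj gen ns' s' s.
have /sub/imsetP[y' yb' e] : f y \in box_colours a (below o (o j)) (diag_pt z0 q s).
  exact: imset_f.
by exists y' => //; apply/boxP.
Qed.

Definition sensitive2 (x : vec) : bool :=
  sensitive (1 *+ 2) rank_up j x || sensitive (- (1 *+ 2)) rank_down j x.

(** By [insensitive_diag] every [z] has a sensitive point [diag_pt z q s], from which it is
    recovered given [q] and [z j]; there are [l * l] such pairs. *)
Lemma sensitive2_dense : parity T (@low_beta k) f [set j] ->
  (#|{: vec}| <= #|[set x | sensitive2 x]| * (l * l))%N.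
Proof.
move=> par_j.
pose inv (p : vec * (Zl * Zl)) : vec :=
  [ffun i => if i == j then p.2.2 else p.1 i - p.2.1].
have card_Zl : #|{: Zl}| = l by rewrite card_ord.
have -> : (#|[set x | sensitive2 x]| * (l * l) =
    #|setX [set x | sensitive2 x] [set: Zl * Zl]|)%N.
  by rewrite cardsX cardsT card_prod card_Zl.
rewrite -cardsT; apply: leq_trans (leq_imset_card inv _).
apply: subset_leq_card; apply/subsetP=> z _.
have [q [s sens]] : exists q s, sensitive2 (diag_pt z q s).
  have /existsP[q /existsP[s h]] : [exists q, exists s, sensitive2 (diag_pt z q s)].
    apply: contraT => /existsPn ns; rewrite (@insensitive_diag z) // in par_j => q s.
    by have /existsPn/(_ s) := ns q; rewrite /sensitive2 negb_or => /andP[].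
  by exists q, s.
apply/imsetP; exists (diag_pt z q s, (q, z j)); first by rewrite !inE sens.
apply/ffunP=> i; rewrite !ffunE /=; case: eqP => [->//|_].
by rewrite addrK.
Qed.

End OneCoordinate.

(** Counts pairs of a coordinate of parity one and a point sensitive in it: each such coordinate has
    at least a fraction [1 / (l * l)] of all points, and each point has at most four coordinates for
    each of the two orders. *)
Theorem parity_support_bound :
  (#|[set j | parity T (@low_beta k) f [set j]]| <= 8 * (l * l))%N.
Proof.
set J := [set j | _].
have vec_gt0 : (0 < #|{: vec}|)%N by apply/card_gt0P; exists [ffun=> 0].
rewrite -(leq_pmul2r vec_gt0).
apply: (@leq_trans (\sum_(j in J) #|[set x | sensitive2 j x]| * (l * l))).
  rewrite -sum_nat_const; apply: leq_sum => j; rewrite inE.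
  exact: sensitive2_dense.
rewrite -big_distrl /= (mulnAC 8) leq_mul2r.
apply/orP; right.
have -> : (\sum_(j in J) #|[set x | sensitive2 j x]| =
           \sum_x \sum_(j in J) sensitive2 j x)%N.
  rewrite exchange_big /=; apply: eq_bigr => j _.
  by rewrite -sum1dep_card big_mkcond.
rewrite mulnC -sum_nat_const; apply: leq_sum => x _.
apply: (@leq_trans (#|[set j | sensitive (1 *+ 2) rank_up j x]| +
                    #|[set j | sensitive (- (1 *+ 2)) rank_down j x]|)%N); last first.
  by apply: (@leq_add _ _ 4 4); apply: card_sensitive; [apply: rank_up_inj | apply: rank_down_inj].
rewrite -!sum1dep_card big_mkcond [X in (_ <= X + _)%N]big_mkcond [X in (_ <= _ + X)%N]big_mkcond.
rewrite -big_split /=; apply: leq_sum => j _; rewrite /sensitive2.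
by case: (j \in J) => //; move: (sensitive _ rank_up j x) (sensitive _ rank_down j x) => [] [].
Qed.

End SupportBound.

(** * Gadgets for a constraint satisfaction problem *)

Section PartialSolutions.

Variable k : nat.
Let l := k.*2.+3.
Notation Zl := ('Z_(k.*2.+3)).
Definition support_bound : nat := 8 * (l * l).
(* Written as a successor so that ['I_tuple_size] is visibly inhabited. *)
Definition tuple_size : nat := (4 * support_bound.+1).-1.+1.
Notation n := tuple_size.

Lemma tuple_sizeE : n = 4 * support_bound.+1.
Proof. by rewrite /n prednK // muln_gt0. Qed.

Variables (V D : finType) (un : V -> D -> bool) (win : V -> V -> V -> V -> bool)
  (rel4 : D -> D -> D -> D -> bool).

Notation tup := {ffun 'I_n -> V}.
Notation sol := {ffun 'I_n -> D}.
Notation vec := {ffun sol -> Zl}.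

Definition csp_solution (sigma : V -> D) : Prop :=
  (forall u, un u (sigma u)) /\
  (forall a b c d, win a b c d -> rel4 (sigma a) (sigma b) (sigma c) (sigma d)).

Definition is_sol (U : tup) (s : sol) : bool :=
  [&& [forall a, forall b, (U a == U b) ==> (s a == s b)],
      [forall a, un (U a) (s a)] &
      [forall a, forall b, forall c, forall d,
        win (U a) (U b) (U c) (U d) ==> rel4 (s a) (s b) (s c) (s d)]].

Lemma is_solP (U : tup) (s : sol) : reflect
  [/\ forall a b, U a = U b -> s a = s b, forall a, un (U a) (s a) &
      forall a b c d, win (U a) (U b) (U c) (U d) -> rel4 (s a) (s b) (s c) (s d)]
  (is_sol U s).
Proof.
apply: (iffP and3P) => [] [h1 h2 h3]; split.
- by move=> a b /eqP ab; move/forallP/(_ a)/forallP/(_ b)/implyP/(_ ab)/eqP: h1.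
- exact/forallP.
- by move=> a b c d w; move/forallP/(_ a)/forallP/(_ b)/forallP/(_ c)/forallP/(_ d)/implyP: h3; apply.
- by apply/forallP=> a; apply/forallP=> b; apply/implyP=> /eqP/h1/eqP.
- exact/forallP.
by do 4!apply/forallP=> ?; apply/implyP; apply: h3.
Qed.

Definition pull (X : Type) (p : {ffun 'I_n -> 'I_n}) (s : {ffun 'I_n -> X}) :
  {ffun 'I_n -> X} := [ffun b => s (p b)].

(* [W] lists some of the variables of [U], selected by [p], and [pull p] restricts
   partial solutions accordingly. *)
Definition gadget_adj (U : tup) (x : vec) (W : tup) (y : vec) : bool :=
  [exists p : {ffun 'I_n -> 'I_n}, (W == pull p U) &&
    [forall s, is_sol U s ==> nb (x s) (y (pull p s))]].

(** Every tuple uses the dictator at the partial solution induced by [sigma]; [pull p] carries these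
    solutions to one another. *)
Lemma gadget_complete (sigma : V -> D) (U : tup) x (W : tup) y : csp_solution sigma ->
  gadget_adj U x W y ->
  nb (x [ffun a => sigma (U a)]) (y [ffun a => sigma (W a)]).
Proof.
move=> [sun swin] /existsP[p /andP[/eqP -> /forallP h]].
have solU : is_sol U [ffun a => sigma (U a)].
  apply/is_solP; split=> [a b|a|a b c d].
  - by rewrite !ffunE => ->.
  - by rewrite ffunE.
  by rewrite !ffunE; apply: swin.
have := implyP (h _) solU; congr (nb _ (y _)).
by apply/ffunP=> a; rewrite !ffunE.
Qed.

(** * From a 4-colouring of the gadgets to a solution *)

Section Soundness.

Variable v0 : V.
Variable phi : tup -> vec -> colour.
Hypothesis phiP : forall U x W y, gadget_adj U x W y -> phi U x != phi W y.

Notation par f S := (parity l.*2.+1 (@low_beta k) f S).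

Let support (U : tup) : {set sol} := [set s | par (phi U) [set s]].
Let range (U : tup) : {set V} := [set U a | a in 'I_n].

Let T_odd : odd l.*2.+1. Proof. by rewrite /= odd_double. Qed.

Lemma phi_crossing U : crossing [set s | is_sol U s] (phi U) (phi U).
Proof.
move=> x y /nbvP xy; apply: phiP; apply/existsP; exists [ffun a => a].
apply/andP; split; first by apply/eqP/ffunP=> a; rewrite !ffunE.
apply/forallP=> s; apply/implyP=> sU.
have -> : pull [ffun a => a] s = s by apply/ffunP=> a; rewrite !ffunE.
by apply: xy; rewrite inE.
Qed.

Lemma phi_crossingT U : crossing setT (phi U) (phi U).
Proof. exact: crossing_sub (subsetT _) (@phi_crossing U). Qed.

(** A coordinate that is not a partial solution does not matter for adjacency, so its parity is that
    of the empty set. *)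
Lemma support_sol U s : s \in support U -> is_sol U s.
Proof.
rewrite inE; apply: contraTT => sU.
rewrite (parity_disjoint T_odd (@low_beta_step k) (@low_beta_per k) (@phi_crossing U)).
  by rewrite (parity_set0 T_odd (@low_beta_step k) (@low_beta_per k) (@phi_crossing U)).
by rewrite disjoint_sym disjoints1 inE.
Qed.

Lemma card_support U : #|support U| <= support_bound.
Proof. exact: parity_support_bound (@phi_crossingT U). Qed.

Lemma support_neq0 U : 0 < #|support U|.
Proof.
have [s sU] := parity_exists T_odd (@low_beta_step k) (@low_beta_per k) (@phi_crossing U).
by apply/card_gt0P; exists s; rewrite inE.
Qed.

(** [phi (pull p U)] and the minor of [phi U] along [pull p] are adjacent in the exponential graph,
    so the bit of [s] is the sum of the bits of its preimages, one of which must be set. *)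
Lemma support_pull U p : support (pull p U) \subset pull p @: support U.
Proof.
apply/subsetP=> s; rewrite inE.
pose f := minor (pull p) (phi U).
have crossing_f : crossing setT f f.
  move=> y y' /nbvP yy; apply: (@phi_crossingT U); apply/nbvP=> t _.
  by rewrite !ffunE yy // inE.
rewrite (@parity_crossing _ _ _ _ T_odd (@low_beta_step k) (@low_beta_per k) setT _ _ f) //; last 2 first.
- exact: phi_crossingT.
- move=> y y' /nbvP yy; rewrite eq_sym; apply: phiP; apply/existsP; exists p.
  rewrite eqxx; apply/forallP=> t; apply/implyP=> _.
  by rewrite ffunE nbC yy // inE.
rewrite parity_minor (parity_sum T_odd (@low_beta_step k) (@low_beta_per k) _ (@phi_crossing U)).
move=> sum_s; have /existsP[t /andP[ts tU]] :
    [exists t, (t \in pull p @^-1: [set s]) && (t \in support U)].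
  apply: contraTT sum_s => /existsPn no; rewrite big1 // => t ts.
  by have := no t; rewrite ts inE => /negbTE.
by apply/imsetP; exists t => //; move: ts; rewrite !inE => /eqP.
Qed.

Lemma range_factor U W : range W \subset range U -> exists p, W = pull p U.
Proof.
move=> sub.
have /fin_all_exists[p hp] : forall b : 'I_n, exists a : 'I_n, W b = U a.
  move=> b; have Wb : W b \in range W by apply: imset_f.
  by case/imsetP: (subsetP sub _ Wb) => a _ ->; exists a.
by exists (finfun p); apply/ffunP=> b; rewrite !ffunE.
Qed.

Lemma range_exists (R : {set V}) : R != set0 -> #|R| <= n -> exists U, range U = R.
Proof.
move=> /set0Pn[r rR] Rn; exists [ffun i : 'I_n => nth r (enum R) i].
apply/setP=> v; apply/imsetP/idP => [[i _ ->]|vR].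
  rewrite ffunE; case: (ltnP i #|R|) => iR.
    by rewrite -mem_enum mem_nth // -cardE.
  by rewrite nth_default // -cardE.
have vi : index v (enum R) < n by apply: leq_trans Rn; rewrite cardE index_mem mem_enum.
by exists (Ordinal vi) => //; rewrite ffunE nth_index // mem_enum.
Qed.

(* Supports can only shrink under restriction. For [B] of maximal support,
   adding at most four variables keeps the size of the support, so restriction
   to [B] is bijective on supports. *)
Lemma maximal_support : exists B, [/\ #|range B| <= 4 * #|support B| &
  forall W, range B \subset range W -> #|range W| <= #|range B| + 4 ->
    #|support W| = #|support B|].
Proof.
pose ok U := #|range U| <= 4 * #|support U|.
have ok0 : ok [ffun=> v0].
  apply: (@leq_trans 1).
    apply: (@leq_trans #|[set v0]|); last by rewrite cards1.
    by apply/subset_leq_card/subsetP=> v /imsetP[a _ ->]; rewrite ffunE inE.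
  by rewrite muln_gt0 /= support_neq0.
case: (arg_maxnP (fun U => #|support U|) ok0) => B okB maxB.
exists B; split=> // W BW cW; apply/eqP; rewrite eqn_leq; apply/andP; split; last first.
  have [p ->] := range_factor BW.
  apply: leq_trans (leq_imset_card (pull p) _).
  exact: subset_leq_card (support_pull _ _).
rewrite leqNgt; apply/negP=> lt.
(* A support larger by one pays for the four added variables, so [W] competes with [B] in the
   maximum. *)
have okW : ok W by move: okB cW lt; rewrite /ok; lia.
have le : #|support W| <= #|support B| := maxB W okW.
by rewrite leqNgt lt in le.
Qed.

(* Every [W] extending [B] has a unique element of its support extending a fixed
   [s0] in the support of [B]; these elements are compatible with each other. *)
Lemma gadget_sound : exists sigma, csp_solution sigma.
Proof.
have [B [okB maxB]] := maximal_support.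
have /card_gt0P[s0 s0B] := support_neq0 B.
pose good W := (range B \subset range W) && (#|range W| <= #|range B| + 4).
(* Phrased by shared variables rather than by some [p] with [B = pull p W], so that it passes to
   restrictions of [W]. *)
pose ext W (s : sol) := forall a b, B b = W a -> s a = s0 b.
have support_factor W p : good W -> good (pull p W) ->
    pull p @: support W = support (pull p W) /\ {in support W &, injective (pull p)}.
  move=> /andP[gW cW] /andP[gP cP]; have eW := maxB _ gW cW; have eP := maxB _ gP cP.
  have e : support (pull p W) = pull p @: support W.
    apply/eqP; rewrite eqEcard support_pull eP -eW; exact: leq_imset_card.
  by split=> //; apply/imset_injP; rewrite -e eP eW.
have goodB : good B by rewrite /good subxx leq_addr.
have ext_pull W p s : B = pull p W -> s \in support W -> ext W s <-> pull p s = s0.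
  move=> BW sW; have /is_solP[cons _ _] := support_sol sW.
  have Bb b : B b = W (p b) by rewrite BW ffunE.
  split=> [e|e a b ab].
    by apply/ffunP=> b; rewrite ffunE; apply: e.
  by rewrite -e ffunE; apply: cons; rewrite -Bb.
have ext_ex W : good W -> exists2 s, s \in support W & ext W s.
  move=> gW; have /andP[BW cW] := gW; have [p pB] := range_factor BW.
  have [|img _] := support_factor W p gW; first by rewrite -pB.
  move: s0B; rewrite pB -img => /imsetP[s sW s0E].
  by exists s => //; apply/(ext_pull _ _ _ pB sW).
have ext_uniq W s s' : good W -> s \in support W -> s' \in support W ->
    ext W s -> ext W s' -> s = s'.
  move=> gW sW sW' e e'; have /andP[BW cW] := gW; have [p pB] := range_factor BW.
  have [|_ inj] := support_factor W p gW; first by rewrite -pB.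
  by apply: inj => //; rewrite (ext_pull _ _ _ pB sW).1 // (ext_pull _ _ _ pB sW').1.
have good_ex (X : {set V}) : #|X| <= 4 -> exists2 W, good W & range W = X :|: range B.
  move=> X4; have cX : #|X :|: range B| <= #|range B| + 4.
    by rewrite cardsU (leq_trans (leq_subr _ _)) // addnC leq_add2l.
  have [||W rW] := @range_exists (X :|: range B).
  - by apply/set0Pn; exists (B ord0); rewrite inE imset_f ?orbT.
  (* The range of [B] has at most [4 * support_bound] elements; the size of the tuples leaves room
     for four more. *)
  - rewrite tuple_sizeE; apply: leq_trans cX _.
    by move: okB (card_support B); lia.
  by exists W => //; rewrite /good rW subsetUr.
(* The value at [v] is read off a tuple listing [v] and the range of [B]. Every good [W] through [v]
   restricts to this tuple, and uniqueness of the extension makes the values agree. *)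
have [sigma sigmaP] : exists sigma : V -> D, forall v W s a, good W ->
    s \in support W -> ext W s -> W a = v -> s a = sigma v.
  suff /fin_all_exists : forall v, exists d, forall W s a, good W ->
    s \in support W -> ext W s -> W a = v -> s a = d by [].
  move=> v; have [|Wv gv rv] := good_ex [set v]; first by rewrite cards1.
  have [sv svW ev] := ext_ex _ gv.
  have /imsetP[av _ vE] : v \in range Wv by rewrite rv !inE eqxx.
  exists (sv av) => W s a gW sW eW Wa.
  have [p pW] : exists p, Wv = pull p W.
    apply: range_factor; rewrite rv subUset sub1set; have /andP[-> _] := gW.
    by rewrite andbT -Wa imset_f.
  have [|img _] := support_factor W p gW; first by rewrite -pW.
  have sv' : pull p s \in support Wv by rewrite pW -img imset_f.
  have evs : ext Wv (pull p s) by move=> c b; rewrite pW !ffunE; apply: eW.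
  rewrite (ext_uniq _ _ _ gv svW sv' ev evs) ffunE.
  by have /is_solP[cons _ _] := support_sol sW; apply: cons; rewrite Wa vE pW ffunE.
exists sigma; split=> [u|a b c d w].
  have [|W gW rW] := good_ex [set u]; first by rewrite cards1.
  have [s sW eW] := ext_ex _ gW.
  have /imsetP[a _ ua] : u \in range W by rewrite rW !inE eqxx.
  have /is_solP[_ h _] := support_sol sW.
  by rewrite ua -(sigmaP _ _ _ a gW sW eW erefl).
(* The four variables of a window and the range of [B] fit into one good tuple, whose partial
   solution satisfies the constraint. *)
have [|W gW rW] := good_ex [set a; b; c; d].
  by rewrite -!setUA !cardsU1 cards1; do !case: (_ \notin _).
have [s sW eW] := ext_ex _ gW.
have val v : v \in [set a; b; c; d] -> exists2 i, v = W i & sigma v = s i.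
  move=> vX; have /imsetP[i _ vi] : v \in range W by rewrite rW inE vX.
  by exists i => //; rewrite vi -(sigmaP _ _ _ i gW sW eW erefl).
have [|ia aE ->] := val a; first by rewrite !inE eqxx.
have [|ib bE ->] := val b; first by rewrite !inE eqxx ?orbT.
have [|ic cE ->] := val c; first by rewrite !inE eqxx ?orbT.
have [|id dE ->] := val d; first by rewrite !inE eqxx ?orbT.
have /is_solP[_ _ h] := support_sol sW; apply: h.
by rewrite -aE -bE -cE -dE.
Qed.

End Soundness.
End PartialSolutions.

(** * A while language compiled to Turing machines *)

Section Machines.

Variable K : nat.
Definition symbol : Type := option (bool + void).
Notation tape_ix := 'I_K.+2.
Notation scanned := {ffun tape_ix -> symbol}.
Notation action := {ffun tape_ix -> symbol * move}.

(** A fragment is left through the next state [None], so that fragments can be plugged into one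
    another. *)
Record frag := Frag {
  fr_state : finType;
  fr_start : fr_state;
  fr_trans : fr_state -> scanned -> option fr_state * action
}.

Definition tapes : Type := (tape_ix -> int) * (tape_ix -> int -> symbol).

Definition scan (X : tapes) : scanned := [ffun t => X.2 t (X.1 t)].

Definition act (a : action) (X : tapes) : tapes :=
  (fun t => shift (a t).2 (X.1 t),
   fun t i => if i == X.1 t then (a t).1 else X.2 t i).

Definition noop (s : scanned) : action := [ffun t => (s t, Stay)].

Lemma act_noop X : act (noop (scan X)) X = X.
Proof.
case: X => h c; congr pair; apply: functional_extensionality => t /=.
  by rewrite ffunE.
by apply: functional_extensionality => i; rewrite !ffunE; case: eqP => [->|].
Qed.

Inductive runs (F : frag) : fr_state F -> tapes -> nat -> tapes -> Prop :=
| RunsExit q X a : fr_trans q (scan X) = (None, a) -> runs q X 1 (act a X)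
| RunsStep q q' X a n Y : fr_trans q (scan X) = (Some q', a) ->
    runs q' (act a X) n Y -> runs q X n.+1 Y.

Definition single (a : scanned -> action) : frag :=
  @Frag unit tt (fun _ s => (None, a s)).

Definition seq_frag (F G : frag) : frag :=
  @Frag (fr_state F + fr_state G)%type (inl (fr_start F)) (fun q s =>
    match q with
    | inl q => let: (q', a) := fr_trans q s in
               (Some (if q' is Some q'' then inl q'' else inr (fr_start G)), a)
    | inr q => let: (q', a) := fr_trans q s in (omap inr q', a)
    end).

(* In the states of [while_frag], [None] is where the test is performed. *)
Definition while_frag (b : scanned -> bool) (F : frag) : frag :=
  @Frag (option (fr_state F)) None (fun q s =>
    match q with
    | None => (if b s then Some (Some (fr_start F)) else None, noop s)
    | Some q => let: (q', a) := fr_trans q s in (Some q', a)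
    end).

Definition if_frag (b : scanned -> bool) (F G : frag) : frag :=
  @Frag (option (fr_state F + fr_state G)) None (fun q s =>
    match q with
    | None => (Some (Some (if b s then inl (fr_start F) else inr (fr_start G))), noop s)
    | Some (inl q) => let: (q', a) := fr_trans q s in (omap (fun x => Some (inl x)) q', a)
    | Some (inr q) => let: (q', a) := fr_trans q s in (omap (fun x => Some (inr x)) q', a)
    end).

Lemma runs_single a X : @runs (single a) tt X 1 (act (a (scan X)) X).
Proof. exact: RunsExit. Qed.

Lemma runs_seq_l (F G : frag) q X n Y m Z : @runs F q X n Y ->
  @runs (seq_frag F G) (inr (fr_start G)) Y m Z ->
  @runs (seq_frag F G) (inl q) X (n + m) Z.
Proof.
elim=> {q X n Y} [q X a e|q q' X a n Y e _ IH] r.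
  by apply: RunsStep r; rewrite /= e.
by apply: RunsStep (IH r); rewrite /= e.
Qed.

Lemma runs_seq_r (F G : frag) q X n Y : @runs G q X n Y ->
  @runs (seq_frag F G) (inr q) X n Y.
Proof.
elim=> {q X n Y} [q X a e|q q' X a n Y e _ IH].
  by apply: RunsExit; rewrite /= e.
by apply: RunsStep IH; rewrite /= e.
Qed.

Lemma runs_while_body (b : scanned -> bool) (F : frag) q X n Y m Z : @runs F q X n Y ->
  @runs (while_frag b F) None Y m Z ->
  @runs (while_frag b F) (Some q) X (n + m) Z.
Proof.
elim=> {q X n Y} [q X a e|q q' X a n Y e _ IH] r.
  by apply: RunsStep r; rewrite /= e.
by apply: RunsStep (IH r); rewrite /= e.
Qed.

Lemma runs_while_true (b : scanned -> bool) (F : frag) X n Y m Z : b (scan X) ->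
  @runs F (fr_start F) X n Y -> @runs (while_frag b F) None Y m Z ->
  @runs (while_frag b F) None X (n + m).+1 Z.
Proof.
move=> bX rF rW; have := runs_while_body rF rW.
by rewrite -{1}(act_noop X); apply: RunsStep; rewrite /= bX.
Qed.

Lemma runs_while_false (b : scanned -> bool) (F : frag) X : ~~ b (scan X) ->
  @runs (while_frag b F) None X 1 X.
Proof.
by move=> /negbTE bX; rewrite -{2}(act_noop X); apply: RunsExit; rewrite /= bX.
Qed.

Lemma runs_if (b : scanned -> bool) (F G : frag) X n Y :
  (if b (scan X) then @runs F (fr_start F) X n Y else @runs G (fr_start G) X n Y) ->
  @runs (if_frag b F G) None X n.+1 Y.
Proof.
move=> r; apply: (@RunsStep (if_frag b F G) None
  (Some (if b (scan X) then inl (fr_start F) else inr (fr_start G))) X) => //.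
rewrite act_noop; case: (b (scan X)) r.
  elim=> {X n Y} [q X a e|q q' X a n Y e _ IH].
    by apply: RunsExit; rewrite /= e.
  by apply: RunsStep IH; rewrite /= e.
elim=> {X n Y} [q X a e|q q' X a n Y e _ IH].
  by apply: RunsExit; rewrite /= e.
by apply: RunsStep IH; rewrite /= e.
Qed.

Definition tm_of_frag (F : frag) : tm :=
  @TM K.+1 void (option (fr_state F)) (Some (fr_start F)) (pred1 None)
    (fun q s => if q is Some q' then fr_trans q' s else (None, noop s)).

Lemma runs_iter (F : frag) q X n Y : @runs F q X n Y ->
  iter n (@step (tm_of_frag F)) (@Config (tm_of_frag F) (Some q) X.1 X.2) =
  @Config (tm_of_frag F) None Y.1 Y.2.
Proof.
elim=> {q X n Y} [q X a e|q q' X a n Y e _ IH].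
  by rewrite /= /step /= -/(scan X) e.
by rewrite iterSr -IH /step /= -/(scan X) e.
Qed.

Lemma iter_halted (M : tm) c n : tm_halt (cf_state c) -> iter n (@step M) c = c.
Proof. by move=> h; elim: n => //= n ->; rewrite /step h. Qed.

End Machines.

Inductive test := NonZero of nat | InSome | InTrue.

Inductive cmd :=
| Inc of nat | Dec of nat | InRight | InLeft | Out of bool
| Seq of cmd & cmd | While of test & cmd | If of test & cmd & cmd.

Record store := Store { regs : nat -> nat; inpos : nat; outp : seq bool }.

Definition upd (f : nat -> nat) (r v : nat) : nat -> nat :=
  fun i => if i == r then v else f i.

Definition set_reg (S : store) (r v : nat) : store :=
  Store (upd (regs S) r v) (inpos S) (outp S).

Section Semantics.

Variable s : seq bool.

Definition test_val (b : test) (S : store) : bool :=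
  match b with
  | NonZero r => regs S r != 0
  | InSome => inpos S < size s
  | InTrue => nth false s (inpos S)
  end.

Inductive exec : cmd -> store -> nat -> store -> Prop :=
| ExInc r S : exec (Inc r) S 1 (set_reg S r (regs S r).+1)
| ExDec r S : exec (Dec r) S 1 (set_reg S r (regs S r).-1)
| ExInRight f p o : exec InRight (Store f p o) 1 (Store f p.+1 o)
| ExInLeft f p o : exec InLeft (Store f p.+1 o) 1 (Store f p o)
| ExOut b f p o : exec (Out b) (Store f p o) 1 (Store f p (rcons o b))
| ExSeq c d S n S' m S'' : exec c S n S' -> exec d S' m S'' ->
    exec (Seq c d) S (n + m) S''
| ExWhileF b c S : ~~ test_val b S -> exec (While b c) S 1 S
| ExWhileT b c S n S' m S'' : test_val b S -> exec c S n S' ->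
    exec (While b c) S' m S'' -> exec (While b c) S (n + m).+1 S''
| ExIf b c d S n S' : exec (if test_val b S then c else d) S n S' ->
    exec (If b c d) S n.+1 S'.

End Semantics.

Fixpoint cmd_regs (c : cmd) : nat :=
  match c with
  | Inc r | Dec r => r.+1
  | InRight | InLeft | Out _ => 0
  | Seq c d => maxn (cmd_regs c) (cmd_regs d)
  | While b c => maxn (if b is NonZero r then r.+1 else 0) (cmd_regs c)
  | If b c d => maxn (if b is NonZero r then r.+1 else 0) (maxn (cmd_regs c) (cmd_regs d))
  end.

(** * Compilation of commands and its correctness *)

Section Compile.

Variable K : nat.
Notation tape_ix := 'I_K.+2.
Notation scanned := {ffun tape_ix -> symbol}.
Notation action := {ffun tape_ix -> symbol * move}.

(** Tape 0 is the input and the last of the [K.+2] tapes the output, so register [r] lives on tape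
    [r.+1]. *)
Definition reg_ix (r : nat) : tape_ix := inord r.+1.

Definition move_on (t : tape_ix) (m : symbol -> move) (s : scanned) : action :=
  [ffun i => (s i, if i == t then m (s i) else Stay)].

Definition write_out (b : bool) (s : scanned) : action :=
  [ffun i => if i == ord_max then (Some (inl b), MoveRight) else (s i, Stay)].

Definition test_scan (b : test) (s : scanned) : bool :=
  match b with
  | NonZero r => s (reg_ix r) == None
  | InSome => s ord0 != None
  | InTrue => s ord0 == Some (inl true)
  end.

Fixpoint compile (c : cmd) : frag K :=
  match c with
  | Inc r => single (move_on (reg_ix r) (fun=> MoveRight))
  | Dec r => single (move_on (reg_ix r) (fun x => if x == None then MoveLeft else Stay))
  | InRight => single (move_on ord0 (fun=> MoveRight))
  | InLeft => single (move_on ord0 (fun=> MoveLeft))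
  | Out b => single (write_out b)
  | Seq c d => seq_frag (compile c) (compile d)
  | While b c => while_frag (test_scan b) (compile c)
  | If b c d => if_frag (test_scan b) (compile c) (compile d)
  end.

Variable s : seq bool.

Definition str_tape (w : seq bool) (i : int) : symbol :=
  match i with
  | Posz n => nth None [seq Some (inl b) | b <- w] n
  | Negz _ => None
  end.

(* A register holding [v] is a tape with a single mark at the origin and the
   head at [v]. *)
Definition mark_tape (i : int) : symbol := if i == 0%R then Some (inl true) else None.

Definition store_head (S : store) (t : tape_ix) : int :=
  Posz (if t == ord0 then inpos S else if t == ord_max then size (outp S)
        else regs S (nat_of_ord t).-1).

Definition store_tape (S : store) (t : tape_ix) : int -> symbol :=
  if t == ord0 then str_tape s else if t == ord_max then str_tape (outp S)
  else mark_tape.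

Definition store_tapes (S : store) : tapes K := (store_head S, store_tape S).

Lemma reg_ix_val r : r < K -> nat_of_ord (reg_ix r) = r.+1.
Proof. by move=> rK; rewrite inordK // ltnS ltnW. Qed.

Lemma reg_ix0 r : r < K -> (reg_ix r == ord0) = false.
Proof. by move=> rK; rewrite -val_eqE /= reg_ix_val. Qed.

Lemma reg_ix_max r : r < K -> (reg_ix r == ord_max) = false.
Proof. by move=> rK; rewrite -val_eqE /= reg_ix_val // eqSS; lia. Qed.

Lemma str_tape_nth w n : str_tape w (Posz n) =
  if n < size w then Some (inl (nth false w n)) else None.
Proof.
rewrite /str_tape; case: ltnP => h; first by rewrite (nth_map false).
by rewrite nth_default // size_map.
Qed.

Lemma scan_reg S r : r < K ->
  scan (store_tapes S) (reg_ix r) = if regs S r == 0 then Some (inl true) else None.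
Proof.
move=> rK; rewrite ffunE /= /store_tape /store_head reg_ix0 // reg_ix_max //.
by rewrite reg_ix_val.
Qed.

Lemma scan_in S : scan (store_tapes S) ord0 = str_tape s (Posz (inpos S)).
Proof. by rewrite ffunE. Qed.

Lemma test_scanE b S : (if b is NonZero r then r < K else true) ->
  test_scan b (scan (store_tapes S)) = test_val s b S.
Proof.
case: b => [r|_|_] /=.
- by move=> rK; rewrite scan_reg //; case: (regs S r == 0).
- by rewrite scan_in str_tape_nth; case: ltnP.
rewrite scan_in str_tape_nth; case: ltnP => h; first by case: nth.
by rewrite nth_default.
Qed.

Lemma act_move_on S S' t m :
  (forall i, i != t -> store_head S' i = store_head S i) ->
  store_head S' t = shift (m (scan (store_tapes S) t)) (store_head S t) ->
  outp S' = outp S ->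
  act (move_on t m (scan (store_tapes S))) (store_tapes S) = store_tapes S'.
Proof.
move=> h1 h2 h3; congr pair; apply: functional_extensionality => i /=.
  rewrite ffunE /=; case: eqP => [->|/eqP/h1 ->//]; by rewrite h2.
apply: functional_extensionality => z; rewrite !ffunE /=.
have -> : store_tape S' i = store_tape S i by rewrite /store_tape h3.
by case: eqP => [->|].
Qed.

Lemma runs_move_on S S' t m :
  (forall i, i != t -> store_head S' i = store_head S i) ->
  store_head S' t = shift (m (scan (store_tapes S) t)) (store_head S t) ->
  outp S' = outp S ->
  @runs K (single (move_on t m)) tt (store_tapes S) 1 (store_tapes S').
Proof. by move=> h1 h2 h3; rewrite -(act_move_on h1 h2 h3); apply: runs_single. Qed.

Lemma store_head_set S r v i : r < K ->
  store_head (set_reg S r v) i = if i == reg_ix r then Posz v else store_head S i.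
Proof.
move=> rK; rewrite /store_head /=; have [->|ne] := eqVneq i (reg_ix r).
  by rewrite reg_ix0 // reg_ix_max // reg_ix_val //= /upd eqxx.
case: (i =P ord0) => // /eqP i0; case: (i == ord_max) => //; congr Posz; rewrite /upd.
case: eqP => // ir; case/negP: ne; rewrite -val_eqE /= reg_ix_val // -ir prednK //.
by rewrite lt0n -val_eqE in i0 *.
Qed.

Lemma act_write_out b f p o :
  act (write_out b (scan (store_tapes (Store f p o)))) (store_tapes (Store f p o)) =
  store_tapes (Store f p (rcons o b)).
Proof.
congr pair; apply: functional_extensionality => i /=.
  rewrite ffunE /store_head /=; case: (i =P ord_max) => [->|ne] /=; last by case: eqP.
  by rewrite size_rcons -addn1 PoszD.
apply: functional_extensionality => z; rewrite !ffunE /store_tape /store_head /=.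
case: (i =P ord_max) => [->|/eqP/negbTE ne] /=; last first.
  by case: (z =P _) => [->|//]; rewrite /store_tape /store_head ne.
case: z => [n|n] //; rewrite !str_tape_nth size_rcons nth_rcons eqz_nat ltnS.
by case: ltngtP.
Qed.

Lemma compile_correct c S n S' : exec s c S n S' -> cmd_regs c <= K ->
  runs (fr_start (compile c)) (store_tapes S) n (store_tapes S').
Proof.
elim=> {c S n S'} /=.
- move=> r S rK; apply: runs_move_on => // [i ne|].
    by rewrite store_head_set // (negbTE ne).
  rewrite store_head_set // eqxx /= /store_head reg_ix0 // reg_ix_max //.
  by rewrite reg_ix_val //= -addn1 PoszD.
- move=> r S rK; apply: runs_move_on => // [i ne|].
    by rewrite store_head_set // (negbTE ne).
  rewrite store_head_set // eqxx scan_reg // /store_head reg_ix0 // reg_ix_max //.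
  by rewrite reg_ix_val //=; case: (regs S r) => //= m; rewrite -addn1 PoszD addrK.
- move=> f p o _; apply: runs_move_on => // [i ne|].
    by rewrite /store_head (negbTE ne).
  by rewrite /store_head /= -addn1 PoszD.
- move=> f p o _; apply: runs_move_on => // [i ne|].
    by rewrite /store_head (negbTE ne).
  by rewrite /store_head /= -addn1 PoszD addrK.
- by move=> b f p o _; rewrite -act_write_out; apply: runs_single.
- move=> c d S n S' m S'' _ IHc _ IHd; rewrite geq_max => /andP[cK dK].
  exact: runs_seq_l (IHc cK) (runs_seq_r _ (IHd dK)).
- move=> b c S bF; rewrite geq_max => /andP[bK cK].
  by apply: runs_while_false; rewrite test_scanE //; case: b bK {bF}.
- move=> b c S n S' m S'' bT _ IHc _ IHw; rewrite geq_max => /andP[bK cK].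
  apply: runs_while_true (IHc cK) (IHw _); last by rewrite geq_max bK.
  by rewrite test_scanE //; case: b bK {bT IHw}.
move=> b c d S n S' _ IH; rewrite !geq_max => /and3P[bK cK dK].
apply: runs_if; rewrite test_scanE; last by case: b bK {IH}.
by case: (test_val s b S) IH; apply.
Qed.

(** All tapes but the input start blank; this one step writes the origin marks of the registers. *)
Definition init_frag : frag K :=
  single (fun s => [ffun i => if (i == ord0) || (i == ord_max) then (s i, Stay)
                              else (Some (inl true), Stay)]).

Definition empty_store : store := Store (fun=> 0) 0 [::].

Definition program (c : cmd) : tm := tm_of_frag (seq_frag init_frag (compile c)).

Lemma program_run c n S : exec s c empty_store n S -> cmd_regs c <= K ->
  iter n.+1 (@step (program c)) (init (program c) s) =
  @Config (program c) None (store_head S) (store_tape S).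
Proof.
move=> e cK; have rc := compile_correct e cK.
pose X0 : tapes K := (fun=> 0%R, fun t => if t == ord0 then str_tape s else fun=> None).
suff r : @runs K (seq_frag init_frag (compile c)) (fr_start (seq_frag init_frag (compile c))) X0
    n.+1 (store_tapes S) by rewrite -[RHS](runs_iter r).
rewrite -add1n; apply: runs_seq_l (runs_seq_r _ rc).
have -> : store_tapes empty_store = act [ffun i => if (i == ord0) || (i == ord_max)
   then (scan X0 i, Stay) else (Some (inl true), Stay)] X0.
  congr pair; apply: functional_extensionality => i /=.
    by rewrite ffunE /store_head; do !case: eqP => //=.
  apply: functional_extensionality => z; rewrite !ffunE /store_tape /=.
  case: (i =P ord0) => [->|_] /=; first by case: eqP => [->|].
  by case: (i =P ord_max) => _ /=; [case: z => [[|m]|m] | ].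
exact: runs_single.
Qed.

End Compile.

(** The strict bound pays for the step of [init_frag]; any remaining steps act on a halted
    machine. *)
Lemma polytime_cmd (f : seq bool -> seq bool) (c : cmd) (e : nat) :
  (forall s, exists n S, [/\ exec s c empty_store n S, outp S = f s &
     n < size s ^ e + e]) -> polytime f.
Proof.
move=> h; exists (program (cmd_regs c) c), e => s.
have [n [S [ex fS lt]]] := h s.
have run := program_run ex (leqnn (cmd_regs c)).
rewrite /= -(subnK lt) iterD run iter_halted //=; split=> // i.
by rewrite /store_tape eqxx fS.
Qed.

(** * Bounded arithmetic in polynomial time *)

(** Variables are de Bruijn indices, bound by [TSum] (the summation index) and [TLet]. Subtraction
    is truncated, which makes comparisons and Boolean connectives expressible. *)
Inductive term :=
| TVar of nat | TOne | TLen | TBit of term | TAdd of term & term | TSub of term & term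
| TSum of term & term | TLet of term & term.

Fixpoint eval (s : seq bool) (t : term) (e : seq nat) : nat :=
  match t with
  | TVar i => nth 0 e i
  | TOne => 1
  | TLen => size s
  | TBit t => nth false s (eval s t e)
  | TAdd t u => eval s t e + eval s u e
  | TSub t u => eval s t e - eval s u e
  | TSum t u => \sum_(0 <= i < eval s t e) eval s u (i :: e)
  | TLet t u => eval s u (eval s t e :: e)
  end.

Definition loop (r : nat) (c : cmd) : cmd := While (NonZero r) (Seq (Dec r) c).

Definition clear (r : nat) : cmd := While (NonZero r) (Dec r).

(* The value of the term is added to register [out]; the registers in [G] hold
   the environment and the registers from [fr] on are free and hold 0. *)
Fixpoint term_cmd (G : seq nat) (out fr : nat) (t : term) : cmd :=
  match t with
  | TVar i => if i < size G then
      Seq (loop (nth 0 G i) (Seq (Inc out) (Inc fr))) (loop fr (Inc (nth 0 G i)))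
      else Seq (Inc fr) (Dec fr)
  | TOne => Inc out
  | TLen => Seq (While InSome (Seq InRight (Seq (Inc out) (Inc fr)))) (loop fr InLeft)
  | TBit t => Seq (term_cmd G fr fr.+2 t)
      (Seq (loop fr (Seq InRight (Inc fr.+1)))
      (Seq (If InTrue (Inc out) (Seq (Inc fr) (Dec fr))) (loop fr.+1 InLeft)))
  | TAdd t u => Seq (term_cmd G out fr t) (term_cmd G out fr u)
  | TSub t u => Seq (term_cmd G fr fr.+2 t) (Seq (term_cmd G fr.+1 fr.+2 u)
      (Seq (loop fr.+1 (Dec fr)) (loop fr (Inc out))))
  | TSum t u => Seq (term_cmd G fr fr.+2 t)
      (Seq (loop fr (Seq (term_cmd (fr.+1 :: G) out fr.+2 u) (Inc fr.+1))) (clear fr.+1))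
  | TLet t u => Seq (term_cmd G fr fr.+1 t)
      (Seq (term_cmd (fr :: G) out fr.+1 u) (clear fr))
  end.

Fixpoint cost (s : seq bool) (t : term) (e : seq nat) : nat :=
  match t with
  | TVar i => 8 * nth 0 e i + 8
  | TOne => 1
  | TLen => 8 * size s + 8
  | TBit t => cost s t e + 8 * eval s t e + 10
  | TAdd t u => cost s t e + cost s u e
  | TSub t u => cost s t e + cost s u e + 4 * eval s u e + 4 * eval s t e + 8
  | TSum t u => cost s t e + \sum_(0 <= i < eval s t e) (cost s u (i :: e) + 6) + 8
  | TLet t u => cost s t e + cost s u (eval s t e :: e) + 4 * eval s t e + 4
  end.

Lemma store_ext S S' : regs S =1 regs S' -> inpos S = inpos S' -> outp S = outp S' -> S = S'.
Proof.
by case: S S' => f p o [f' p' o'] /= /functional_extensionality -> -> ->.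
Qed.

Ltac store_eq := apply: store_ext => [? | //= | /=]; rewrite /= ?cats0 ?catA /upd //=;
  repeat (let E := fresh in case: eqP => E; try rewrite E); try lia; try congruence.

Section Exec.

Variable s : seq bool.

Definition execb (c : cmd) (S : store) (n : nat) (S' : store) : Prop :=
  exists2 m, m <= n & exec s c S m S'.

Lemma execb_seq c d S n S' m S'' : execb c S n S' -> execb d S' m S'' ->
  execb (Seq c d) S (n + m) S''.
Proof.
by move=> [a an ca] [b bm db]; exists (a + b); [exact: leq_add | exact: ExSeq ca db].
Qed.

Lemma execb_le c S n m S' : execb c S n S' -> n <= m -> execb c S m S'.
Proof. by move=> [a an ca] nm; exists a => //; exact: leq_trans nm. Qed.

Lemma execb_inc r S : execb (Inc r) S 1 (set_reg S r (regs S r).+1).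
Proof. by exists 1 => //; apply: ExInc. Qed.

Lemma execb_dec r S : execb (Dec r) S 1 (set_reg S r (regs S r).-1).
Proof. by exists 1 => //; apply: ExDec. Qed.

Lemma execb_while b c (F : nat -> store) (N : nat -> nat) m :
  (forall i, i < m -> test_val s b (F i) /\ execb c (F i) (N i) (F i.+1)) ->
  ~~ test_val s b (F m) ->
  execb (While b c) (F 0) (\sum_(0 <= i < m) (N i).+1 + 1) (F m).
Proof.
elim: m F N => [|m IH] F N h hm.
  by rewrite big_geq //; exists 1 => //; apply: ExWhileF.
have [t0 [n0 n0N c0]] := h 0 isT.
have [|n nN cn] := IH (fun i => F i.+1) (fun i => N i.+1) _ hm.
  by move=> i im; apply: h.
exists (n0 + n).+1; last exact: ExWhileT t0 c0 cn.
by rewrite big_nat_recl //=; move: nN n0N; lia.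
Qed.

(** [F i] is the store after [i] rounds apart from the counter, whose value [v] the body has to
    preserve. *)
Lemma execb_loop r c (F : nat -> store) (N : nat -> nat) m :
  (forall i v, i < m -> execb c (set_reg (F i) r v) (N i) (set_reg (F i.+1) r v)) ->
  execb (loop r c) (set_reg (F 0) r m) (\sum_(0 <= i < m) (N i + 2) + 1) (set_reg (F m) r 0).
Proof.
move=> h; have := @execb_while (NonZero r) (Seq (Dec r) c)
  (fun i => set_reg (F i) r (m - i)) (fun i => N i + 1) m.
rewrite subn0 subnn => H; apply: execb_le; first apply: H.
- move=> i im; split; first by rewrite /= /upd eqxx; lia.
  rewrite addnC; apply: execb_seq (execb_dec _ _) _.
  have -> : set_reg (set_reg (F i) r (m - i)) r (regs (set_reg (F i) r (m - i)) r).-1 =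
    set_reg (F i) r (m - i.+1) by store_eq.
  exact: h.
- by rewrite /= /upd eqxx.
by rewrite leq_add2r; apply: leq_sum => i _; lia.
Qed.

Lemma execb_clear r S : execb (clear r) S (2 * regs S r + 1) (set_reg S r 0).
Proof.
have := @execb_while (NonZero r) (Dec r) (fun i => set_reg S r (regs S r - i)) (fun=> 1) (regs S r).
rewrite subn0 subnn sum_nat_const_nat subn0 mulnC => H.
have -> : S = set_reg S r (regs S r) by store_eq.
have -> : set_reg (set_reg S r (regs S r)) r 0 = set_reg S r 0 by store_eq.
rewrite /= /upd eqxx; apply: H; last by rewrite /= /upd eqxx.
move=> i im; split; first by rewrite /= /upd eqxx; lia.
have -> : set_reg S r (regs S r - i.+1) =
  set_reg (set_reg S r (regs S r - i)) r (regs (set_reg S r (regs S r - i)) r).-1 by store_eq.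
exact: execb_dec.
Qed.

Definition env_ok (G : seq nat) (out fr : nat) (e : seq nat) (S : store) : Prop :=
  [/\ inpos S = 0, map (regs S) G = e, out \notin G, out < fr &
      all (fun r => r < fr) G /\ forall r, fr <= r -> regs S r = 0].

Lemma env_ok_fresh G out fr e S m : env_ok G out fr e S ->
  env_ok G fr (m.+1 + fr) e S.
Proof.
case=> p Ge oG of_ [Gf z]; split=> //.
- by apply/negP=> /(allP Gf); rewrite ltnn.
- by rewrite ltnS leq_addl.
split; first by apply/allP=> r /(allP Gf) h; apply: leq_trans h _; rewrite leq_addl.
by move=> r h; apply: z; apply: leq_trans h; rewrite leq_addl.
Qed.

Lemma env_ok_set G out fr e S r v : env_ok G out fr e S -> r < fr -> r \notin G ->
  env_ok G out fr e (set_reg S r v).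
Proof.
case=> p Ge oG of_ [Gf z] rf rG; split=> //=.
  rewrite -Ge; apply/eq_in_map => x xG; rewrite /upd; case: eqP => // xr.
  by rewrite xr (negbTE rG) in xG.
split=> // x fx; rewrite /upd; case: eqP => [xr|_]; last exact: z.
by rewrite xr leqNgt rf in fx.
Qed.

Lemma env_ok_out G out out' fr e S : env_ok G out fr e S ->
  out' \notin G -> out' < fr -> env_ok G out' fr e S.
Proof. by case=> p Ge _ _ [Gf z]. Qed.

Lemma env_ok_cons G out fr e S r : env_ok G out fr e S -> r < fr -> r != out ->
  env_ok (r :: G) out fr (regs S r :: e) S.
Proof.
case=> p Ge oG of_ [Gf z] rf ro; split=> //=; first by rewrite Ge.
  by rewrite inE negb_or eq_sym ro.
by rewrite rf.
Qed.

Lemma execb_conv c S n S' m S'' :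
  execb c S n S' -> S' = S'' -> n <= m -> execb c S m S''.
Proof. by move=> h <-; apply: execb_le. Qed.

Lemma execb_copy r out fr S v : regs S r = v -> regs S fr = 0 -> r != out -> r != fr -> out != fr ->
  execb (Seq (loop r (Seq (Inc out) (Inc fr))) (loop fr (Inc r))) S
    (8 * v + 8) (set_reg S out (regs S out + v)).
Proof.
move=> rv z ro rf of_.
pose F i := set_reg (set_reg S out (regs S out + i)) fr i.
pose F' i := set_reg (set_reg S out (regs S out + v)) r i.
have h1 : execb (loop r (Seq (Inc out) (Inc fr))) (set_reg (F 0) r v)
    (\sum_(0 <= i < v) (2 + 2) + 1) (set_reg (F v) r 0).
  apply: execb_loop => i w _.
  apply: (execb_conv (execb_seq (execb_inc _ _) (execb_inc _ _))) => //.
  by rewrite /F; store_eq.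
have h2 : execb (loop fr (Inc r)) (set_reg (F' 0) fr v)
    (\sum_(0 <= i < v) (1 + 2) + 1) (set_reg (F' v) fr 0).
  apply: execb_loop => i w _; apply: (execb_conv (execb_inc _ _)) => //.
  by rewrite /F'; store_eq.
have e1 : set_reg (F 0) r v = S by rewrite /F; store_eq.
have e2 : set_reg (F v) r 0 = set_reg (F' 0) fr v by rewrite /F /F'; store_eq.
rewrite e1 in h1; rewrite e2 in h1; apply: (execb_conv (execb_seq h1 h2)).
  by rewrite /F'; store_eq.
by rewrite !sum_nat_const_nat; lia.
Qed.

Lemma execb_skip fr S : execb (Seq (Inc fr) (Dec fr)) S 2 S.
Proof.
apply: (execb_conv (execb_seq (execb_inc _ _) (execb_dec _ _))) => //.
by store_eq.
Qed.

Definition move_in (S : store) (p : nat) : store := Store (regs S) p (outp S).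

Lemma execb_in_right S p : execb InRight (move_in S p) 1 (move_in S p.+1).
Proof. by exists 1 => //; apply: ExInRight. Qed.

Lemma execb_in_left S p : execb InLeft (move_in S p.+1) 1 (move_in S p).
Proof. by exists 1 => //; apply: ExInLeft. Qed.

Lemma execb_rewind fr S p : inpos S = 0 -> regs S fr = 0 ->
  execb (loop fr InLeft) (set_reg (move_in S p) fr p) (3 * p + 1) S.
Proof.
move=> p0 z; pose F i := move_in S (p - i).
have h : execb (loop fr InLeft) (set_reg (F 0) fr p)
    (\sum_(0 <= i < p) (1 + 2) + 1) (set_reg (F p) fr 0).
  apply: execb_loop => i w ip; rewrite /F.
  have := @execb_in_left (set_reg S fr w) (p - i.+1).
  by rewrite -subSn // subSS.
have e1 : set_reg (F 0) fr p = set_reg (move_in S p) fr p by rewrite /F subn0.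
rewrite e1 in h; apply: (execb_conv h).
  by rewrite /F subnn; store_eq.
by rewrite sum_nat_const_nat; lia.
Qed.

Lemma execb_len out fr S : inpos S = 0 -> regs S fr = 0 -> out != fr ->
  execb (Seq (While InSome (Seq InRight (Seq (Inc out) (Inc fr)))) (loop fr InLeft)) S
    (8 * size s + 8) (set_reg S out (regs S out + size s)).
Proof.
move=> p0 z of_; have [v vE] : exists v, v = size s by exists (size s).
rewrite -vE; pose F i := set_reg (set_reg (move_in S i) out (regs S out + i)) fr i.
have h1 : execb (While InSome (Seq InRight (Seq (Inc out) (Inc fr)))) (F 0)
    (\sum_(0 <= i < v) 4 + 1) (F v).
  apply: (@execb_while InSome _ F (fun=> 3)) => [i iv|]; last by rewrite /= -vE ltnn.
  split; first by rewrite /= -vE.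
  have r := @execb_in_right (F i) i.
  have e : F i = move_in (F i) i by store_eq.
  rewrite -e in r.
  apply: (execb_conv (execb_seq r (execb_seq (execb_inc _ _) (execb_inc _ _)))) => //.
  by rewrite /F; store_eq.
have e1 : F 0 = S by rewrite /F; store_eq.
rewrite e1 in h1.
have h2 := @execb_rewind fr (set_reg S out (regs S out + v)) v p0.
have e2 : F v = set_reg (move_in (set_reg S out (regs S out + v)) v) fr v.
  by rewrite /F; store_eq.
rewrite e2 in h1; apply: (execb_conv (execb_seq h1 (h2 _))) => //.
  by rewrite /= /upd; case: eqP => // e; rewrite e eqxx in of_.
by rewrite sum_nat_const_nat; lia.
Qed.

Lemma execb_bit out fr S v : inpos S = 0 -> regs S fr = v -> regs S fr.+1 = 0 ->
  out < fr ->
  execb (Seq (loop fr (Seq InRight (Inc fr.+1)))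
        (Seq (If InTrue (Inc out) (Seq (Inc fr) (Dec fr))) (loop fr.+1 InLeft))) S
    (8 * v + 10) (set_reg (set_reg S fr 0) out (regs S out + nth false s v)).
Proof.
move=> p0 rv z of_.
pose F i := set_reg (move_in S i) fr.+1 i.
have h1 : execb (loop fr (Seq InRight (Inc fr.+1))) (set_reg (F 0) fr v)
    (\sum_(0 <= i < v) (2 + 2) + 1) (set_reg (F v) fr 0).
  apply: execb_loop => i w _.
  have r := @execb_in_right (set_reg (F i) fr w) i.
  apply: (execb_conv (execb_seq r (execb_inc _ _))) => //.
  by rewrite /F; store_eq.
have e1 : set_reg (F 0) fr v = S by rewrite /F; store_eq.
rewrite e1 in h1.
pose S' := set_reg (set_reg S fr 0) out (regs S out + nth false s v).
have h2 : execb (If InTrue (Inc out) (Seq (Inc fr) (Dec fr))) (set_reg (F v) fr 0) 3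
    (set_reg (move_in S' v) fr.+1 v).
  have [n n2 en] : execb (if test_val s InTrue (set_reg (F v) fr 0) then Inc out
      else Seq (Inc fr) (Dec fr)) (set_reg (F v) fr 0) 2 (set_reg (move_in S' v) fr.+1 v).
    rewrite /= /S'; case: (nth false s v).
      by apply: (execb_conv (execb_inc _ _)) => //; rewrite /F; store_eq.
    by apply: (execb_conv (execb_skip _ _)) => //; rewrite /F; store_eq.
  by exists n.+1 => //; apply: ExIf.
have h3 := @execb_rewind fr.+1 S' v p0.
apply: (execb_conv (execb_seq h1 (execb_seq h2 (h3 _)))) => //.
  by rewrite /S' /= /upd; do !case: eqP => //; lia.
by rewrite sum_nat_const_nat; lia.
Qed.

Lemma execb_sub out fr S a b : regs S fr = a -> regs S fr.+1 = b -> out < fr ->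
  execb (Seq (loop fr.+1 (Dec fr)) (loop fr (Inc out))) S (4 * b + 4 * a + 8)
    (set_reg (set_reg (set_reg S fr 0) fr.+1 0) out (regs S out + (a - b))).
Proof.
move=> ra rb of_.
pose F i := set_reg S fr (a - i).
pose F' i := set_reg (set_reg S fr.+1 0) out (regs S out + i).
have h1 : execb (loop fr.+1 (Dec fr)) (set_reg (F 0) fr.+1 b)
    (\sum_(0 <= i < b) (1 + 2) + 1) (set_reg (F b) fr.+1 0).
  apply: execb_loop => i w _; apply: (execb_conv (execb_dec _ _)) => //.
  by rewrite /F; store_eq.
have h2 : execb (loop fr (Inc out)) (set_reg (F' 0) fr (a - b))
    (\sum_(0 <= i < a - b) (1 + 2) + 1) (set_reg (F' (a - b)) fr 0).
  apply: execb_loop => i w _; apply: (execb_conv (execb_inc _ _)) => //.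
  by rewrite /F'; store_eq.
have e1 : set_reg (F 0) fr.+1 b = S by rewrite /F; store_eq.
have e2 : set_reg (F b) fr.+1 0 = set_reg (F' 0) fr (a - b) by rewrite /F /F'; store_eq.
rewrite e1 e2 in h1; apply: (execb_conv (execb_seq h1 h2)).
  by rewrite /F'; store_eq.
by rewrite !sum_nat_const_nat; lia.
Qed.

(** Adding the value to [out] instead of storing it makes [TAdd] a mere composition and lets the
    body of [TSum] accumulate its result. *)
Lemma term_cmd_correct t : forall G out fr e S, env_ok G out fr e S ->
  execb (term_cmd G out fr t) S (cost s t e) (set_reg S out (regs S out + eval s t e)).
Proof.
elim: t => [i|||t IHt|t IHt u IHu|t IHt u IHu|t IHt u IHu|t IHt u IHu] G out fr e S ok;
  have [p Ge oG of_ [Gf z]] := ok; rewrite /=.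
- case: ifP => iG; last first.
    rewrite nth_default; last by rewrite -Ge size_map leqNgt iG.
    by apply: (execb_conv (execb_skip _ _)) => //; store_eq.
  have rG : nth 0 G i \in G by apply: mem_nth.
  have rf : nth 0 G i < fr := allP Gf _ rG.
  have -> : nth 0 e i = regs S (nth 0 G i) by rewrite -Ge (nth_map 0).
  apply: (execb_copy erefl (z _ (leqnn _))).
  - by apply: contraNneq oG => <-.
  - by rewrite neq_ltn rf.
  by rewrite neq_ltn of_.
- by apply: (execb_conv (execb_inc _ _)) => //; store_eq.
- by apply: execb_len; rewrite ?z // neq_ltn of_.
- have okt := env_ok_fresh 1 ok.
  have h := IHt _ _ _ _ _ okt; rewrite z // add0n in h.
  have hb := @execb_bit out fr (set_reg S fr (eval s t e)) (eval s t e) p.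
  apply: (execb_conv (execb_seq h (hb _ _ _))) => //.
  + by rewrite /= /upd eqxx.
  + by rewrite /= /upd; case: eqP => [|_]; [lia | rewrite z].
  + have zf := z fr (leqnn fr); store_eq.
  by lia.
- have h1 := IHt _ _ _ _ _ ok.
  have h2 := IHu _ _ _ _ _ (env_ok_set (regs S out + eval s t e) ok of_ oG).
  apply: (execb_conv (execb_seq h1 h2)) => //.
  by store_eq.
- have okt := env_ok_fresh 1 ok; have frG : fr \notin G by case: okt.
  have fr1G : fr.+1 \notin G by apply/negP=> /(allP Gf); rewrite ltnNge leqnSn.
  have h1 := IHt _ _ _ _ _ okt; rewrite z // add0n in h1.
  have ok1 : env_ok G fr.+1 fr.+2 e (set_reg S fr (eval s t e)).
    by apply: env_ok_out fr1G _ => //; apply: env_ok_set okt _ frG.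
  have h2 := IHu _ _ _ _ _ ok1.
  have zf := z _ (leqnn fr); have zf1 := z _ (leqnSn fr).
  rewrite {2}/set_reg /= /upd gtn_eqF // zf1 add0n in h2.
  have h3 := @execb_sub out fr (set_reg (set_reg S fr (eval s t e)) fr.+1 (eval s u e))
    (eval s t e) (eval s u e) _ _ of_.
  apply: (execb_conv (execb_seq h1 (execb_seq h2 (h3 _ _)))).
  + by rewrite /= /upd ltn_eqF // eqxx.
  + by rewrite /= /upd eqxx.
  + by store_eq.
  by lia.
- have okt := env_ok_fresh 1 ok; have frG : fr \notin G by case: okt.
  have fr1G : fr.+1 \notin G by apply/negP=> /(allP Gf); rewrite ltnNge leqnSn.
  have h1 := IHt _ _ _ _ _ okt; rewrite z // add0n in h1.
  have zf := z _ (leqnn fr); have zf1 := z _ (leqnSn fr).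
  move: (eval s t e) h1 => a h1.
  pose F i := set_reg (set_reg S fr.+1 i) out
    (regs S out + \sum_(0 <= j < i) eval s u (j :: e)).
  have h2 : execb (loop fr (Seq (term_cmd (fr.+1 :: G) out fr.+2 u) (Inc fr.+1)))
      (set_reg (F 0) fr a) (\sum_(0 <= i < a) (cost s u (i :: e) + 1 + 2) + 1)
      (set_reg (F a) fr 0).
    apply: execb_loop => i w _; set X := set_reg (F i) fr w.
    have okX : env_ok (fr.+1 :: G) out fr.+2 (i :: e) X.
      have -> : i = regs X fr.+1 by rewrite /X /F /= /upd; do !case: eqP => //; lia.
      apply: env_ok_cons => //; last by rewrite gtn_eqF // ltnS ltnW.
      apply: env_ok_set => //; apply: env_ok_set => //; last by rewrite ltnW // ltnW.
      apply: env_ok_set => //; apply: env_ok_out okt oG _.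
      by rewrite ltnW // ltnW.
    apply: (execb_conv (execb_seq (IHu _ _ _ _ _ okX) (execb_inc _ _))) => //.
    by rewrite /X /F big_nat_recr //=; store_eq.
  have e1 : set_reg (F 0) fr a = set_reg S fr a.
    by rewrite /F big_geq //; store_eq.
  rewrite e1 in h2; have h3 := execb_clear fr.+1 (set_reg (F a) fr 0).
  apply: (execb_conv (execb_seq h1 (execb_seq h2 h3))).
    by rewrite /F; store_eq.
  have -> : regs (set_reg (F a) fr 0) fr.+1 = a.
    by rewrite /F /= /upd; do !case: eqP => //; lia.
  rewrite -2!addnA leq_add2l.
  rewrite !big_split /= !sum_nat_const_nat.
  by lia.
have okt := env_ok_fresh 0 ok; have frG : fr \notin G by case: okt.
have h1 := IHt _ _ _ _ _ okt; rewrite z // add0n in h1.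
have zf := z _ (leqnn fr); move: (eval s t e) h1 => a h1.
have ok1 : env_ok (fr :: G) out fr.+1 (a :: e) (set_reg S fr a).
  have -> : a :: e = regs (set_reg S fr a) fr :: e by rewrite /= /upd eqxx.
  apply: env_ok_cons => //; last by rewrite neq_ltn of_ orbT.
  by apply: env_ok_set => //; apply: env_ok_out okt oG _; rewrite ltnW.
have h2 := IHu _ _ _ _ _ ok1; rewrite {2}/set_reg /= /upd ltn_eqF // in h2.
have h3 := execb_clear fr (set_reg (set_reg S fr a) out (regs S out + eval s u (a :: e))).
apply: (execb_conv (execb_seq h1 (execb_seq h2 h3))).
  by store_eq.
by rewrite /= /upd gtn_eqF // eqxx; lia.
Qed.

End Exec.

Lemma pow_ge (B e : nat) : 0 < (B + 2) ^ e.
Proof. by rewrite expn_gt0 addn2. Qed.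

Lemma pow_mono (B e e' : nat) : e <= e' -> (B + 2) ^ e <= (B + 2) ^ e'.
Proof. by move=> ee; rewrite leq_exp2l // addn2. Qed.


Lemma pow_mul2 (B e j : nat) : 2 ^ j * (B + 2) ^ e <= (B + 2) ^ (j + e).
Proof.
rewrite expnD leq_mul2r; apply/orP; right.
by case: j => // j; rewrite leq_exp2r // leq_addl.
Qed.

(** The base [B + 2] is at least 2, so constant factors are absorbed into the exponent. Under a
    binder the environment is bounded by [(B + 2) ^ c.+1], which multiplies the exponent of the body
    by [c.+2]. *)
Lemma term_bound t : exists c, forall s e B, size s <= B -> all (fun x => x <= B) e ->
  eval s t e + cost s t e <= (B + 2) ^ c.
Proof.
have le_pow B : B + 2 <= (B + 2) ^ 1 by rewrite expn1.
elim: t => [i|||t [c IHt]|t [c IHt] u [d IHu]|t [c IHt] u [d IHu]|t [c IHt] u [d IHu]|t [c IHt] u [d IHu]].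
- exists 5 => s e B sB eB /=.
  have h : nth 0 e i <= B.
    by case: (ltnP i (size e)) => ie; [apply: (allP eB); apply: mem_nth | rewrite nth_default].
  by have := pow_mul2 B 1 4; rewrite expn1; move: h; rewrite -[2 ^ 4]/16; lia.
- by exists 1 => s e B _ _ /=; rewrite expn1; lia.
- exists 5 => s e B sB _ /=; have := pow_mul2 B 1 4; rewrite expn1.
  by move: sB; rewrite -[2 ^ 4]/16; lia.
- exists (5 + c) => s e B sB eB /=; have h := IHt s e B sB eB.
  have := pow_mul2 B c 5; have := pow_ge B c; rewrite -[2 ^ 5]/32.
  by case: (nth _ _ _); move: h; lia.
- exists (1 + (c + d)) => s e B sB eB /=.
  have h := IHt s e B sB eB; have h' := IHu s e B sB eB.
  have := pow_mul2 B (c + d) 1; have := pow_mono B (leq_addr d c).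
  by have := pow_mono B (leq_addl c d); rewrite expn1; lia.
- exists (5 + (c + d)) => s e B sB eB /=.
  have h := IHt s e B sB eB; have h' := IHu s e B sB eB.
  have := pow_mul2 B (c + d) 5; have := pow_mono B (leq_addr d c).
  have := pow_ge B (c + d).
  by have := pow_mono B (leq_addl c d); rewrite -[2 ^ 5]/32; lia.
- exists (5 + (c.+2 * d + c.+2)) => s e B sB eB /=.
  have h := IHt s e B sB eB; set X := (B + 2) ^ c in h.
  pose B' := (B + 2) ^ c.+1; pose Y := (B + 2) ^ (c.+2 * d).
  have XB' : X <= B' by apply: pow_mono.
  have BB' : B + 2 <= B' by rewrite -{1}(expn1 (B + 2)); apply: pow_mono.
  have B'Y : (B' + 2) ^ d <= Y.
    rewrite /Y expnM; case: (d) => // d'; rewrite leq_exp2r // expnS.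
    by have := leq_mul2r B' 2 (B + 2); rewrite -/B' leq_addl orbT; lia.
  have hb i : i < eval s t e -> eval s u (i :: e) + cost s u (i :: e) <= Y.
    move=> ie; apply: leq_trans B'Y; apply: IHu; first by lia.
    rewrite /= (leq_trans (ltnW ie)) /=; last by lia.
    by apply: sub_all eB => x; lia.
  have sum_le : \sum_(0 <= i < eval s t e) eval s u (i :: e) +
     \sum_(0 <= i < eval s t e) (cost s u (i :: e) + 6) <= X * (Y + 6).
    rewrite -big_split /=; apply: (@leq_trans (\sum_(0 <= i < eval s t e) (Y + 6))).
      rewrite big_nat [X in _ <= X]big_nat; apply: leq_sum => i /andP[_ ie].
      by rewrite addnA leq_add2r hb.
    by rewrite sum_nat_const_nat subn0 leq_mul2r; apply/orP; right; move: h; lia.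
  have := pow_mul2 B (c.+2 * d + c.+2) 5; rewrite [in X in _ -> X <= _]addnCA.
  have XY : X * Y <= (B + 2) ^ (c.+2 * d + c.+2).
    by rewrite expnD mulnC leq_mul2l pow_mono ?orbT // ltnW // ltnW.
  have Y1 : 0 < Y := pow_ge _ _.
  have X1 : 0 < X := pow_ge _ _.
  have XXY : X <= X * Y by rewrite leq_pmulr.
  move: sum_le h; rewrite mulnDr -[2 ^ 5]/32; lia.
exists (5 + (c.+2 * d + c.+2)) => s e B sB eB /=.
have h := IHt s e B sB eB; set X := (B + 2) ^ c in h.
pose B' := (B + 2) ^ c.+1; pose Y := (B + 2) ^ (c.+2 * d).
have XB' : X <= B' by apply: pow_mono.
have BB' : B + 2 <= B' by rewrite -{1}(expn1 (B + 2)); apply: pow_mono.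
have B'Y : (B' + 2) ^ d <= Y.
  rewrite /Y expnM; case: (d) => // d'; rewrite leq_exp2r // expnS.
  by have := leq_mul2r B' 2 (B + 2); rewrite -/B' leq_addl orbT; lia.
have hb : eval s u (eval s t e :: e) + cost s u (eval s t e :: e) <= Y.
  apply: leq_trans B'Y; apply: IHu; first by lia.
  rewrite /= (leq_trans (leq_addr (cost s t e) _)) /=; last by lia.
  by apply: sub_all eB => x; lia.
have := pow_mul2 B (c.+2 * d + c.+2) 5.
have XY : X * Y <= (B + 2) ^ (c.+2 * d + c.+2).
  by rewrite expnD mulnC leq_mul2l pow_mono ?orbT // ltnW // ltnW.
have Y1 : 0 < Y := pow_ge _ _.
have X1 : 0 < X := pow_ge _ _.
have XXY : X <= X * Y by rewrite leq_pmulr.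
have YXY : Y <= X * Y by rewrite leq_pmull.
by move: hb h; rewrite -[2 ^ 5]/32; lia.
Qed.

Definition put (S : store) (w : seq bool) : store :=
  Store (regs S) (inpos S) (outp S ++ w).

Lemma execb_out s b S : execb s (Out b) S 1 (put S [:: b]).
Proof. by case: S => f p o; rewrite /put cats1; exists 1 => //; apply: ExOut. Qed.

Lemma iotaSr n : iota 0 n.+1 = rcons (iota 0 n) n.
Proof. by rewrite -addn1 iotaD cats1. Qed.

(** * A program printing the code of a graph *)

Section GraphProgram.

Variables (tN tA : term).

Let N s := eval s tN [::].
Let A s u v := eval s tA [:: u; v] != 0.

(** Registers 0 and 2 count down the remaining rows and columns, 1 and 3 hold the current row and
    column, 4 receives the matrix entry. *)
Definition cell_cmd : cmd := Seq (term_cmd [:: 1; 3] 4 5 tA)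
  (Seq (If (NonZero 4) (Out true) (Out false)) (clear 4)).

Definition row_cmd : cmd := Seq (term_cmd [::] 2 4 tN)
  (Seq (loop 2 (Seq cell_cmd (Inc 3))) (clear 3)).

Definition graph_cmd : cmd := Seq (term_cmd [::] 0 4 tN) (Seq (loop 0 (Out true))
  (Seq (Out false) (Seq (term_cmd [::] 0 4 tN) (loop 0 (Seq row_cmd (Inc 1)))))).

Definition cell_cost s u v := cost s tA [:: u; v] + (2 + (2 * eval s tA [:: u; v] + 1)).

Lemma cell_correct s S u v : inpos S = 0 -> regs S 1 = u -> regs S 3 = v ->
  (forall r, 4 <= r -> regs S r = 0) ->
  execb s cell_cmd S (cell_cost s u v) (put S [:: A s u v]).
Proof.
move=> p0 ru rv z; rewrite /A /cell_cost.
have ok : env_ok [:: 1; 3] 4 5 [:: u; v] S.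
  by split; rewrite //= ?ru ?rv //; split=> // r r5; apply: z; apply: ltnW.
have h1 := term_cmd_correct s tA ok; rewrite z // add0n in h1.
move: (eval _ _ _) h1 => a h1.
have h2 : execb s (If (NonZero 4) (Out true) (Out false)) (set_reg S 4 a) 2
    (put (set_reg S 4 a) [:: a != 0]).
  have [n n1 en] : execb s (if test_val s (NonZero 4) (set_reg S 4 a) then Out true
    else Out false) (set_reg S 4 a) 1 (put (set_reg S 4 a) [:: a != 0]).
    by rewrite /= /upd eqxx; case: (a != 0); apply: execb_out.
  by exists n.+1 => //; apply: ExIf.
have h3 := execb_clear s 4 (put (set_reg S 4 a) [:: a != 0]).
apply: (execb_conv (execb_seq h1 (execb_seq h2 h3))); last by rewrite /= /upd eqxx.
have z4 := z 4 isT; apply: store_ext => //= r; rewrite /upd.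
by case: (r =P 4) => // ->.
Qed.

Definition row_cost s u :=
  cost s tN [::] + (\sum_(0 <= v < N s) (cell_cost s u v + 1 + 2) + 1 + (2 * N s + 1)).

Lemma row_correct s S u : inpos S = 0 -> regs S 1 = u ->
  (forall r, 2 <= r -> regs S r = 0) ->
  execb s row_cmd S (row_cost s u) (put S [seq A s u v | v <- iota 0 (N s)]).
Proof.
move=> p0 ru z; have ok : env_ok [::] 2 4 [::] S.
  by split=> //; split=> // r r4; apply: z; lia.
have h1 := term_cmd_correct s tN ok; rewrite z // add0n -/(N s) in h1.
pose F i := put (set_reg S 3 i) [seq A s u v | v <- iota 0 i].
have z2 := z 2 isT; have z3 := z 3 isT.
have h2 : execb s (loop 2 (Seq cell_cmd (Inc 3))) (set_reg (F 0) 2 (N s))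
    (\sum_(0 <= v < N s) (cell_cost s u v + 1 + 2) + 1) (set_reg (F (N s)) 2 0).
  apply: execb_loop => i w _.
  have h : execb s cell_cmd (set_reg (F i) 2 w) (cell_cost s u i)
      (put (set_reg (F i) 2 w) [:: A s u i]).
    apply: cell_correct => //=.
    by case=> [|[|[|[|r]]]] //= _; rewrite /upd /=; apply: z.
  apply: (execb_conv (execb_seq h (execb_inc _ _ _))) => //.
  rewrite /F iotaSr map_rcons -cats1.
  apply: store_ext => [r | //= |]; rewrite /= /upd; last by rewrite catA.
  by do !case: eqP => // *; lia.
have e1 : set_reg (F 0) 2 (N s) = set_reg S 2 (N s).
  by rewrite /F; store_eq.
rewrite e1 in h2; have h3 := execb_clear s 3 (set_reg (F (N s)) 2 0).
apply: (execb_conv (execb_seq h1 (execb_seq h2 h3))) => //.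
by rewrite /F; store_eq.
Qed.

Definition graph_cost s := cost s tN [::] + (\sum_(0 <= i < N s) (1 + 2) + 1 +
  (1 + (cost s tN [::] + (\sum_(0 <= u < N s) (row_cost s u + 1 + 2) + 1)))).

Definition graph_output s := nseq (N s) true ++ false ::
  [seq A s u v | u <- iota 0 (N s), v <- iota 0 (N s)].

Lemma graph_cmd_correct s : exists S,
  outp S = graph_output s /\ execb s graph_cmd empty_store (graph_cost s) S.
Proof.
have ok S : inpos S = 0 -> (forall r, regs S r = 0) -> env_ok [::] 0 4 [::] S.
  by move=> p0 z; split.
have h1 := term_cmd_correct s tN (ok empty_store erefl (fun=> erefl)).
rewrite add0n -/(N s) in h1.
pose F i := put empty_store (nseq i true).
have h2 : execb s (loop 0 (Out true)) (set_reg (F 0) 0 (N s))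
    (\sum_(0 <= i < N s) (1 + 2) + 1) (set_reg (F (N s)) 0 0).
  apply: execb_loop => i w _; apply: (execb_conv (execb_out _ _ _)) => //.
  apply: store_ext => //=.
  by rewrite -(nseqD i 1) addn1.
pose S1 := put empty_store (nseq (N s) true ++ [:: false]).
have e2 : set_reg (F (N s)) 0 0 = F (N s).
  by apply: store_ext => //= r; rewrite /upd; case: eqP.
rewrite e2 in h2.
have h3 : execb s (Out false) (F (N s)) 1 S1.
  by apply: (execb_conv (execb_out _ _ _)).
have h4 := term_cmd_correct s tN (ok S1 erefl (fun=> erefl)).
rewrite add0n -/(N s) in h4.
pose H i := put (set_reg S1 1 i) [seq A s u v | u <- iota 0 i, v <- iota 0 (N s)].
have h5 : execb s (loop 0 (Seq row_cmd (Inc 1))) (set_reg (H 0) 0 (N s))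
    (\sum_(0 <= u < N s) (row_cost s u + 1 + 2) + 1) (set_reg (H (N s)) 0 0).
  apply: execb_loop => i w _.
  have h : execb s row_cmd (set_reg (H i) 0 w) (row_cost s i)
      (put (set_reg (H i) 0 w) [seq A s i v | v <- iota 0 (N s)]).
    by apply: row_correct => //=; case=> [|[|r]].
  apply: (execb_conv (execb_seq h (execb_inc _ _ _))) => //.
  rewrite /H iotaSr map_rcons flatten_rcons.
  apply: store_ext => [r | //= |]; rewrite /= /upd; last by rewrite -!catA.
  by do !case: eqP => // *; lia.
exists (set_reg (H (N s)) 0 0); split; first by rewrite /= /graph_output -catA.
have e0 : set_reg (F 0) 0 (N s) = set_reg empty_store 0 (N s) by [].
have e4 : set_reg (H 0) 0 (N s) = set_reg S1 0 (N s).
  by rewrite /H; store_eq.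
rewrite e0 in h2; rewrite e4 in h5.
exact: execb_seq h1 (execb_seq h2 (execb_seq h3 (execb_seq h4 h5))).
Qed.

(** Converts to the shape of bound used by [polytime]: [m + 2 <= m ^ 2] once [m] is at least 2, and
    the summand [3 ^ c] of [e] covers smaller [m]. *)
Lemma pow_shift c : exists e, forall m, (m + 2) ^ c < m ^ e + e.
Proof.
exists (2 * c + 3 ^ c).+1 => m; case: (ltnP m 2) => m2.
  have : (m + 2) ^ c <= 3 ^ c by case: c => // c; rewrite leq_exp2r //; lia.
  by lia.
have : (m + 2) ^ c <= m ^ (2 * c).
  rewrite expnM; case: c => // c; rewrite leq_exp2r // -mulnn.
  by have := leq_mul2r m 2 m; rewrite m2 orbT; lia.
have : m ^ (2 * c) <= m ^ (2 * c + 3 ^ c).+1.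
  by rewrite leq_pexp2l //; lia.
by lia.
Qed.

Lemma graph_cost_bound : exists c, forall s, graph_cost s <= (size s + 2) ^ c.
Proof.
have [c hc] := term_bound tN; have [d hd] := term_bound tA.
exists (5 + (c + c + c.+2 * d)) => s; set B := size s.
have h := hc s [::] B (leqnn _) isT; rewrite -/(N s) in h.
set X := (B + 2) ^ c in h; pose Y := (B + 2) ^ (c.+2 * d).
pose B' := (B + 2) ^ c.+1.
have XB' : X <= B' by apply: pow_mono.
have BB' : B + 2 <= B' by rewrite -{1}(expn1 (B + 2)); apply: pow_mono.
have B'Y : (B' + 2) ^ d <= Y.
  rewrite /Y expnM; case: (d) => // d'; rewrite leq_exp2r // expnS.
  by have := leq_mul2r B' 2 (B + 2); rewrite -/B' leq_addl orbT; lia.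
have Y1 : 0 < Y := pow_ge _ _.
have X1 : 0 < X := pow_ge _ _.
have cell_le u v : u < N s -> v < N s -> cell_cost s u v <= 5 * Y.
  move=> uN vN; have := leq_trans (hd s [:: u; v] B' _ _) B'Y; rewrite /cell_cost.
  by move=> /(_ _ _)H; have : eval s tA [:: u; v] + cost s tA [:: u; v] <= Y;
     [apply: H; rewrite /= ?andbT; lia | lia].
have row_le u : u < N s -> row_cost s u <= 13 * (X * Y).
  move=> uN; rewrite /row_cost.
  have : \sum_(0 <= v < N s) (cell_cost s u v + 1 + 2) <= X * (8 * Y).
    apply: (@leq_trans (\sum_(0 <= v < N s) 8 * Y)); last first.
      by rewrite sum_nat_const_nat subn0 leq_mul2r; apply/orP; right; lia.
    rewrite big_nat [X in _ <= X]big_nat; apply: leq_sum => v /andP[_ vN].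
    by have := cell_le u v uN vN; lia.
  have : X <= X * Y by rewrite leq_pmulr.
  by move: h; lia.
have : \sum_(0 <= u < N s) (row_cost s u + 1 + 2) <= X * (16 * (X * Y)).
  apply: (@leq_trans (\sum_(0 <= v < N s) 16 * (X * Y))); last first.
    by rewrite sum_nat_const_nat subn0 leq_mul2r; apply/orP; right; lia.
  rewrite big_nat [X in _ <= X]big_nat; apply: leq_sum => u /andP[_ uN].
  have := row_le u uN; have : 0 < X * Y by rewrite muln_gt0 X1.
  by lia.
have := pow_mul2 B (c + c + c.+2 * d) 5; rewrite [(B + 2) ^ (c + c + _)]expnD.
rewrite [(B + 2) ^ (c + c)]expnD -/X -/Y /graph_cost sum_nat_const_nat -[2 ^ 5]/32.
have : X <= X * X * Y by rewrite -mulnA leq_pmulr // muln_gt0 X1.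
by move: h; rewrite -mulnA; lia.
Qed.

Theorem polytime_graph_output : polytime graph_output.
Proof.
have [c hc] := graph_cost_bound; have [e he] := pow_shift c.
apply: (@polytime_cmd _ graph_cmd e) => s.
have [S [oS [n nC ex]]] := graph_cmd_correct s.
by exists n, S; split=> //; apply: leq_ltn_trans (he _); apply: leq_trans (hc s).
Qed.

End GraphProgram.

(** * Closure properties of the functions given by terms *)

Fixpoint lift (c : nat) (t : term) : term :=
  match t with
  | TVar i => TVar (if i < c then i else i.+1)
  | TOne => TOne
  | TLen => TLen
  | TBit t => TBit (lift c t)
  | TAdd t u => TAdd (lift c t) (lift c u)
  | TSub t u => TSub (lift c t) (lift c u)
  | TSum t u => TSum (lift c t) (lift c.+1 u)
  | TLet t u => TLet (lift c t) (lift c.+1 u)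
  end.

Lemma eval_lift s t e e' x : eval s (lift (size e) t) (e ++ x :: e') = eval s t (e ++ e').
Proof.
elim: t e => //= [i|t IHt|t IHt u IHu|t IHt u IHu|t IHt u IHu|t IHt u IHu] e //; rewrite ?IHt ?IHu //.
- rewrite !nth_cat; case: (ltnP i (size e)) => ie; first by rewrite ie.
  by rewrite ltnNge leqW // subSn.
- by apply: eq_bigr => i _; apply: (IHu (i :: e)).
exact: (IHu (_ :: e)).
Qed.

Definition funct := seq bool -> seq nat -> nat.

Definition computable (F : funct) : Prop := exists t, forall s e, eval s t e = F s e.

Lemma eq_computable F G : (forall s e, F s e = G s e) -> computable F -> computable G.
Proof. by move=> FG [t ht]; exists t => s e; rewrite ht. Qed.

Lemma computable_var i : computable (fun _ e => nth 0 e i).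
Proof. by exists (TVar i). Qed.

Lemma computable_add F G : computable F -> computable G ->
  computable (fun s e => F s e + G s e).
Proof. by move=> [t ht] [u hu]; exists (TAdd t u) => s e /=; rewrite ht hu. Qed.

Lemma computable_sub F G : computable F -> computable G ->
  computable (fun s e => F s e - G s e).
Proof. by move=> [t ht] [u hu]; exists (TSub t u) => s e /=; rewrite ht hu. Qed.

Lemma computable_const n : computable (fun _ _ => n).
Proof.
elim: n => [|n IH]; first by exists (TSub TOne TOne).
by have := computable_add IH (ex_intro _ TOne (fun _ _ => erefl)); apply: eq_computable => s e; rewrite addn1.
Qed.

Lemma computable_size : computable (fun s _ => size s).
Proof. by exists TLen. Qed.

Lemma computable_bit F : computable F -> computable (fun s e => nth false s (F s e)).
Proof. by move=> [t ht]; exists (TBit t) => s e /=; rewrite ht. Qed.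

(** [t] expects its arguments as variables. Two binders supply them, and [u] is lifted past the
    value of [v]. *)
Lemma computable_apply2 (f : nat -> nat -> nat) t F G :
  (forall s x y e, eval s t (x :: y :: e) = f x y) ->
  computable F -> computable G -> computable (fun s e => f (F s e) (G s e)).
Proof.
move=> ht [u hu] [v hv]; exists (TLet v (TLet (lift 0 u) t)) => s e /=.
by rewrite (@eval_lift s u [::] e) /= hu hv ht.
Qed.

Lemma computable_mul F G : computable F -> computable G ->
  computable (fun s e => F s e * G s e).
Proof.
apply: (@computable_apply2 muln (TSum (TVar 0) (TVar 2))) => s x y e /=.
by rewrite sum_nat_const_nat subn0.
Qed.

Lemma computable_leq F G : computable F -> computable G ->
  computable (fun s e => F s e <= G s e).
Proof.
move=> cF cG; have := computable_sub (computable_const 1) (computable_sub cF cG).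
by apply: eq_computable => s e; rewrite /leq; case: (F s e - G s e).
Qed.

Definition computable_pred (P : seq bool -> seq nat -> bool) : Prop :=
  computable (fun s e => P s e).

Lemma computable_and P Q : computable_pred P -> computable_pred Q ->
  computable_pred (fun s e => P s e && Q s e).
Proof. by move=> cP cQ; have := computable_mul cP cQ; apply: eq_computable => s e; rewrite mulnb. Qed.

Lemma computable_neg P : computable_pred P -> computable_pred (fun s e => ~~ P s e).
Proof.
move=> cP; have := computable_sub (computable_const 1) cP.
by apply: eq_computable => s e; case: (P s e).
Qed.

Lemma computable_or P Q : computable_pred P -> computable_pred Q ->
  computable_pred (fun s e => P s e || Q s e).
Proof.
move=> cP cQ; have := computable_neg (computable_and (computable_neg cP) (computable_neg cQ)).
by apply: eq_computable => s e; rewrite negb_and !negbK.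
Qed.

Lemma computable_imply P Q : computable_pred P -> computable_pred Q ->
  computable_pred (fun s e => P s e ==> Q s e).
Proof.
move=> cP cQ; have := computable_or (computable_neg cP) cQ.
by apply: eq_computable => s e; rewrite implybE.
Qed.

Lemma computable_bool b : computable_pred (fun _ _ => b).
Proof. exact: computable_const. Qed.

Lemma computable_eqn F G : computable F -> computable G ->
  computable_pred (fun s e => F s e == G s e).
Proof.
move=> cF cG; have := computable_and (computable_leq cF cG) (computable_leq cG cF).
by apply: eq_computable => s e; rewrite eqn_leq.
Qed.

Lemma computable_if P F G : computable_pred P -> computable F -> computable G ->
  computable (fun s e => if P s e then F s e else G s e).
Proof.
move=> cP cF cG.
have := computable_add (computable_mul cP cF) (computable_mul (computable_neg cP) cG).
by apply: eq_computable => s e; case: (P s e); rewrite /= ?mul1n ?mul0n ?addn0.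
Qed.

(** Makes division a bounded sum of comparisons, hence expressible by a term. *)
Lemma count_div (x d : nat) : 0 < d -> \sum_(0 <= i < x) (i.+1 * d <= x) = x %/ d.
Proof.
move=> d0; rewrite (eq_bigr (fun i => (i < x %/ d : nat))) => [|i _]; last first.
  by rewrite leq_divRL.
have [n le] : exists n, x = x %/ d + n.
  by exists (x - x %/ d); rewrite subnKC // leq_div.
rewrite {1}le (big_cat_nat (n := x %/ d)) ?leq_addr //=.
rewrite big_nat (eq_bigr (fun=> 1)) => [|i /andP[_ ->] //].
rewrite -big_nat sum_nat_const_nat muln1 subn0 big_nat big1 ?addn0 // => i /andP[h _].
by rewrite ltnNge h.
Qed.

Lemma computable_div F G : computable F -> computable G ->
  computable (fun s e => F s e %/ G s e).
Proof.
have [t ht] : computable (fun _ e => (0 < nth 0 e 2) *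
    ((nth 0 e 0).+1 * nth 0 e 2 <= nth 0 e 1)).
  apply: computable_mul; first apply: computable_leq (computable_const 1) (computable_var 2).
  apply: computable_leq (computable_var 1).
  apply: (computable_mul _ (computable_var 2)).
  have := computable_add (computable_var 0) (computable_const 1).
  by apply: eq_computable => s e; rewrite addn1.
apply: (@computable_apply2 divn (TSum (TVar 0) t)) => s x y e /=.
under eq_bigr => i _ do rewrite ht /=.
by case: (posnP y) => [->|y0]; [rewrite divn0 big1 | rewrite -count_div //; apply: eq_bigr => i _; rewrite mul1n].
Qed.

Lemma computable_mod F G : computable F -> computable G ->
  computable (fun s e => F s e %% G s e).
Proof.
move=> cF cG; have := computable_sub cF (computable_mul (computable_div cF cG) cG).
by apply: eq_computable => s e; rewrite {1}(divn_eq (F s e) (G s e)) addKn.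
Qed.

Lemma computable_exp F n : computable F -> computable (fun s e => F s e ^ n).
Proof.
move=> cF; elim: n => [|n IH]; first by apply: eq_computable (computable_const 1).
by have := computable_mul cF IH; apply: eq_computable => s e; rewrite expnS.
Qed.

(** [X] is independent of the input, so the quantifier unfolds into a conjunction of fixed
    length. *)
Lemma computable_forall (X : finType) (P : X -> seq bool -> seq nat -> bool) :
  (forall x, computable_pred (P x)) ->
  computable_pred (fun s e => [forall x, P x s e]).
Proof.
move=> cP; have : computable_pred (fun s e => all (fun x => P x s e) (enum X)).
  by elim: (enum X) => [|x r IH] /=; [apply: computable_bool | apply: computable_and].
apply: eq_computable => s e; congr nat_of_bool; apply/allP/forallP => h x.
  by apply: h; rewrite mem_enum.
by [].
Qed.

Lemma computable_exists (X : finType) (P : X -> seq bool -> seq nat -> bool) :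
  (forall x, computable_pred (P x)) ->
  computable_pred (fun s e => [exists x, P x s e]).
Proof.
move=> cP; have := computable_neg (computable_forall (fun x => computable_neg (cP x))).
by apply: eq_computable => s e; rewrite negb_forall; congr nat_of_bool; apply: eq_existsb => x; rewrite negbK.
Qed.

Definition computable_graph (N : seq bool -> nat) (A : seq bool -> nat -> nat -> bool)
  (s : seq bool) : seq bool :=
  nseq (N s) true ++ false :: [seq A s u v | u <- iota 0 (N s), v <- iota 0 (N s)].

Lemma polytime_computable_graph N A :
  computable (fun s _ => N s) ->
  computable_pred (fun s e => A s (nth 0 e 0) (nth 0 e 1)) ->
  polytime (computable_graph N A).
Proof.
move=> [tN hN] [tA hA]; have [M [c h]] := polytime_graph_output tN tA.
exists M, c => s; have [h1 h2] := h s; split=> // i; rewrite h2 /graph_output hN.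
congr (@string_tape M _ i); congr (_ ++ _ :: _); congr flatten.
by apply: eq_map => u; apply: eq_map => v; rewrite hA /= eqb0 negbK.
Qed.

(** * From constraint satisfaction to graphs *)

Lemma digits_exist (b n : nat) (a : nat -> nat) : 0 < b -> (forall i, a i < b) ->
  exists2 e, e < b ^ n & forall i, i < n -> (e %/ b ^ i) %% b = a i.
Proof.
move=> b0 ab; elim: n a ab => [|n IH] a ab; first by exists 0.
have [e elt he] := IH (fun i => a i.+1) (fun i => ab _).
exists (a 0 + b * e).
  rewrite expnS; apply: (@leq_trans (b * e.+1)); last by rewrite leq_mul2l elt orbT.
  by rewrite mulnS ltn_add2r.
case=> [|i] im; first by rewrite expn0 divn1 addnC mulnC modnMDl modn_small.
rewrite expnS divnMA [a 0 + _]addnC mulnC divnMDl // (divn_small (ab 0)) addn0.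
exact: he.
Qed.

Section Reduction.

Variable k : nat.
Let l := k.*2.+3.
Notation Zl := ('Z_(k.*2.+3)).
Notation n := (tuple_size k).

Variables (D : finType) (Qf : seq bool -> nat) (un : seq bool -> nat -> D -> bool)
  (win : seq bool -> nat -> nat -> nat -> nat -> bool) (rel4 : D -> D -> D -> D -> bool).

Hypothesis Qf_gt0 : forall s, 0 < Qf s.
Hypothesis computable_Q : computable (fun s _ => Qf s).
Hypothesis computable_un : forall d F, computable F ->
  computable_pred (fun s e => un s (F s e) d).
Hypothesis computable_win : forall F1 F2 F3 F4,
  computable F1 -> computable F2 -> computable F3 -> computable F4 ->
  computable_pred (fun s e => win s (F1 s e) (F2 s e) (F3 s e) (F4 s e)).

Notation sol := {ffun 'I_n -> D}.
Notation vec := {ffun sol -> Zl}.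
Notation tup s := {ffun 'I_n -> 'I_(Qf s)}.

(** Vertices are numbers [ex + vec_count * eu]: the base [l] digits of [ex] are the coordinates of a
    point, the base [Qf s] digits of [eu] the entries of a tuple. As [vec_count] is constant, the
    number of vertices is polynomial in [Qf s]. *)
Definition vec_count : nat := l ^ #|{: sol}|.

Definition vertex_count (s : seq bool) : nat := vec_count * Qf s ^ n.

Definition tuple_digit (s : seq bool) (e a : nat) : nat :=
  ((e %/ vec_count) %/ Qf s ^ a) %% Qf s.

Definition vec_digit (e : nat) (x : sol) : nat := (e %/ l ^ enum_rank x) %% l.

Definition digit_sol (s : seq bool) (e : nat) (x : sol) : bool :=
  [&& [forall a : 'I_n, forall b : 'I_n,
        (tuple_digit s e a == tuple_digit s e b) ==> (x a == x b)],
      [forall a : 'I_n, un s (tuple_digit s e a) (x a)] &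
      [forall a : 'I_n, forall b : 'I_n, forall c : 'I_n, forall d : 'I_n,
        win s (tuple_digit s e a) (tuple_digit s e b) (tuple_digit s e c)
          (tuple_digit s e d) ==> rel4 (x a) (x b) (x c) (x d)]].

Definition digit_nb (x y : nat) : bool := (x == (y + 1) %% l) || (y == (x + 1) %% l).

Definition digit_adj (s : seq bool) (e e' : nat) : bool :=
  [exists p : {ffun 'I_n -> 'I_n},
    [forall b : 'I_n, tuple_digit s e' b == tuple_digit s e (p b)] &&
    [forall x : sol, digit_sol s e x ==>
       digit_nb (vec_digit e x) (vec_digit e' (pull p x))]].

Definition vertex_adj (s : seq bool) (e e' : nat) : bool :=
  digit_adj s e e' || digit_adj s e' e.

Lemma computable_tuple_digit F a : computable F ->
  computable (fun s e => tuple_digit s (F s e) a).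
Proof.
move=> cF; apply: computable_mod => //; apply: computable_div.
  exact: computable_div cF (computable_const _).
exact: computable_exp.
Qed.

Lemma computable_vec_digit F x : computable F ->
  computable (fun s e => vec_digit (F s e) x).
Proof.
move=> cF; apply: computable_mod (computable_const _).
exact: computable_div cF (computable_const _).
Qed.

Lemma computable_digit_nb F G : computable F -> computable G ->
  computable_pred (fun s e => digit_nb (F s e) (G s e)).
Proof.
move=> cF cG; have c1 := computable_const 1; have cl := computable_const l.
apply: computable_or; apply: computable_eqn => //.
  exact: computable_mod (computable_add cG c1) cl.
exact: computable_mod (computable_add cF c1) cl.
Qed.

Lemma computable_digit_sol F x : computable F ->
  computable_pred (fun s e => digit_sol s (F s e) x).
Proof.
move=> cF; have cd a := computable_tuple_digit a cF.
apply: computable_and; last apply: computable_and.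
- apply: computable_forall => a; apply: computable_forall => b.
  by apply: computable_imply (computable_bool _); apply: computable_eqn.
- by apply: computable_forall => a; apply: computable_un.
do 4!(apply: computable_forall => ?).
by apply: computable_imply (computable_bool _); apply: computable_win.
Qed.

Lemma computable_digit_adj F G : computable F -> computable G ->
  computable_pred (fun s e => digit_adj s (F s e) (G s e)).
Proof.
move=> cF cG; apply: computable_exists => p; apply: computable_and.
  by apply: computable_forall => b; apply: computable_eqn; apply: computable_tuple_digit.
apply: computable_forall => x; apply: computable_imply; first exact: computable_digit_sol.
by apply: computable_digit_nb; apply: computable_vec_digit.
Qed.

Lemma polytime_reduction : polytime (computable_graph vertex_count vertex_adj).
Proof.
apply: polytime_computable_graph.
  by apply: computable_mul (computable_const _) _; apply: computable_exp.
by apply: computable_or; apply: computable_digit_adj; apply: computable_var.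
Qed.

Lemma vertex_adj_sym s : symmetric (fun u v : 'I_(vertex_count s) => vertex_adj s u v).
Proof. by move=> u v; rewrite /vertex_adj orbC. Qed.

Definition reduction_graph (s : seq bool) : graph :=
  @Graph 'I_(vertex_count s) _ (@vertex_adj_sym s).

Lemma reduction_graph_code s :
  computable_graph vertex_count vertex_adj s = graph_code (reduction_graph s).
Proof.
rewrite /computable_graph /graph_code /= card_ord; congr (_ ++ _ :: _).
by rewrite -val_enum_ord allpairs_mapl allpairs_mapr.
Qed.

Section Instance.

Variable s : seq bool.
Notation Q := (Qf s).

Let un' (u : 'I_Q) (d : D) := un s u d.
Let win' (a b c d : 'I_Q) := win s a b c d.

Definition satisfiable : Prop := exists sigma : 'I_Q -> D, csp_solution un' win' rel4 sigma.

Definition decodes (e : nat) (U : tup s) (x : vec) : Prop :=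
  (forall a : 'I_n, tuple_digit s e a = U a) /\ forall t, vec_digit e t = x t.

Lemma decodes_ex e : exists U x, decodes e U x.
Proof.
exists [ffun a : 'I_n => Ordinal (ltn_pmod ((e %/ vec_count) %/ Q ^ a) (Qf_gt0 s))].
exists [ffun t => Ordinal (ltn_pmod (e %/ l ^ enum_rank t) (isT : 0 < l))].
by split=> ?; rewrite ffunE.
Qed.

Lemma encode_ex U x : exists e : 'I_(vertex_count s), decodes e U x.
Proof.
have l0 : 0 < l by [].
pose ax i : nat := if insub i is Some j then x (enum_val (j : 'I_#|{: sol}|)) else 0.
have [|ex ex_lt hx] := @digits_exist l #|{: sol}| ax l0.
  by move=> i; rewrite /ax; case: insubP => //= j _ _; apply: ltn_ord.
pose au i : nat := if insub i is Some j then U (j : 'I_n) else 0.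
have [|eu eu_lt hu] := @digits_exist Q n au (Qf_gt0 s).
  by move=> i; rewrite /au; case: insubP => //= j _ _; apply: ltn_ord.
have vc0 : 0 < vec_count by rewrite expn_gt0.
have e_lt : ex + vec_count * eu < vertex_count s.
  apply: (@leq_trans (vec_count * eu.+1)); last by rewrite leq_mul2l eu_lt orbT.
  by rewrite mulnS ltn_add2r.
exists (Ordinal e_lt); split=> [a|t] /=.
  rewrite /tuple_digit addnC mulnC divnMDl // (divn_small (ex_lt : ex < vec_count)) addn0 hu //.
  by rewrite /au valK.
rewrite /vec_digit; have le := ltnW (ltn_ord (enum_rank t)).
have -> : ex + vec_count * eu = vec_count %/ l ^ enum_rank t * eu * l ^ enum_rank t + ex.
  by rewrite addnC mulnAC divnK // dvdn_exp2l.
rewrite divnMDl ?expn_gt0 //.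
(* The tuple part is still a multiple of [l] after the division, so it does not affect this
   digit. *)
have -> : vec_count %/ l ^ enum_rank t = l * l ^ (#|{: sol}| - enum_rank t).-1.
  by rewrite -expnS prednK ?subn_gt0 // /vec_count expnB.
by rewrite -mulnA mulnC modnMDl hx // /ax valK enum_rankK.
Qed.

Lemma digit_solE e U x t : decodes e U x -> digit_sol s e t = is_sol un' win' rel4 U t.
Proof.
case=> hU _; congr [&& _, _ & _].
- by apply: eq_forallb => a; apply: eq_forallb => b; rewrite !hU.
- by apply: eq_forallb => a; rewrite !hU.
by do 4!(apply: eq_forallb => ?); rewrite !hU.
Qed.

Lemma digit_nbE (x y : Zl) : digit_nb x y = nb x y.
Proof. by rewrite /digit_nb /nb -!val_eqE /= !modnDmr. Qed.

Lemma digit_adjE e e' U x U' x' : decodes e U x -> decodes e' U' x' ->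
  digit_adj s e e' = gadget_adj un' win' rel4 U x U' x'.
Proof.
move=> h h'; apply: eq_existsb => p; congr (_ && _).
  apply/forallP/eqP => [hp|E b].
    apply/ffunP=> b; rewrite ffunE; have /eqP := hp b.
    by rewrite h'.1 h.1 => /val_inj.
  by rewrite h'.1 h.1 E ffunE.
apply: eq_forallb => t; rewrite (digit_solE _ h); congr (_ ==> _).
by rewrite h.2 h'.2 digit_nbE.
Qed.

(** [h] reads the digit of the dictator coordinate and maps it along the odd closed walk [g]. *)
Lemma reduction_yes (G : graph) (g : Zl -> G) : (forall x, edge (g x) (g (x + 1)%R)) ->
  satisfiable -> hom_to (reduction_graph s) G.
Proof.
move=> hg [sigma sat].
pose h (e : reduction_graph s) : G :=
  g (inZp (vec_digit e [ffun a : 'I_n => sigma (Ordinal (ltn_pmod ((e %/ vec_count) %/ Q ^ a) (Qf_gt0 s)))])).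
have hE e U x : decodes (e : 'I__) U x -> h e = g (x [ffun a => sigma (U a)]).
  case=> hU hx; rewrite /h; congr g.
  have -> : [ffun a : 'I_n => sigma (Ordinal (ltn_pmod ((e %/ vec_count) %/ Q ^ a) (Qf_gt0 s)))] =
    [ffun a => sigma (U a)].
    by apply/ffunP=> a; rewrite !ffunE; congr sigma; apply: val_inj; rewrite /= -hU.
  by rewrite hx valZpK.
have adj (e e' : 'I_(vertex_count s)) : digit_adj s e e' -> edge (h e) (h e').
  have [U [x hx]] := decodes_ex e; have [U' [x' hx']] := decodes_ex e'.
  rewrite (hE _ _ _ hx) (hE _ _ _ hx') (digit_adjE hx hx').
  move=> /(gadget_complete sat) /orP[/eqP->|/eqP->]; last exact: hg.
  by rewrite edge_sym.
exists h => u v /= /orP[/adj //|/adj]; by rewrite edge_sym.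
Qed.

Definition colour_code (i : 'I_4) : colour := (odd i, 1 < i).

Lemma colour_code_inj : injective colour_code.
Proof.
move=> [[|[|[|[|i]]]] // hi] [[|[|[|[|j]]]] // hj] // _; exact: val_inj.
Qed.

Lemma reduction_no : hom_to (reduction_graph s) (complete_graph 4) -> satisfiable.
Proof.
move=> [f hf].
have enc (Ux : tup s * vec) : {e : 'I_(vertex_count s) | 
   [forall a : 'I_n, tuple_digit s e a == Ux.1 a] && [forall t, vec_digit e t == Ux.2 t]}.
  apply: sigW; have [e [h1 h2]] := encode_ex Ux.1 Ux.2; exists e.
  by apply/andP; split; apply/forallP=> a; rewrite ?h1 ?h2.
pose phi U x : colour := colour_code (f (sval (enc (U, x)))).
apply: (@gadget_sound k 'I_Q D un' win' rel4 (Ordinal (Qf_gt0 s)) phi).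
have dec U x : decodes (sval (enc (U, x))) U x.
  case: (enc (U, x)) => e /= /andP[/forallP h1 /forallP h2].
  by split=> a; [apply/eqP/h1 | apply/eqP/h2].
move=> U x W y adj; rewrite /phi (inj_eq colour_code_inj).
by apply: hf; rewrite /= /vertex_adj (digit_adjE (dec U x) (dec W y)) adj.
Qed.

End Instance.
End Reduction.

(** * The tableau of a nondeterministic computation *)

Lemma size_pair_string s w : size (pair_string s w) = 2 * size s + 1 + size w.
Proof.
rewrite /pair_string size_cat /=; elim: s => [|b s IH] //=.
by move: IH; lia.
Qed.

Lemma nth_pair_string s w z : nth false (pair_string s w) z =
  if z < 2 * size s then ~~ odd z || nth false s z./2
  else if z == 2 * size s then false else nth false w (z - (2 * size s).+1).
Proof.
elim: s z => [|b s IH] z; first by case: z => [|z] //=; rewrite subn1.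
have -> : 2 * size (b :: s) = (2 * size s).+2 by rewrite /= mulnS.
case: z => [|[|z]] //.
rewrite -[LHS]/(nth false (pair_string s w) z) IH !ltnS eqSS.
by rewrite -[odd z.+2]/(~~ ~~ odd z) negbK.
Qed.

Section Tableau.

Variables (M : tm) (cw dt : nat).
Notation tape_ix := 'I_(tm_tapes M).+1.
Notation sym := (option (bool + tm_work M)).
(* What a cell of the tableau stores: the state, the symbols scanned by all
   heads, the symbols in its column, which heads are there, and a marker for
   the part of the first row holding the witness. *)
Definition info : finType := (tm_state M * {ffun tape_ix -> sym} *
  {ffun tape_ix -> sym} * {ffun tape_ix -> bool} * bool)%type.

Definition st (d : info) := d.1.1.1.1.
Definition sc (d : info) : {ffun tape_ix -> sym} := d.1.1.1.2.
Definition ct (d : info) : {ffun tape_ix -> sym} := d.1.1.2.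
Definition fl (d : info) : {ffun tape_ix -> bool} := d.1.2.
Definition wt (d : info) : bool := d.2.

Definition witness_bound (s : seq bool) : nat := size s ^ cw + cw.
Definition input_bound (s : seq bool) : nat := 2 * size s + 1 + witness_bound s.
(** Beyond the running time, the summand [input_bound s] lets the input fit to the right of the
    centre. The columns leave room on both sides for the heads, which move at most [rows s] cells,
    and for a border of unreliable cells growing by one per row. *)
Definition rows (s : seq bool) : nat := input_bound s ^ dt + dt + input_bound s.
Definition centre (s : seq bool) : nat := 2 * rows s + 2.
Definition cols (s : seq bool) : nat := 4 * rows s + 5.
Definition cells (s : seq bool) : nat := (rows s).+1 * cols s.

(* [d1], [d2], [d3] are consecutive in a row and [d4] is below [d2]. *)
Definition window_ok (d1 d2 d3 d4 : info) : bool :=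
  [&& st d1 == st d2, st d2 == st d3, sc d1 == sc d2, sc d2 == sc d3,
    (wt d2 && (ct d2 ord0 == None)) ==> (ct d3 ord0 == None) &
    if tm_halt (st d2) then [&& st d4 == st d2, ct d4 == ct d2 & fl d4 == fl d2]
    else let qa := tm_trans (st d2) (sc d2) in
      [&& st d4 == qa.1,
          ct d4 == [ffun t => if fl d2 t then (qa.2 t).1 else ct d2 t] &
          fl d4 == [ffun t => match (qa.2 t).2 with
                              | MoveLeft => fl d3 t
                              | Stay => fl d2 t
                              | MoveRight => fl d1 t
                              end]]].

(** Spells [pair_string s w] from the centre on, with [w] left open: its cells may hold any bit or a
    blank, and [window_ok] forces blanks to be followed by blanks. *)
Definition first_content (s : seq bool) (p : nat) (y : sym) : bool :=
  if p < centre s then y == None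
  else if p - centre s < 2 * size s then
    y == Some (inl (((p - centre s) %% 2 == 0) || nth false s ((p - centre s) %/ 2)))
  else if p - centre s == 2 * size s then y == Some (inl false)
  else if p - centre s < input_bound s then (if y is Some (inr _) then false else true)
  else y == None.

Definition first_row (s : seq bool) (p : nat) (d : info) : bool :=
  [&& st d == tm_start M, [forall t, fl d t == (p == centre s)],
      [forall t, (t != ord0) ==> (ct d t == None)],
      wt d == (centre s + 2 * size s < p) & first_content s p (ct d ord0)].

(** Heads of different tapes stand in different columns, so every cell carries a copy of all scanned
    symbols. The copies agree along a row by [window_ok] and are compared here with the contents
    under the heads, which makes a transition a local condition. The last row must show the
    accepting bit at the origin of the output tape. *)
Definition cell_ok (s : seq bool) (u : nat) (d : info) : bool :=
  [&& [forall t, fl d t ==> (ct d t == sc d t)],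
      (u %/ cols s == 0) ==> first_row s (u %% cols s) d &
      (u %/ cols s == rows s) && (u %% cols s == centre s) ==>
        (ct d ord_max == Some (inl true))].

(* Rows are stored one after the other in a single array of variables. *)
Definition window (s : seq bool) (a b c e : nat) : bool :=
  [&& b == a + 1, c == a + 2, e == b + cols s & a %% cols s + 2 < cols s].

Lemma computable_witness_bound : computable (fun s _ => witness_bound s).
Proof. exact: computable_add (computable_exp _ computable_size) (computable_const _). Qed.

Lemma computable_input_bound : computable (fun s _ => input_bound s).
Proof.
apply: computable_add computable_witness_bound.
exact: computable_add (computable_mul (computable_const 2) computable_size) (computable_const 1).
Qed.

Lemma computable_rows : computable (fun s _ => rows s).
Proof.
apply: computable_add computable_input_bound.
exact: computable_add (computable_exp _ computable_input_bound) (computable_const _).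
Qed.

Lemma computable_centre : computable (fun s _ => centre s).
Proof. exact: computable_add (computable_mul (computable_const 2) computable_rows) (computable_const 2). Qed.

Lemma computable_cols : computable (fun s _ => cols s).
Proof. exact: computable_add (computable_mul (computable_const 4) computable_rows) (computable_const 5). Qed.

Lemma computable_cells : computable (fun s _ => cells s).
Proof.
apply: computable_mul computable_cols.
have := computable_add computable_rows (computable_const 1).
by apply: eq_computable => s e; rewrite addn1.
Qed.

Lemma computable_ltn F G : computable F -> computable G ->
  computable_pred (fun s e => F s e < G s e).
Proof.
move=> cF cG; have := computable_leq (computable_add cF (computable_const 1)) cG.
by apply: eq_computable => s e; rewrite addn1.
Qed.

Lemma computable_eqb b P : computable_pred P -> computable_pred (fun s e => b == P s e).
Proof.
case: b => cP; last by have := computable_neg cP; apply: eq_computable => s e; case: (P s e).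
by apply: eq_computable cP => s e; case: (P s e).
Qed.

Lemma computable_eq_bit (y : sym) P : computable_pred P ->
  computable_pred (fun s e => y == Some (inl (P s e))).
Proof.
move=> cP; have := computable_if cP (computable_bool (y == Some (inl true)))
  (computable_bool (y == Some (inl false))).
by apply: eq_computable => s e; case: (P s e).
Qed.

Lemma computable_first_content F y : computable F ->
  computable_pred (fun s e => first_content s (F s e) y).
Proof.
move=> cF; have cc := computable_centre; have c2 := computable_const 2.
have cz := computable_sub cF cc; have c2s := computable_mul c2 computable_size.
have c0 := computable_const 0.
have bits : computable_pred (fun s e => y == Some (inl (((F s e - centre s) %% 2 == 0) ||
    nth false s ((F s e - centre s) %/ 2)))).
  apply: computable_eq_bit; apply: computable_or.
    exact: computable_eqn (computable_mod cz c2) c0.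
  exact: computable_bit (computable_div cz c2).
have := computable_if (computable_ltn cF cc) (computable_bool (y == None))
  (computable_if (computable_ltn cz c2s) bits
  (computable_if (computable_eqn cz c2s) (computable_bool (y == Some (inl false)))
  (computable_if (computable_ltn cz computable_input_bound)
     (computable_bool (if y is Some (inr _) then false else true))
     (computable_bool (y == None))))).
by apply: eq_computable => s e; rewrite /first_content; do !case: ifP.
Qed.

Lemma computable_cell_ok d F : computable F -> computable_pred (fun s e => cell_ok s (F s e) d).
Proof.
move=> cF; have cP := computable_cols.
have crow := computable_div cF cP; have ccol := computable_mod cF cP.
apply: computable_and (computable_bool _) _; apply: computable_and; last first.
  apply: computable_imply (computable_bool _).
  exact: computable_and (computable_eqn crow computable_rows) (computable_eqn ccol computable_centre).
apply: computable_imply; first exact: computable_eqn crow (computable_const 0).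
apply: computable_and (computable_bool _) _; apply: computable_and.
  by apply: computable_forall => t; apply: computable_eqb; apply: computable_eqn computable_centre.
apply: computable_and (computable_bool _) _; apply: computable_and; last exact: computable_first_content.
apply: computable_eqb; apply: computable_ltn ccol.
exact: computable_add computable_centre (computable_mul (computable_const 2) computable_size).
Qed.

Lemma computable_window F1 F2 F3 F4 :
  computable F1 -> computable F2 -> computable F3 -> computable F4 ->
  computable_pred (fun s e => window s (F1 s e) (F2 s e) (F3 s e) (F4 s e)).
Proof.
move=> c1 c2 c3 c4; have cP := computable_cols.
apply: computable_and; first exact: computable_eqn c2 (computable_add c1 (computable_const 1)).
apply: computable_and; first exact: computable_eqn c3 (computable_add c1 (computable_const 2)).
apply: computable_and; first exact: computable_eqn c4 (computable_add c2 cP).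
exact: computable_ltn (computable_add (computable_mod c1 cP) (computable_const 2)) cP.
Qed.

Definition info_of (c : config M) (z : int) (b : bool) : info :=
  (cf_state c, [ffun t => cf_tape c t (cf_head c t)], [ffun t => cf_tape c t z],
   [ffun t => cf_head c t == z], b).

Definition agrees (d : info) (c : config M) (z : int) : Prop :=
  [/\ st d = cf_state c, forall t, ct d t = cf_tape c t z &
      forall t, fl d t = (cf_head c t == z)].

Lemma window_ok_complete (c : config M) (z : int) (b1 b2 b3 b4 : bool) :
  (b2 -> cf_tape c ord0 z = None -> cf_tape c ord0 (z + 1)%R = None) ->
  window_ok (info_of c (z - 1)%R b1) (info_of c z b2) (info_of c (z + 1)%R b3)
    (info_of (step c) z b4).
Proof.
move=> hb; rewrite /window_ok !eqxx /=; apply/andP; split.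
  by apply/implyP=> /andP[/hb {}hb]; rewrite !ffunE => /eqP/hb/eqP.
rewrite /st /sc /ct /fl /= /step; case: (tm_halt (cf_state c)) => /=; first by rewrite !eqxx.
case: (tm_trans _ _) => q a /=; rewrite eqxx /=; apply/andP; split.
  by apply/eqP/ffunP=> t; rewrite !ffunE [z == _]eq_sym.
apply/eqP/ffunP=> t; rewrite !ffunE; case: (a t).2 => //=.
  by apply/eqP/eqP; lia.
by apply/eqP/eqP; lia.
Qed.

Lemma window_ok_sound (c : config M) (z : int) (d1 d2 d3 d4 : info) : agrees d1 c (z - 1)%R -> agrees d2 c z ->
  agrees d3 c (z + 1)%R -> (forall t, sc d2 t = cf_tape c t (cf_head c t)) ->
  window_ok d1 d2 d3 d4 -> agrees d4 (step c) z.
Proof.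
move=> [s1 t1 f1] [s2 t2 f2] [s3 t3 f3] scE /and5P[_ _ _ _ /andP[_]].
have -> : sc d2 = [ffun t => cf_tape c t (cf_head c t)] by apply/ffunP=> t; rewrite scE ffunE.
rewrite s2 /step; case: ifP => [_ /and3P[/eqP e1 /eqP e2 /eqP e3]|_].
  by split=> [//|t|t]; rewrite ?e2 ?e3.
case: (tm_trans _ _) => q a /= /and3P[/eqP e1 /eqP e2 /eqP e3]; split=> [//|t|t] /=.
  by rewrite e2 ffunE f2 t2 [z == _]eq_sym.
rewrite e3 ffunE f1 f2 f3; case: (a t).2 => //=.
  by apply/eqP/eqP; lia.
by apply/eqP/eqP; lia.
Qed.

Lemma head_bound x i t :
  (- i%:Z <= cf_head (iter i (@step M) (init M x)) t <= i%:Z)%R.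
Proof.
elim: i => [|i IH] //; rewrite iterS; move: IH; set c := iter i _ _ => IH.
rewrite /step; case: ifP => _; first by lia.
case: (tm_trans _ _) => q a /=; case: (a t).2 => /=; lia.
Qed.

(** * Correctness of the tableau *)

Section Instance.

Variable s : seq bool.
Notation T := (rows s).
Notation P := (cols s).
Notation C := (centre s).

Lemma cell_row i p : p < P -> (i * P + p) %/ P = i.
Proof. by move=> pP; rewrite divnMDl ?(leq_ltn_trans _ pP) // divn_small ?addn0. Qed.

Lemma cell_col i p : p < P -> (i * P + p) %% P = p.
Proof. by move=> pP; rewrite modnMDl modn_small. Qed.

Lemma cell_lt i p : i <= T -> p < P -> i * P + p < cells s.
Proof.
move=> iT pP; rewrite /cells; apply: (@leq_trans (i.+1 * P)); last by rewrite leq_mul2r ltnS iT orbT.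
by rewrite mulSn addnC ltn_add2r.
Qed.

Variable V : seq bool -> bool.
Hypothesis MV : forall x, let final := iter (size x ^ dt + dt) (@step M) (init M x) in
  tm_halt (cf_state final) /\ cf_tape final ord_max =1 @string_tape M [:: V x].

Lemma final_row x : size x <= input_bound s ->
  cf_tape (iter T (@step M) (init M x)) ord_max 0%R = Some (inl (V x)).
Proof.
move=> xs; have [halted out] := MV x.
have le : size x ^ dt + dt <= T.
  rewrite /rows (leq_trans _ (leq_addr _ _)) // leq_add2r.
  by case: (dt) => // d; rewrite leq_exp2r.
rewrite -(subnK le) iterD (_ : iter (T - _) _ _ = iter (size x ^ dt + dt) (@step M) (init M x)).
  by rewrite out.
by elim: (T - _) => //= n ->; rewrite /step halted.
Qed.

Lemma string_tapeE (x : seq bool) (z : nat) : @string_tape M x (Posz z) =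
  if z < size x then Some (inl (nth false x z)) else None.
Proof.
rewrite /=; case: ltnP => h; first by rewrite (nth_map false).
by rewrite nth_default // size_map.
Qed.

Lemma first_content_complete w p : size w <= witness_bound s -> p < P ->
  first_content s p (@string_tape M (pair_string s w) (p%:Z - C%:Z)%R).
Proof.
move=> ws pP; rewrite /first_content; case: (ltnP p C) => pC.
  by have -> : (p%:Z - C%:Z)%R = Negz (C - p).-1 by lia.
have -> : (p%:Z - C%:Z)%R = Posz (p - C) by lia.
rewrite string_tapeE size_pair_string nth_pair_string; move: (p - C) => z.
rewrite modn2 eqb0 divn2.
case: (ltnP z (2 * size s)) => h1.
  by rewrite (leq_trans h1) ?eqxx // -addnA leq_addr.
case: eqP => [->|h2].
  by have -> : 2 * size s < 2 * size s + 1 + size w by lia.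
rewrite /input_bound; case: ltnP => h3; first by case: ifP.
case: ifP => //; move: h3; rewrite ltnNge => h3.
by rewrite (leq_trans _ h3) // leq_add2l.
Qed.

Lemma tableau_complete w : size w <= witness_bound s -> V (pair_string s w) ->
  satisfiable cells cell_ok window window_ok s.
Proof.
move=> ws Vw; set x := pair_string s w.
pose cfg i := iter i (@step M) (init M x).
pose wit i p := (i == 0) && (C + 2 * size s < p).
pose sigma u := info_of (cfg (u %/ P)) ((u %% P)%:Z - C%:Z)%R (wit (u %/ P) (u %% P)).
have P0 : 0 < P by rewrite /cols addn_gt0 orbT.
exists (fun u => sigma (nat_of_ord u)); split=> [[u uQ]|[a aQ] [b bQ] [c cQ] [e eQ]] /=.
  rewrite /cell_ok /sigma; set i := u %/ P; set p := u %% P.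
  have pP : p < P by rewrite ltn_mod.
  apply/and3P; split.
  - by apply/forallP=> t; apply/implyP; rewrite /fl /ct /sc !ffunE => /eqP->.
  - apply/implyP=> /eqP i0; rewrite i0; apply/and5P; split.
    + by rewrite /st /= eqxx.
    + apply/forallP=> t; rewrite /fl ffunE /=; apply/eqP; apply/eqP/eqP; lia.
    + by apply/forallP=> t; apply/implyP=> t0; rewrite /ct ffunE /= (negbTE t0).
    + by rewrite /wt /= /wit eqxx.
    by rewrite /ct ffunE /=; apply: first_content_complete.
  apply/implyP=> /andP[/eqP iT /eqP pC]; rewrite /ct ffunE iT pC subrr /cfg final_row ?Vw //.
  by rewrite size_pair_string /input_bound leq_add2l.
rewrite /window => /and4P[/eqP bE /eqP cE /eqP eE lt].
have [aE pP] : a = a %/ P * P + a %% P /\ a %% P < P by rewrite {1}(divn_eq a P) ltn_mod.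
move: (a %/ P) (a %% P) aE pP lt => i p aE pP lt.
have bE' : b = i * P + (p + 1) by rewrite bE aE addnA.
have cE' : c = i * P + (p + 2) by rewrite cE aE addnA.
have eE' : e = i.+1 * P + (p + 1) by rewrite eE bE' mulSn; lia.
rewrite /sigma aE bE' cE' eE' !cell_row ?cell_col; try lia.
have -> : (p%:Z - C%:Z)%R = ((p + 1)%N%:Z - C%:Z - 1)%R by lia.
have -> : ((p + 2)%N%:Z - C%:Z)%R = ((p + 1)%N%:Z - C%:Z + 1)%R by lia.
apply: window_ok_complete => /andP[/eqP -> ltp] /=.
have -> : ((p + 1)%N%:Z - C%:Z)%R = Posz (p + 1 - C) by lia.
have -> : (Posz (p + 1 - C) + 1)%R = Posz (p + 1 - C).+1 by lia.
by rewrite !string_tapeE; case: ltnP => // h _; rewrite ltnNge leqW.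
Qed.

Lemma window_ok_sc d1 d2 d3 d4 : window_ok d1 d2 d3 d4 -> sc d2 = sc d3.
Proof. by case/and5P=> _ _ _ /eqP. Qed.

Lemma tableau_sound : satisfiable cells cell_ok window window_ok s ->
  exists w, size w <= witness_bound s /\ V (pair_string s w).
Proof.
case=> sigma [hun hwin]; set W := witness_bound s.
have T0 : 0 < T by rewrite /rows /input_bound; lia.
have P0 : 0 < P by rewrite /cols; lia.
have Q0 : 0 < cells s by rewrite muln_gt0.
pose tau u := if insub u is Some v then sigma v else sigma (Ordinal Q0).
have tauE u (uQ : u < cells s) : tau u = sigma (Ordinal uQ) by rewrite /tau insubT.
pose g i p := tau (i * P + p).
have gun i p : i <= T -> p < P -> cell_ok s (i * P + p) (g i p).
  by move=> iT pP; rewrite /g (tauE _ (cell_lt iT pP)); apply: hun.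
have gwin i p : i < T -> 0 < p -> p.+1 < P ->
    window_ok (g i p.-1) (g i p) (g i p.+1) (g i.+1 p).
  case: p => // p iT _ pP.
  have h1 : p < P by lia.
  have h2 : p.+1 < P by lia.
  rewrite /g (tauE _ (cell_lt (ltnW iT) h1)) (tauE _ (cell_lt (ltnW iT) h2)).
  rewrite (tauE _ (cell_lt (ltnW iT) pP)) (tauE _ (cell_lt iT h2)).
  by apply: hwin; rewrite /window /= cell_col // mulSn; lia.
have fr p : p < P -> first_row s p (g 0 p).
  by move=> pP; have /and3P[_] := gun 0 p isT pP; rewrite mul0n divn_small // modn_small // eqxx.
pose y j := ct (g 0 (C + (2 * size s).+1 + j)) ord0.
(* The witness ends at the first blank among its [W] cells, or fills all of them. *)
pose J := find (fun j => y j == None) (iota 0 W).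
have JW : J <= W by have := find_size (fun j => y j == None) (iota 0 W); rewrite size_iota.
pose w := [seq y j == Some (inl true) | j <- iota 0 J].
have sw : size w = J by rewrite size_map size_iota.
have CP : C + input_bound s < P by rewrite /centre /cols /rows; lia.
(* Inside the witness part blanks propagate to the right by [window_ok]; beyond it [first_content]
   demands them. *)
have yNone j : J <= j -> C + (2 * size s).+1 + j < P -> y j = None.
  elim: j => [|j IH] Jj jP.
    have [W0|W0] := posnP W.
      have /and5P[_ _ _ _] := fr _ jP; rewrite /first_content /input_bound -/W W0.
      rewrite -/(y 0) !ifF; try lia.
      by move/eqP.
    have := @nth_find _ 0 (fun j => y j == None) (iota 0 W).
    rewrite -/J; move: Jj; rewrite leqn0 => /eqP J0; rewrite J0 nth_iota //.
    rewrite has_find -/J J0 size_iota W0 => /(_ isT)/eqP; by rewrite add0n.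
  have [jW|jW] := leqP W j.+1.
    have /and5P[_ _ _ _] := fr _ jP; rewrite /first_content /input_bound -/W.
    rewrite -/(y j.+1) !ifF; try lia.
    by move/eqP.
  move: Jj; rewrite leq_eqVlt => /orP[/eqP JE|Jj].
    have := @nth_find _ 0 (fun j => y j == None) (iota 0 W).
    by rewrite -/J nth_iota JE // add0n has_find -/J JE size_iota => /(_ jW)/eqP.
  have jP' : C + (2 * size s).+1 + j < P by lia.
  have /and5P[_ _ _ /eqP wtE _] := fr _ jP'.
  have /and5P[_ _ _ _ /andP[/implyP h _]] := gwin 0 (C + (2 * size s).+1 + j) T0 ltac:(lia) ltac:(lia).
  rewrite /y addnS; apply/eqP/h; rewrite -/(y j) IH // eqxx andbT wtE.
  by lia.
have first_tape z : C + z < P -> ct (g 0 (C + z)) ord0 = @string_tape M (pair_string s w) (Posz z).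
  move=> zP; rewrite string_tapeE size_pair_string nth_pair_string sw.
  have /and5P[_ _ _ _] := fr _ zP; rewrite /first_content addKn ltnNge leq_addr /=.
  rewrite modn2 eqb0 divn2.
  case: (ltnP z (2 * size s)) => h1.
    have -> : z < 2 * size s + 1 + J by lia.
    by move=> /eqP.
  case: (z =P _) => [-> /eqP ->|h2 yOK].
    by have -> : 2 * size s < 2 * size s + 1 + J by lia.
  have zE : C + z = C + (2 * size s).+1 + (z - (2 * size s).+1) by lia.
  have jP : C + (2 * size s).+1 + (z - (2 * size s).+1) < P by rewrite -zE.
  move: yOK; rewrite zE -/(y (z - (2 * size s).+1)).
  set j := z - (2 * size s).+1 in jP *; case: (ltnP z (2 * size s + 1 + J)) => zJ yOK.
    have jJ : j < J by rewrite /j; lia.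
    have := before_find 0 (jJ : j < find (fun j => y j == None) (iota 0 W)).
    rewrite nth_iota ?add0n; last by lia.
    rewrite (nth_map 0) ?size_iota // nth_iota // add0n.
    have zW : z < input_bound s by rewrite /input_bound -/W; lia.
    move: yOK; rewrite zW; case: (y j) => [[b|b]|] // _ _.
    by case: b.
  by apply: yNone => //; rewrite /j; lia.
exists w; rewrite sw; split=> //; set x := pair_string s w.
have sx : size x <= input_bound s by rewrite size_pair_string sw /input_bound leq_add2l.
pose cfg i := iter i (@step M) (init M x).
(* Nothing constrains the two ends of the rows, so row [i] is only known to be
   right at distance more than [i] from them. *)
have inv i : i <= T -> forall p, i < p -> p + i.+1 < P ->
    agrees (g i p) (cfg i) (p%:Z - C%:Z)%R.
  elim: i => [|i IH] iT p ip pP.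
    have pP' : p < P by lia.
    have /and5P[/eqP h1 /forallP h2 /forallP h3 _ h5] := fr p pP'.
    split=> [//|t|t] /=.
      case: eqP => [->|/eqP t0]; last by have /implyP/(_ t0)/eqP := h3 t.
      have [pC|pC] := ltnP p C.
        have -> : (p%:Z - C%:Z)%R = Negz (C - p).-1 by lia.
        by move: h5; rewrite /first_content pC => /eqP.
      have -> : (p%:Z - C%:Z)%R = Posz (p - C) by lia.
      by rewrite -first_tape subnKC.
    by rewrite (eqP (h2 t)); apply/eqP/eqP; lia.
  have {}IH := IH (ltnW iT).
  (* The copies [sc] are constant along the reliable part of a row, so they can be evaluated at the
     cell under a head, which lies in that part. *)
  have sc_shift n q : i < q -> q + n + i.+1 < P -> sc (g i (q + n)) = sc (g i q).
    elim: n => [|n IHn] iq qP; first by rewrite addn0.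
    rewrite addnS -IHn; try lia.
    by rewrite (window_ok_sc (gwin i (q + n) iT ltac:(lia) ltac:(lia))).
  have sc_const q q' : i < q -> i < q' -> q + i.+1 < P -> q' + i.+1 < P ->
      sc (g i q) = sc (g i q').
    move=> iq iq' qP qP'; have [le|le] := leqP q q'.
      by rewrite -(subnKC le) sc_shift // subnKC.
    by rewrite -(subnKC (ltnW le)) sc_shift // subnKC // ltnW.
  rewrite /cfg iterS -/(cfg i); apply: (@window_ok_sound _ _ (g i p.-1) (g i p) (g i p.+1)).
  - have -> : (p%:Z - C%:Z - 1)%R = (p.-1%:Z - C%:Z)%R by lia.
    by apply: IH; lia.
  - by apply: IH; lia.
  - have -> : (p%:Z - C%:Z + 1)%R = (p.+1%:Z - C%:Z)%R by lia.
    by apply: IH; lia.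
  - move=> t; have hb := head_bound x i t; rewrite -/(cfg i) in hb.
    have [q qE] : exists q : nat, (q%:Z = C%:Z + cf_head (cfg i) t)%R.
      by exists `|(C%:Z + cf_head (cfg i) t)%R|%N; rewrite /centre in hb *; lia.
    have iq : i < q by rewrite /centre in qE; lia.
    have qP : q + i.+1 < P by rewrite /centre /cols in qE *; lia.
    rewrite (sc_const p q); try lia.
    have [_ ctE flE] := IH q iq qP.
    have hE : cf_head (cfg i) t = (q%:Z - C%:Z)%R by lia.
    have /and3P[/forallP/(_ t)/implyP h _ _] := gun i q (ltnW iT) ltac:(lia).
    by rewrite -(eqP (h _)) ?flE ?ctE hE.
  by apply: gwin; lia.
have [||_ ctE _] := inv T (leqnn T) C; try by rewrite /centre /cols; lia.
have CP' : C < P by rewrite /centre /cols; lia.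
have /and3P[_ _] := gun T C (leqnn T) CP'.
rewrite cell_row // cell_col // !eqxx /= => /eqP; rewrite ctE subrr final_row // => -[].
exact.
Qed.

End Instance.
End Tableau.

(** * Odd closed walks and the theorem *)

Section OddWalk.

Variable G : graph.

(** The bipartite double cover of [G]: a path between the two copies of [u] is an odd closed walk at
    [u]. *)
Definition double_edge : rel (G * bool) := fun x y => edge x.1 y.1 && (x.2 != y.2).

Lemma double_connect_sym : connect_sym double_edge.
Proof.
by apply: sym_connect_sym => x y; rewrite /double_edge edge_sym eq_sym.
Qed.

Lemma double_connect_lift (r u : G) : connect (@edge G) r u ->
  exists b, connect double_edge (r, true) (u, b).
Proof.
case/connectP=> p; elim/last_ind: p u => [|p v IH] u.
  by move=> _ ->; exists true; apply: connect0.
rewrite rcons_path last_rcons => /andP[pp ev] ->.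
have [b cb] := IH _ pp erefl; exists (~~ b); apply: connect_trans cb (connect1 _).
by rewrite /double_edge /= ev; case: b.
Qed.

(** Otherwise the root of each component reaches every vertex of it in exactly one of its two
    copies, and which copy it is gives a bipartition. *)
Lemma odd_closed_walk : ~ bipartite G ->
  exists u, connect double_edge (u, true) (u, false).
Proof.
move=> nb; apply/existsP; apply: contraT => /existsPn no; case: nb.
have e_sym : connect_sym (@edge G) by apply: sym_connect_sym; apply: edge_sym.
pose r := fingraph.root (@edge G); exists [set u | connect double_edge (r u, true) (u, true)].
have one (w u : G) : ~~ (connect double_edge (w, true) (u, true) &&
                         connect double_edge (w, true) (u, false)).
  apply: contra (no u) => /andP[c1 c2]; apply: connect_trans c2.
  by rewrite double_connect_sym.
move=> u v uv; have rv : r v = r u.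
  by apply/(fingraph.rootP e_sym); apply: connect1; rewrite edge_sym.
have step b : connect double_edge (r u, true) (u, b) -> connect double_edge (r u, true) (v, ~~ b).
  by move=> h; apply: connect_trans h (connect1 _); rewrite /double_edge /= uv; case: b.
rewrite !inE rv; have := one (r u) u; have := one (r u) v.
have [c hc] : exists c, connect double_edge (r u, true) (u, c).
  by apply: double_connect_lift; rewrite e_sym connect_root.
case: c hc => hc; rewrite hc /=.
  by have := step _ hc; rewrite /= => ->; rewrite andbT => /negbTE ->.
by rewrite andbT => _ /negbTE ->; have := step _ hc; rewrite /= => ->.
Qed.

Lemma double_path_odd x p : path double_edge x p -> (last x p).2 = x.2 (+) odd (size p).
Proof.
elim: p x => [|y p IH] x /=; first by rewrite addbF.
case/andP=> /andP[_ xy] /IH ->; case: (x.2) (y.2) xy => [] [] //= _.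
by case: (odd _).
Qed.

Lemma nonbipartite_odd_cycle : ~ bipartite G -> (forall u : G, ~~ edge u u) ->
  exists k (g : 'Z_(k.*2.+3) -> G), forall x, edge (g x) (g (x + 1)%R).
Proof.
move=> nb loopless; have [u /connectP[p pp lastp]] := odd_closed_walk nb.
have p_odd : odd (size p) by have := double_path_odd pp; rewrite -lastp /=; case: odd.
have /(pathP (u, true)) stepp := pp.
(* A closed walk of length one would be a loop, so the odd length is at least three. *)
have [k kE] : exists k, size p = k.*2.+3.
  case: p pp lastp p_odd stepp => [|x [|y [|z p]]] // pp lastp p_odd stepp.
    by move: lastp pp => /= <-; rewrite /double_edge /= (negbTE (loopless u)).
  by exists (size p)./2; rewrite /= -[in LHS](odd_double_half (size p)); move: p_odd => /=; case: odd.
exists k, (fun x => (nth (u, true) ((u, true) :: p) x).1) => x.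
have xp : x < size p by rewrite kE; apply: ltn_ord.
have /andP[+ _] := stepp x xp; congr edge.
have -> : nat_of_ord (x + 1)%R = (x + 1) %% (k.*2.+3) by rewrite /= modnDmr.
rewrite addn1; have [xl|xl] := eqVneq x.+1 (size p).
  by rewrite xl kE modnn /= -[nat_of_ord x]/(x.+1.-1) xl nth_last -(lastp) //=; case: (p) xp lastp => //= ? ? _ <-.
by rewrite modn_small //; move: xp xl; rewrite kE; lia.
Qed.

End OddWalk.

Theorem theorem1p1 (G : graph) (hnb : ~ bipartite G)
    (h4 : hom_to G (complete_graph 4)) :
  NP_hard (PCSP G (complete_graph 4)).
Proof.
have loopless (u : G) : ~~ edge u u.
  by have [f hf] := h4; apply/negP=> /hf; rewrite /= eqxx.
have [k [g hg]] := nonbipartite_odd_cycle hnb loopless.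
move=> L [V [cw [[M [dt MV]] LV]]].
have Q0 s : 0 < cells cw dt s by rewrite muln_gt0 /= /cols addn_gt0 orbT.
exists (computable_graph (vertex_count k (info M) (cells cw dt))
  (vertex_adj k (cells cw dt) (@cell_ok M cw dt) (@window cw dt) (@window_ok M))).
split.
  apply: polytime_reduction; first exact: computable_cells.
    by move=> d F; apply: computable_cell_ok.
  by move=> F1 F2 F3 F4; apply: computable_window.
split=> s sL; exists (reduction_graph k (cells cw dt) (@cell_ok M cw dt) (@window cw dt) (@window_ok M) s).
  split; first exact: reduction_graph_code.
  have /LV[w [ws Vw]] := sL; apply: (reduction_yes Q0 hg).
  exact (tableau_complete MV ws Vw).
split; first exact: reduction_graph_code.
move=> /(reduction_no Q0)/(tableau_sound MV)[w [ws Vw]].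
by apply: sL; apply/LV; exists w.
Qed.
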